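(* Let $R$ be an associative ring with identity, $m\in\mathbb{Z}_{\geq 0}$, and let $(\mathcal{X},\omega)$ be a Frobenius pair in the category ${}_R\mathsf{Mod}$ of left $R$-modules which is totally left $\omega^\wedge_m$-complete in $\mathcal{X}^{\perp_1}$ and such that $R\in\mathcal{X}$. The following assertions hold for Frobenius pairs in the category ${}_R\mathsf{Ch}$ of chain complexes of left $R$-modules: (1) $(\mathrm{dw}\,\widetilde{\mathcal{X}},\widetilde{\omega})$ is left $\widetilde{\omega}^\wedge_m$-complete in $[\mathrm{dw}\,\widetilde{\mathcal{X}}]^{\perp_1}$. (2) $(\mathrm{dg}\,\widetilde{\mathcal{X}},\widetilde{\omega})$ is left $\widetilde{\omega}^\wedge_m$-complete in $[\mathrm{dg}\,\widetilde{\mathcal{X}}]^{\perp_1}$. If in addition $\mathcal{X}$ is closed under coproducts, then: (3) $(\widetilde{\mathcal{X}},\widetilde{\omega})$ is left $\widetilde{\omega}^\wedge_m$-complete in $[\widetilde{\mathcal{X}}]^{\perp_1}$. (4) $(\mathrm{ex}\,\widetilde{\mathcal{X}},\widetilde{\omega})$ is left $\widetilde{\omega}^\wedge_m$-complete in $[\mathrm{ex}\,\widetilde{\mathcal{X}}]^{\perp_1}$.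
   Context: In an abelian category $\mathfrak C$ and for a class $\mathcal X$: $\mathcal{X}^{\perp_i}=\{N: \mathrm{Ext}^i(X,N)=0\ \forall X\in\mathcal X\}$ for $i>0$, $\mathcal{X}^\perp=\bigcap_{i>0}\mathcal{X}^{\perp_i}$. $\mathcal{X}^\wedge_m$ is the class of objects $M$ having an exact sequence $0\to X_m\to\cdots\to X_0\to M\to 0$ with all $X_i\in\mathcal{X}$; $\widetilde\omega^\wedge_m=(\widetilde\omega)^\wedge_m$, computed in ${}_R\mathsf{Ch}$. $A\rightarrowtail B\twoheadrightarrow C$ denotes a short exact sequence. A (left) Frobenius pair $(\mathcal{X},\omega)$: $\mathcal{X}$ is closed under extensions, kernels of epimorphisms between its objects, and direct summands; $\omega$ is closed under direct summands; $\mathrm{Ext}^i(X,W)=0$ for all $X\in\mathcal X$, $W\in\omega$, $i>0$; $\omega\subseteq\mathcal X$ and every $X\in\mathcal X$ admits a short exact sequence $X\rightarrowtail W\twoheadrightarrow X'$ with $W\in\omega$, $X'\in\mathcal X$. A Frobenius pair $(\mathcal X,\omega)$ is left (resp. totally left) $\omega^\wedge_m$-complete in $\mathcal X^{\perp_1}$ if for every $M\in\mathcal{X}^{\perp_1}$ there is a short exact sequence $K'\rightarrowtail L\twoheadrightarrow M$ with $L\in\omega^\wedge_m$ and $K'\in[\omega^\wedge_m]^{\perp_1}$ (resp. $K'\in[\omega^\wedge_m]^{\perp}$). Classes of complexes: $\mathrm{dw}\,\widetilde{\mathcal X}$ = complexes $X_\bullet$ with $X_k\in\mathcal X$ for all $k$;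 $\widetilde{\mathcal X}$ (resp. $\widetilde\omega$) = exact complexes with all cycles $Z_k=\ker\partial_k$ in $\mathcal X$ (resp. $\omega$); $\mathrm{ex}\,\widetilde{\mathcal X}$ = exact complexes in $\mathrm{dw}\,\widetilde{\mathcal X}$; $\mathrm{dg}\,\widetilde{\mathcal X}$ = complexes $X_\bullet\in\mathrm{dw}\,\widetilde{\mathcal X}$ such that $\mathcal{H}om(X_\bullet,W_\bullet)$ is exact for every $W_\bullet\in\widetilde\omega$, where $\mathcal{H}om(X_\bullet,W_\bullet)_n=\prod_{k}\mathrm{Hom}_R(X_k,W_{n+k})$ with differential $(f_k)_k\mapsto(\partial_{n+k}f_k-(-1)^nf_{k-1}\partial_k)_k$. If $(\mathcal X,\omega)$ is a Frobenius pair in ${}_R\mathsf{Mod}$, then the four pairs in (1)–(4) are Frobenius pairs in ${}_R\mathsf{Ch}$. *)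

(* Defs.v *)
From Stdlib Require Import Relations.Relation_Operators.
From HB Require Import structures.
From mathcomp Require Import all_boot all_order all_algebra.

Set Implicit Arguments.
Unset Strict Implicit.
Unset Printing Implicit Defensive.

Import GRing.Theory.
Local Open Scope ring_scope.

(* The data of an abelian category, equipped with its notion of exactness of
   A -> B -> C at B.  Morphisms are compared by [heq] (pointwise equality in
   the instances below).  Only the data are recorded: the two categories used
   are [Mod R] and [Ch R]. *)
Record abcat := AbCat {
  obj :> Type;
  mor : obj -> obj -> Type;
  heq : forall A B, mor A B -> mor A B -> Prop;
  idm : forall A, mor A A;
  compm : forall A B C, mor B C -> mor A B -> mor A C;
  zerom : forall A B, mor A B;
  addm : forall A B, mor A B -> mor A B -> mor A B;
  is_exact : forall A B C, mor A B -> mor B C -> Prop }.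

Arguments idm {_} _.
Arguments zerom {_} _ _.

Notation "f =h g" := (heq f g) (at level 70, no associativity).
Notation "g ∘ f" := (compm g f) (at level 40, left associativity).

Definition obj_class (C : abcat) := obj C -> Prop.

Section Generic.
Variable C : abcat.
Implicit Types (A B D M N : C) (X w : obj_class C) (n m j : nat).

(* Exactness of 0 -> A -> B, where the image of 0 is that of 0 : A -> A. *)
Definition is_mono A B (f : mor A B) : Prop := is_exact (zerom A A) f.

Definition is_epi A B (f : mor A B) : Prop := is_exact f (zerom B B).

Definition short_exact A B D (f : mor A B) (g : mor B D) : Prop :=
  [/\ is_mono f, is_exact f g & is_epi g].

(* A = B (+) D, by biproduct equations *)
Definition biproduct A B D (i1 : mor B A) (p1 : mor A B)
    (i2 : mor D A) (p2 : mor A D) : Prop :=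
  [/\ p1 ∘ i1 =h idm B, p2 ∘ i2 =h idm D,
      p1 ∘ i2 =h zerom D B, p2 ∘ i1 =h zerom B D
    & addm (i1 ∘ p1) (i2 ∘ p2) =h idm A].

Definition direct_summand B A : Prop :=
  exists (D : C) (i1 : mor B A) (p1 : mor A B) (i2 : mor D A) (p2 : mor A D),
    biproduct i1 p1 i2 p2.

Definition is_coproduct (I : Type) (F : I -> C) A
    (inj : forall i, mor (F i) A) : Prop :=
  forall (B : C) (f : forall i, mor (F i) B),
    exists u : mor A B, (forall i, u ∘ inj i =h f i) /\
      forall v : mor A B, (forall i, v ∘ inj i =h f i) -> v =h u.

Definition closed_coproducts X : Prop :=
  forall (I : Type) (F : I -> C) A (inj : forall i, mor (F i) A),
    is_coproduct inj -> (forall i, X (F i)) -> X A.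

Definition closed_extensions X : Prop :=
  forall A B D (f : mor A B) (g : mor B D),
    short_exact f g -> X A -> X D -> X B.

Definition closed_kernels_epi X : Prop :=
  forall A B D (f : mor A B) (g : mor B D),
    short_exact f g -> X B -> X D -> X A.

Definition closed_summands X : Prop :=
  forall A B, direct_summand B A -> X A -> X B.

(* A sequence ... -> E 1 -> E 0 -> M is given by its objects [E] and maps
   [d j : E j -> aug M E j], so that [d 0 : E 0 -> M] and
   [d j.+1 : E j.+1 -> E j].  Only finitely many of the E j are relevant in
   what follows; the others are arbitrary. *)
Definition aug M (E : nat -> C) j : C := if j is j'.+1 then E j' else M.

Definition aug_hom M (E E' : nat -> C) (phi : forall j, mor (E j) (E' j)) j :
    mor (aug M E j) (aug M E' j) :=
  match j return mor (aug M E j) (aug M E' j) with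
  | 0%N => idm M
  | j'.+1 => phi j'
  end.

Definition exact_upto n M (E : nat -> C)
    (d : forall j, mor (E j) (aug M E j)) : Prop :=
  is_epi (d 0%N) /\
  forall j, (j < n)%N -> @is_exact C (E j.+1) (E j) (aug M E j) (d j.+1) (d j).

(* 0 -> X_m -> ... -> X_0 -> M -> 0 exact with all X_j in X *)
Definition wedge X m : obj_class C := fun M =>
  exists (E : nat -> C) (d : forall j, mor (E j) (aug M E j)),
    [/\ exact_upto m d, is_mono (d m) & forall j, (j <= m)%N -> X (E j)].

(* Exact sequences 0 -> N -> E_n -> ... -> E_0 -> M -> 0, that is, Yoneda
   extensions of degree n + 1 of M by N *)
Record extension n M N := Extension {
  ext_obj : nat -> C;
  ext_d : forall j, mor (ext_obj j) (aug M ext_obj j);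
  ext_in : mor N (ext_obj n);
  ext_exact_upto : exact_upto n ext_d;
  ext_exact_in : is_exact ext_in (ext_d n);
  ext_mono_in : is_mono ext_in }.

(* There is a morphism of extensions which is the identity on M and N. *)
Definition ext_le n M N (E E' : extension n M N) : Prop :=
  exists phi : forall j, mor (ext_obj E j) (ext_obj E' j),
    (forall j, (j <= n)%N -> ext_d E' j ∘ phi j =h aug_hom M phi j ∘ ext_d E j)
    /\ phi n ∘ ext_in E =h ext_in E'.

Definition yoneda_equiv n M N : extension n M N -> extension n M N -> Prop :=
  clos_refl_sym_trans _ (@ext_le n M N).

(* Ext^i(M, N) = 0 for i > 0: there is only one Yoneda class. *)
Definition Ext_zero i M N : Prop :=
  forall E E' : extension i.-1 M N, yoneda_equiv E E'.

Definition perp_i X i : obj_class C := fun N => forall M, X M -> Ext_zero i M N.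

Definition perp X : obj_class C := fun N => forall i, (0 < i)%N -> perp_i X i N.

Record frobenius_pair X w : Prop := FrobeniusPair {
  frob_ext : closed_extensions X;
  frob_ker : closed_kernels_epi X;
  frob_summand : closed_summands X;
  frob_summand_w : closed_summands w;
  frob_Ext : forall M W, X M -> w W -> forall i, (0 < i)%N -> Ext_zero i M W;
  frob_sub : forall W, w W -> X W;
  frob_cogen : forall M, X M -> exists (W M' : C) (f : mor M W) (g : mor W M'),
    [/\ short_exact f g, w W & X M'] }.

Definition left_complete m X w : Prop :=
  frobenius_pair X w /\
  forall M, perp_i X 1 M ->
    exists (K L : C) (f : mor K L) (g : mor L M),
      [/\ short_exact f g, wedge w m L & perp_i (wedge w m) 1 K].

Definition totally_left_complete m X w : Prop :=
  frobenius_pair X w /\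
  forall M, perp_i X 1 M ->
    exists (K L : C) (f : mor K L) (g : mor L M),
      [/\ short_exact f g, wedge w m L & perp (wedge w m) K].

(* The kernel of f is defined up to isomorphism. *)
Definition kernel_in X A B (f : mor A B) : Prop :=
  exists (K : C) (k : mor K A), [/\ is_mono k, is_exact k f & X K].

End Generic.

Definition lin_exact (R : pzRingType) (A B D : lmodType R)
    (f : {linear A -> B}) (g : {linear B -> D}) : Prop :=
  forall y, g y = 0 <-> exists x, f x = y.

Definition Mod (R : pzRingType) : abcat :=
  {| obj := lmodType R;
     mor := fun A B => {linear A -> B};
     heq := fun A B f g => f =1 g;
     idm := fun A => (idfun : {linear A -> A});
     compm := fun A B D g f => (g \o f : {linear A -> D});
     zerom := fun A B => (\0 : {linear A -> B});
     addm := fun A B f g => (f \+ g : {linear A -> B});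
     is_exact := fun A B D f g => lin_exact f g |}.

Record chain_complex (R : pzRingType) := Complex {
  cobj :> int -> lmodType R;
  bd : forall k : int, {linear cobj k -> cobj (k - 1)};
  bd_bd : forall k x, bd (k - 1) (bd k x) = 0 }.

Arguments bd {R} c k.

Record chain_map (R : pzRingType) (A B : chain_complex R) := ChainMap {
  cmap :> forall k : int, {linear A k -> B k};
  cmap_bd : forall k x, cmap (k - 1) (bd A k x) = bd B k (cmap k x) }.

Section Complexes.
Variable R : pzRingType.
Implicit Types A B D : chain_complex R.

Definition chain_id A : chain_map A A :=
  @ChainMap R A A (fun k => (idfun : {linear A k -> A k})) (fun k x => erefl).

Program Definition chain_comp A B D (g : chain_map B D) (f : chain_map A B) :
    chain_map A D :=
  @ChainMap R A D (fun k => (g k \o f k : {linear A k -> D k})) _.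
Next Obligation. by move=> A B D g f k x /=; rewrite !cmap_bd. Qed.

Program Definition chain_zero A B : chain_map A B :=
  @ChainMap R A B (fun k => (\0 : {linear A k -> B k})) _.
Next Obligation. by move=> A B k x /=; rewrite linear0. Qed.

Program Definition chain_add A B (f g : chain_map A B) : chain_map A B :=
  @ChainMap R A B (fun k => (f k \+ g k : {linear A k -> B k})) _.
Next Obligation. by move=> A B f g k x /=; rewrite !cmap_bd linearD. Qed.

Definition Ch : abcat :=
  {| obj := chain_complex R;
     mor := @chain_map R;
     heq := fun A B f g => forall k, f k =1 g k;
     idm := chain_id;
     compm := chain_comp;
     zerom := chain_zero;
     addm := chain_add;
     is_exact := fun A B D f g => forall k, lin_exact (f k) (g k) |}.

Definition acyclic A : Prop :=
  forall k : int, lin_exact (bd A k) (bd A (k - 1)).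

Definition cast_deg A (i j : int) (e : i = j) (x : A i) : A j :=
  eq_rect i (fun k => A k) x j e.

Lemma deg_bd_l (n k : int) : n + k - 1 = n - 1 + k.
Proof. by rewrite addrAC. Qed.

Lemma deg_bd_r (n k : int) : n + (k - 1) = n - 1 + k.
Proof. by rewrite addrA addrAC. Qed.

(* The component of degree n of the Hom complex *)
Definition Hom_deg A B (n : int) := forall k : int, {linear A k -> B (n + k)}.

Definition Hom_bd A B (n : int) (f : Hom_deg A B n) (k : int) (x : A k) :
    B (n - 1 + k) :=
  cast_deg (deg_bd_l n k) (bd B (n + k) (f k x))
  - (-1) ^+ `|n|%N *: cast_deg (deg_bd_r n k) (f (k - 1) (bd A k x)).

(* Exactness in degree n - 1, for all n; as this is a complex, only the
   inclusion of the cycles in the boundaries has to be required. *)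
Definition Hom_acyclic A B : Prop :=
  forall (n : int) (f : Hom_deg A B (n - 1)),
    (forall k x, @Hom_bd A B (n - 1) f k x = 0) ->
    exists g : Hom_deg A B n, forall k x, Hom_bd g x = f k x.

Implicit Types X w : obj_class (Mod R).

Definition dw_tilde X : obj_class Ch := fun A : chain_complex R =>
  forall k, X (A k).

Definition tilde X : obj_class Ch := fun A : chain_complex R =>
  acyclic A /\ forall k, @kernel_in (Mod R) X (A k) (A (k - 1)) (bd A k).

Definition ex_tilde X : obj_class Ch := fun A : chain_complex R =>
  acyclic A /\ dw_tilde X A.

Definition dg_tilde X w : obj_class Ch := fun A : chain_complex R =>
  dw_tilde X A /\ forall W : chain_complex R, tilde w W -> Hom_acyclic A W.

End Complexes.

(* Main.v *)
From Stdlib Require Import Relations.Relation_Operators.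
From HB Require Import structures.
Require Import Defs.
From mathcomp Require Import all_boot all_order all_algebra zify.
From mathcomp Require Import boolp classical_sets.

(* Write M _|_ N for Ext^1(M, N) = 0, that is, for the splitting of all
   extensions of M by N.

   Complexes in tilde w are contractible, because w _|_ w.  Hence Hom into them
   is always acyclic, dg_tilde X w is dw_tilde X, and Ext from a complex of
   modules of X to a complex in tilde w is computed degreewise.

   If E is acyclic with cycles in the class right orthogonal to X, choose short
   exact sequences K_k -> L_k -> Z_k(E) with L_k of w-resolution dimension at
   most m and Ext^i(L, K_k) = 0 for all such L and all i > 0.  As Ext^2(L_{k-1},
   K_k) = 0, a horseshoe argument glues them to an exact sequence of acyclic
   complexes K -> L -> E.  Again by a horseshoe argument, exact complexes whose
   cycles have w-resolution dimension at most m are those of tilde w-resolution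
   dimension at most m; they are orthogonal to K.

   In (1) and (2), complexes with zero differential show that M is such an E.
   In (3) and (4), free modules lie in X.  Embed M into a contractible complex
   of injective modules and pass to the cokernel, m times: dimension shifting
   makes the result orthogonal to the complexes of tilde w-resolution dimension
   at most m.  Going back with pullbacks gives N -> E -> M with E acyclic and N
   orthogonal to these complexes and to tilde X.  Testing E against augmented
   free resolutions of the modules of X shows that the cycles of E are
   orthogonal to X, so that the construction above applies to E. *)

Set Implicit Arguments.
Unset Strict Implicit.
Unset Printing Implicit Defensive.

Import Order.TTheory GRing.Theory Num.Theory.
Local Open Scope ring_scope.

#[local] Obligation Tactic := idtac.

(** * Quotients, submodules and free modules *)

(** The hypothesis on (X, w) concerns modules, so it can only be applied to the cycles of a complex,
    and gluing the results covers the complex only if that complex is acyclic. In (1) and (2) the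
    test class is large enough to force M itself to be acyclic with orthogonal cycles. In (3) and
    (4) it is not. A contractible complex mapping onto M is acyclic, but its kernel is a shift of M,
    and orthogonality to [tilde X] gives orthogonality to complexes of [tilde w]-dimension 0 only.
    Each cosyzygy raises this bound by one, which is where the m steps come from.

    Since Ext is defined by Yoneda equivalence, its vanishing is first turned into something
    elementary: Ext^(n+1)(M, N) = 0 holds exactly when extensions of the n-th syzygy of M by N
    split. After that only splittings, and extending or lifting of maps, occur. These arguments are
    needed for modules and for complexes alike, so they are derived from a list of properties that
    both categories are shown to have. *)

Record presentation (R : pzRingType) := Presentation {
  pcar : Type;
  peq : pcar -> pcar -> Prop;
  pzero : pcar;
  padd : pcar -> pcar -> pcar;
  popp : pcar -> pcar;
  pscale : R -> pcar -> pcar;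
  peq_refl : forall x, peq x x;
  peq_sym : forall x y, peq x y -> peq y x;
  peq_trans : forall x y z, peq x y -> peq y z -> peq x z;
  peq_add : forall x x' y y', peq x x' -> peq y y' -> peq (padd x y) (padd x' y');
  peq_opp : forall x x', peq x x' -> peq (popp x) (popp x');
  peq_scale : forall a x x', peq x x' -> peq (pscale a x) (pscale a x');
  paddA : forall x y z, peq (padd x (padd y z)) (padd (padd x y) z);
  paddC : forall x y, peq (padd x y) (padd y x);
  padd0 : forall x, peq (padd pzero x) x;
  paddN : forall x, peq (padd (popp x) x) pzero;
  pscaleA : forall a b x, peq (pscale a (pscale b x)) (pscale (a * b) x);
  pscale1 : forall x, peq (pscale 1 x) x;
  pscaleDr : forall a x y, peq (pscale a (padd x y)) (padd (pscale a x) (pscale a y));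
  pscaleDl : forall x a b, peq (pscale (a + b) x) (padd (pscale a x) (pscale b x)) }.

Section PresentedModule.
Variables (R : pzRingType) (p : presentation R).

(** Equivalence classes as predicates, with representatives by choice. Submodules, quotients, free
    modules and coinduced modules are all instances, so that the module structure is built only
    once. *)
Definition pmod := {C : pcar p -> Prop | exists x, C = peq x}.

HB.instance Definition _ := gen_eqMixin pmod.
HB.instance Definition _ := gen_choiceMixin pmod.

Definition pcls (x : pcar p) : pmod := exist _ (peq x) (ex_intro _ x erefl).
Definition prep (C : pmod) : pcar p := projT1 (cid (projT2 C)).

Lemma prepK C : pcls (prep C) = C.
Proof.
case: C => C hC; apply: eq_exist; rewrite /= /prep.
by case: cid => x /= ->.
Qed.

Lemma pcls_eq x y : pcls x = pcls y <-> peq x y.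
Proof.
split=> [[e]|h]; first by rewrite e; apply: peq_refl.
apply: eq_exist; apply: funext => z; apply: propext; split=> [|h'].
  by apply: peq_trans; apply: peq_sym.
exact: peq_trans h h'.
Qed.

Lemma prep_cls x : peq (prep (pcls x)) x.
Proof. by apply/pcls_eq; rewrite prepK. Qed.

Definition pm_add (C D : pmod) := pcls (padd (prep C) (prep D)).
Definition pm_opp (C : pmod) := pcls (popp (prep C)).
Definition pm_scale a (C : pmod) := pcls (pscale a (prep C)).

Lemma pm_addE x y : pm_add (pcls x) (pcls y) = pcls (padd x y).
Proof. by apply/pcls_eq; apply: peq_add; apply: prep_cls. Qed.
Lemma pm_oppE x : pm_opp (pcls x) = pcls (popp x).
Proof. by apply/pcls_eq; apply: peq_opp; apply: prep_cls. Qed.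
Lemma pm_scaleE a x : pm_scale a (pcls x) = pcls (pscale a x).
Proof. by apply/pcls_eq; apply: peq_scale; apply: prep_cls. Qed.

Lemma pm_addA : associative pm_add.
Proof.
move=> x y z; rewrite -(prepK x) -(prepK y) -(prepK z) !pm_addE.
by apply/pcls_eq; apply: paddA.
Qed.
Lemma pm_addC : commutative pm_add.
Proof.
move=> x y; rewrite -(prepK x) -(prepK y) !pm_addE.
by apply/pcls_eq; apply: paddC.
Qed.
Lemma pm_add0 : left_id (pcls (pzero p)) pm_add.
Proof. by move=> x; rewrite -(prepK x) pm_addE; apply/pcls_eq; apply: padd0. Qed.
Lemma pm_addN : left_inverse (pcls (pzero p)) pm_opp pm_add.
Proof.
by move=> x; rewrite -(prepK x) pm_oppE pm_addE; apply/pcls_eq; apply: paddN.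
Qed.

HB.instance Definition _ :=
  GRing.isZmodule.Build pmod pm_addA pm_addC pm_add0 pm_addN.

Lemma pm_scaleA a b x : pm_scale a (pm_scale b x) = pm_scale (a * b) x.
Proof.
by rewrite -(prepK x) !pm_scaleE; apply/pcls_eq; apply: pscaleA.
Qed.
Lemma pm_scale1 : left_id 1 pm_scale.
Proof. by move=> x; rewrite -(prepK x) pm_scaleE; apply/pcls_eq; apply: pscale1. Qed.
Lemma pm_scaleDr : right_distributive pm_scale +%R.
Proof.
move=> a x y; change (pm_scale a (pm_add x y) = pm_add (pm_scale a x) (pm_scale a y)).
rewrite -(prepK x) -(prepK y) pm_addE !pm_scaleE pm_addE.
by apply/pcls_eq; apply: pscaleDr.
Qed.
Lemma pm_scaleDl x : {morph pm_scale^~ x : a b / a + b >-> a + b}.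
Proof.
move=> a b; change (pm_scale (a + b) x = pm_add (pm_scale a x) (pm_scale b x)).
rewrite -(prepK x) !pm_scaleE pm_addE.
by apply/pcls_eq; apply: pscaleDl.
Qed.

HB.instance Definition _ := GRing.Zmodule_isLmodule.Build R pmod
  pm_scaleA pm_scale1 pm_scaleDr pm_scaleDl.

Lemma pclsD x y : pcls (padd x y) = pcls x + pcls y.
Proof. by rewrite -pm_addE. Qed.
Lemma pclsZ a x : pcls (pscale a x) = a *: pcls x.
Proof. by rewrite -pm_scaleE. Qed.

End PresentedModule.

(** * Linear maps, submodules and quotients *)

Section LinearMaps.
Variable R : pzRingType.
Implicit Types A B D M N : lmodType R.

Definition mklin A B (f : A -> B) (h : linear f) : {linear A -> B} :=
  HB.pack f (GRing.isLinear.Build R A B *:%R f h).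

(** With this, the relation [heq] of [Mod R] is equality, and the homological part can rewrite with
    equations of morphisms. *)
Lemma linear_eq A B (f g : {linear A -> B}) : f =1 g -> f = g.
Proof.
move=> h; have e : (f : A -> B) = g by exact: funext.
case: f g e {h} => [f cf] [g cg] /= e; subst g; congr (GRing.Linear.Pack _).
case: cf cg => [[a] [s]] [[a'] [s']].
by rewrite (Prop_irrelevance a a') (Prop_irrelevance s s').
Qed.

(** Closure under linear combinations reduces uniqueness of values to uniqueness at 0, and makes any
    choice of values linear. *)
Lemma graph_linear A B (G : A -> B -> Prop) :
  (forall x, exists y, G x y) -> (forall y, G 0 y -> y = 0) ->
  (forall a x y x' y', G x y -> G x' y' -> G (a *: x + x') (a *: y + y')) ->
  exists f : {linear A -> B}, forall x, G x (f x).
Proof.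
move=> tot fun0 clos; have [f hf] := choice tot.
have uniq x y y' : G x y -> G x y' -> y = y'.
  move=> h h'; have := clos (-1) _ _ _ _ h h'.
  rewrite scaleN1r addNr scaleN1r => /fun0 /eqP.
  by rewrite addrC subr_eq0 => /eqP ->.
have lf : linear f by move=> a x y; apply: uniq (hf _) _; apply: clos.
by exists (mklin lf).
Qed.

Record submodule M := Submodule {
  smem :> M -> Prop;
  smem0 : smem 0;
  smemL : forall a x y, smem x -> smem y -> smem (a *: x + y) }.

Lemma smemD M (S : submodule M) x y : S x -> S y -> S (x + y).
Proof. by move=> hx hy; rewrite -[x]scale1r; apply: smemL. Qed.
Lemma smemZ M (S : submodule M) a x : S x -> S (a *: x).
Proof. by move=> hx; rewrite -[_ *: _]addr0; apply: smemL => //; apply: smem0. Qed.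
Lemma smemN M (S : submodule M) x : S x -> S (- x).
Proof. by rewrite -scaleN1r; apply: smemZ. Qed.

Section Sub.
Variables (M : lmodType R) (S : submodule M).

Program Definition sub_pres : presentation R :=
  @Presentation R {x | S x} eq (exist _ 0 (smem0 S))
   (fun x y => exist _ (sval x + sval y) (smemD (svalP x) (svalP y)))
   (fun x => exist _ (- sval x) (smemN (svalP x)))
   (fun a x => exist _ (a *: sval x) (smemZ a (svalP x)))
   _ _ _ _ _ _ _ _ _ _ _ _ _ _.
Next Obligation. by []. Qed.
Next Obligation. by move=> x y ->. Qed.
Next Obligation. by move=> x y z ->. Qed.
Next Obligation. by move=> x x' y y' -> ->. Qed.
Next Obligation. by move=> x x' ->. Qed.
Next Obligation. by move=> a x x' ->. Qed.
Next Obligation. by move=> x y z; apply: eq_exist; rewrite /= addrA. Qed.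
Next Obligation. by move=> x y; apply: eq_exist; rewrite /= addrC. Qed.
Next Obligation. by move=> [x hx]; apply: eq_exist; rewrite /= add0r. Qed.
Next Obligation. by move=> [x hx]; apply: eq_exist; rewrite /= addNr. Qed.
Next Obligation. by move=> a b x; apply: eq_exist; rewrite /= scalerA. Qed.
Next Obligation. by move=> [x hx]; apply: eq_exist; rewrite /= scale1r. Qed.
Next Obligation. by move=> a x y; apply: eq_exist; rewrite /= scalerDr. Qed.
Next Obligation. by move=> x a b; apply: eq_exist; rewrite /= scalerDl. Qed.

Definition subm : lmodType R := pmod sub_pres.

Lemma subi_linear : linear (fun x : subm => sval (prep x)).
Proof.
move=> a x y; rewrite -{1}(prepK x) -{1}(prepK y) -pclsZ -pclsD.
by rewrite (prep_cls (p := sub_pres)).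
Qed.
Definition subi : {linear subm -> M} := mklin subi_linear.

Lemma subi_mem x : S (subi x). Proof. exact: (svalP (prep x)). Qed.
Lemma subi_inj : injective subi.
Proof.
move=> x y /= e; rewrite -(prepK x) -(prepK y); congr pcls.
by case: (prep x) (prep y) e => [u hu] [v hv] /= e; apply: eq_exist.
Qed.
Lemma subi_ex x : S x -> exists y, subi y = x.
Proof.
move=> hx; exists (pcls (p := sub_pres) (exist _ x hx)).
by rewrite /= (prep_cls (p := sub_pres)).
Qed.
End Sub.

Section Quotient.
Variables (M : lmodType R) (S : submodule M).

Program Definition quo_pres : presentation R :=
  @Presentation R M (fun x y => S (x - y)) 0 +%R -%R *:%R
   _ _ _ _ _ _ _ _ _ _ _ _ _ _.
Next Obligation. by move=> x /=; rewrite subrr; apply: smem0. Qed.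
Next Obligation. by move=> x y /= /smemN; rewrite opprB. Qed.
Next Obligation. by move=> x y z /= h /(smemD h); rewrite addrA subrK. Qed.
Next Obligation. by move=> x x' y y' /= h /(smemD h); rewrite addrACA -opprD. Qed.
Next Obligation. by move=> x x' /= /smemN; rewrite opprD. Qed.
Next Obligation. by move=> a x x' /= /(smemZ a); rewrite scalerBr. Qed.
Next Obligation. by move=> x y z /=; rewrite addrA subrr; apply: smem0. Qed.
Next Obligation. by move=> x y /=; rewrite [x + y]addrC subrr; apply: smem0. Qed.
Next Obligation. by move=> x /=; rewrite add0r subrr; apply: smem0. Qed.
Next Obligation. by move=> x /=; rewrite addNr subrr; apply: smem0. Qed.
Next Obligation. by move=> a b x /=; rewrite scalerA subrr; apply: smem0. Qed.
Next Obligation. by move=> x /=; rewrite scale1r subrr; apply: smem0. Qed.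
Next Obligation. by move=> a x y /=; rewrite scalerDr subrr; apply: smem0. Qed.
Next Obligation. by move=> x a b /=; rewrite scalerDl subrr; apply: smem0. Qed.

Definition quom : lmodType R := pmod quo_pres.

Lemma quop_linear : linear (fun x : M => pcls (p := quo_pres) x).
Proof. by move=> a x y; rewrite -pclsZ -pclsD. Qed.
Definition quop : {linear M -> quom} := mklin quop_linear.

Lemma quop_surj y : exists x, quop x = y.
Proof. by exists (prep y); apply: prepK. Qed.
Lemma quop_eq0 x : quop x = 0 <-> S x.
Proof.
rewrite -(linear0 quop) /= -[S x]/(S x); split.
  by move/pcls_eq => /=; rewrite subr0.
by move=> h; apply/pcls_eq; rewrite /= subr0.
Qed.
End Quotient.

Program Definition kerS A B (f : {linear A -> B}) : submodule A :=
  @Submodule A (fun x => f x = 0) _ _.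
Next Obligation. by move=> A B f /=; rewrite linear0. Qed.
Next Obligation. by move=> A B f a x y /= hx hy; rewrite linearP hx hy scaler0 addr0. Qed.

Program Definition imS A B (f : {linear A -> B}) : submodule B :=
  @Submodule B (fun y => exists x, f x = y) _ _.
Next Obligation. by move=> A B f /=; exists 0; rewrite linear0. Qed.
Next Obligation.
by move=> A B f a _ _ /= [x <-] [y <-]; exists (a *: x + y); rewrite linearP.
Qed.

End LinearMaps.

(** * Free modules *)

Section Free.
Variables (R : pzRingType) (M : lmodType R).

Definition comb (N : lmodType R) (phi : M -> N) (s : seq (R * M)) : N :=
  \sum_(c <- s) c.1 *: phi c.2.

Lemma comb_map (N : lmodType R) (phi : M -> N) a s :
  comb phi [seq (a * c.1, c.2) | c <- s] = a *: comb phi s.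
Proof.
rewrite /comb big_map scaler_sumr; apply: eq_bigr => c _ /=.
by rewrite scalerA.
Qed.

Lemma comb_cat (N : lmodType R) (phi : M -> N) s t :
  comb phi (s ++ t) = comb phi s + comb phi t.
Proof. by rewrite /comb big_cat. Qed.

(* Formal combinations are identified when all their evaluations agree. *)
Program Definition free_pres : presentation R :=
  @Presentation R (seq (R * M))
   (fun s t => forall (N : lmodType R) (phi : M -> N), comb phi s = comb phi t)
   [::] cat (fun s => [seq (- 1 * c.1, c.2) | c <- s])
   (fun a s => [seq (a * c.1, c.2) | c <- s])
   _ _ _ _ _ _ _ _ _ _ _ _ _ _.
Next Obligation. by []. Qed.
Next Obligation. by move=> x y h N phi; rewrite h. Qed.
Next Obligation. by move=> x y z h h' N phi; rewrite h h'. Qed.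
Next Obligation. by move=> x x' y y' h h' N phi; rewrite !comb_cat h h'. Qed.
Next Obligation. by move=> x x' h N phi; rewrite !comb_map h. Qed.
Next Obligation. by move=> a x x' h N phi; rewrite !comb_map h. Qed.
Next Obligation. by move=> x y z N phi; rewrite catA. Qed.
Next Obligation. by move=> x y N phi; rewrite !comb_cat addrC. Qed.
Next Obligation. by []. Qed.
Next Obligation.
by move=> x N phi; rewrite comb_cat comb_map scaleN1r addNr /comb big_nil.
Qed.
Next Obligation. by move=> a b x N phi; rewrite !comb_map scalerA. Qed.
Next Obligation. by move=> x N phi; rewrite !comb_map scale1r. Qed.
Next Obligation. by move=> a x y N phi; rewrite map_cat. Qed.
Next Obligation. by move=> x a b N phi; rewrite comb_cat !comb_map scalerDl. Qed.

Definition freem : lmodType R := pmod free_pres.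

Lemma evalf_linear (N : lmodType R) (phi : M -> N) :
  linear (fun x : freem => comb phi (prep x)).
Proof.
move=> a x y; rewrite -{1}(prepK x) -{1}(prepK y) -pclsZ -pclsD.
by rewrite (prep_cls (p := free_pres)) comb_cat comb_map.
Qed.
Definition evalf (N : lmodType R) (phi : M -> N) : {linear freem -> N} :=
  mklin (evalf_linear phi).

Lemma gen_linear (x : M) :
  linear (fun r : R^o => pcls (p := free_pres) [:: (r : R, x)] : freem).
Proof.
move=> a r s; rewrite -pclsZ -pclsD; apply/pcls_eq => N phi /=.
by rewrite /comb !big_cons !big_nil /= !addr0 scalerDl.
Qed.
Definition gen (x : M) : {linear R^o -> freem} := mklin (gen_linear x).

Lemma evalf_gen (N : lmodType R) (phi : M -> N) x (r : R) :
  evalf phi (gen x r) = r *: phi x.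
Proof.
by rewrite /= (prep_cls (p := free_pres)) /comb big_cons big_nil addr0.
Qed.

Lemma freem_ext (N : lmodType R) (f g : {linear freem -> N}) :
  (forall x r, f (gen x r) = g (gen x r)) -> f =1 g.
Proof.
move=> h y; rewrite -(prepK y); elim: (prep y) => [|[r x] s IH].
  by rewrite [pcls _](_ : _ = 0 :> freem) // !linear0.
rewrite -cat1s [pcls _](_ : _ = gen x r + pcls (p := free_pres) s :> freem); last first.
  by rewrite -pclsD.
by rewrite !linearD IH h.
Qed.

Definition evid : {linear freem -> M} := evalf idfun.
Lemma evid_surj x : exists y, evid y = x.
Proof. by exists (gen x 1); rewrite evalf_gen scale1r. Qed.

Lemma linear_unit (N : lmodType R) (f : {linear R^o -> N}) (r : R) :
  f (r : R^o) = r *: f (1 : R^o).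
Proof. by rewrite -linearZ /= /GRing.scale /= mulr1. Qed.

Lemma freem_lift (A B D : lmodType R) (f : {linear A -> B}) (g : {linear B -> D})
    (h : {linear freem -> B}) :
  lin_exact f g -> (forall x, g (h x) = 0) ->
  exists h' : {linear freem -> A}, forall x, f (h' x) = h x.
Proof.
move=> ex gh; have /choice[phi hphi] x : exists a, f a = h (gen x (1 : R^o)).
  by apply/ex.
exists (evalf phi); apply: (@freem_ext B (f \o evalf phi) h) => x r.
by rewrite -[LHS]/(f (evalf phi (gen x r))) evalf_gen linearZ hphi -[h _ in RHS]/((h \o gen x) (r : R^o)) (linear_unit (h \o gen x)).
Qed.

(** Through this, closure of X under coproducts and membership of R in X put all free modules in
    X. *)
Lemma freem_coproduct : @is_coproduct (Mod R) M (fun _ => R^o) freem gen.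
Proof.
move=> B f; exists (evalf (fun x => (f x : {linear R^o -> B}) (1 : R^o))); split.
  move=> x r; rewrite -[LHS]/(evalf _ (gen x r)) evalf_gen.
  exact/esym/(linear_unit (f x)).
move=> v hv; apply: freem_ext => x r.
by rewrite [LHS](hv x r) evalf_gen -linear_unit.
Qed.
End Free.

(** * Enough injective modules *)

Lemma additive_int_linear (A D : lmodType int) (f : A -> D) :
  (forall x y, f (x + y) = f x + f y) -> linear f.
Proof.
move=> fD; have f0 : f 0 = 0.
  by apply: (@addrI _ (f 0)); rewrite -fD !addr0.
pose f' : {additive A -> D} := HB.pack f (GRing.isNmodMorphism.Build A D f (f0, fD)).
move=> a x y; rewrite fD; congr (_ + _).
by rewrite -[a]intz !scaler_int -[LHS]/(f' _) raddfMz.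
Qed.

(** * Divisible abelian groups are injective *)

Section Divisible.
Variable D : lmodType int.
Hypothesis Ddiv : forall (n : nat) (d : D), (0 < n)%N -> exists d', n%:Z *: d' = d.

Section Extension.
Variable B : lmodType int.

(** Homomorphisms defined on a subgroup of B, encoded by their graphs: upper bounds of chains are
    then unions of relations. *)
Definition partial_hom (G : B -> D -> Prop) : Prop :=
  (forall a x y x' y', G x y -> G x' y' -> G (a *: x + x') (a *: y + y')) /\
  (G 0 0 /\ forall y, G 0 y -> y = 0).

Lemma partial_homZ G a x y : partial_hom G -> G x y -> G (a *: x) (a *: y).
Proof. by move=> [c [z _]] h; rewrite -[a *: x]addr0 -[a *: y]addr0; apply: c. Qed.

(* The k with k b in the domain of G form an ideal n Z of the integers. *)
Lemma partial_hom_value G (b : B) : partial_hom G ->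
  exists d, forall (k : int) y, G (k *: b) y -> y = k *: d.
Proof.
move=> hG; have [c [z f]] := hG.
pose P (n : nat) := (0 < n)%N && `[< exists y, G (n%:Z *: b) y >].
have key (n : nat) d (q : int) (r : nat) y : G (n%:Z *: b) (n%:Z *: d) ->
    G ((q * n + r)%R *: b) y -> G (r%:Z *: b) (y - (q * n) *: d).
  move=> h1 h2; have := c (- q) _ _ _ _ h1 h2.
  by rewrite !scalerA scalerDl addrA -scalerDl !mulNr addNr scale0r add0r scaleNr addrC.
have [[n hn]|no] := pselect (exists n, P n).
  have [m] := ex_minnP (ex_intro _ n hn) => /andP[m0 /asboolP[y0 hy0]] mmin.
  have [d hd] := Ddiv y0 m0; exists d => k y; rewrite -hd in hy0.
  have m0' : m%:Z != 0 by rewrite eqz_nat -lt0n.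
  have := divz_eq k m; have := ltz_pmod k (m0 : 0 < m%:Z); have := modz_ge0 k m0'.
  case: (k %% m)%Z => // r _ rm -> /(key _ _ _ _ _ hy0) h.
  have r0 : r = 0%N.
    apply/eqP; rewrite -leqn0 leqNgt; apply/negP => r0.
    have /mmin : P r by rewrite /P r0; apply/asboolP; exists (y - (k %/ m)%Z * m *: d).
    by rewrite leqNgt -ltz_nat rm.
  move: h; rewrite {}r0 scale0r => /f /eqP; rewrite subr_eq0 => /eqP ->.
  by rewrite addr0.
(* No nonzero multiple of b lies in the domain of G, so any value would do. *)
exists 0 => k y h; rewrite scaler0.
have [k0|k0] := eqVneq k 0; first by move: h; rewrite k0 scale0r => /f.
case: no; exists `|k|%N; rewrite /P absz_gt0 k0; apply/asboolP.
exists ((Num.sg k) *: y); rewrite abszE normrEsg -scalerA.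
exact: partial_homZ.
Qed.

(** Send b to the d of [partial_hom_value]: on multiples of b in the domain this agrees with G,
    hence the extended relation is still functional. *)
Lemma partial_hom_step G (b : B) : partial_hom G ->
  exists G', [/\ partial_hom G', forall x y, G x y -> G' x y & exists y, G' b y].
Proof.
move=> hG; have [d hd] := partial_hom_value b hG; have [c [z f]] := hG.
exists (fun x y => exists k : int, G (x - k *: b) (y - k *: d)); split.
- split=> [a x y x' y' [k hk] [l hl]|].
    exists (a * k + l); have := c a _ _ _ _ hk hl.
    by rewrite !scalerBr !scalerA ![_ - _ + _]addrACA -!opprD -!scalerDl.
  split=> [|y [k]]; first by exists 0; rewrite !scale0r !subr0.
  rewrite sub0r -scaleNr => /hd /eqP; rewrite scaleNr subr_eq => /eqP ->.
  by rewrite addNr.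
- by move=> x y h; exists 0; rewrite !scale0r !subr0.
- by exists d, 1; rewrite !scale1r !subrr.
Qed.

Lemma partial_hom_extend G0 : partial_hom G0 ->
  exists f : {linear B -> D}, forall x y, G0 x y -> f x = y.
Proof.
move=> h0.
pose T := {G | partial_hom G /\ forall x y, G0 x y -> G x y}.
pose Rel (s t : T) := `[< forall x y, sval s x y -> sval t x y >].
have t0 : T by exists G0.
have [| | |[G [hG sub]] max] := @ZL_preorder T t0 Rel.
- by move=> t; apply/asboolP.
- by move=> r s t /asboolP h1 /asboolP h2; apply/asboolP => x y /h1 /h2.
- move=> A tot.
  (* G0 is added to the union so that the empty chain has an upper bound as well. *)
  pose G x y := G0 x y \/ exists2 t : T, A t & sval t x y.
  have hG : partial_hom G.
    split; last first.
      split; first by left; case: h0 => _ [].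
      by move=> y [|[[t [[_ [_ ht]] ?]] _ /= /ht]]; [case: h0 => _ [_ h /h]|].
    move=> a x y x' y' [h|[t At h]] [h'|[t' At' h']].
    + by left; case: h0 => c _; apply: c.
    + right; exists t' => //; case: t' h' {At'} => t' [[c _] s] /= h'.
      by apply: c => //; apply: s.
    + right; exists t => //; case: t h {At} => t [[c _] s] /= h.
      by apply: c => //; apply: s.
    + have [/asboolP le|/asboolP le] := tot _ _ At At'.
        right; exists t' => //; move/le: h; case: t' h' {At' le} => t' [[c _] s] /= h' h.
        exact: c.
      right; exists t => //; move/le: h'; case: t h {At le} => t [[c _] s] /= h h'.
      exact: c.
  exists (exist _ G (conj hG (fun x y h => or_introl h))) => s As.
  by apply/asboolP => x y h; right; exists s.
have tot x : exists y, G x y.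
  have [G' [hG' s' [y hy]]] := partial_hom_step x hG; exists y.
  have hT : partial_hom G' /\ forall x y, G0 x y -> G' x y.
    by split=> // u v /sub /s'.
  have /asboolP h : Rel (exist _ G' hT) (exist _ G (conj hG sub)).
    by apply: max; apply/asboolP.
  exact: h.
have [c [z f]] := hG.
have [g hg] := graph_linear tot f c.
exists g => x y /sub h; have := c (-1) _ _ _ _ (hg x) h.
rewrite !scaleN1r addNr => /f /eqP; rewrite addrC subr_eq0 => /eqP //.
Qed.

Lemma divisible_injective (A : lmodType int) (f : {linear A -> B}) (a : {linear A -> D}) :
  (forall x, f x = 0 -> x = 0) -> exists b : {linear B -> D}, forall x, b (f x) = a x.
Proof.
move=> inj; have [|b hb] := @partial_hom_extend (fun y d => exists x, f x = y /\ a x = d).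
  split; first by move=> k _ _ _ _ [x [<- <-]] [y [<- <-]]; exists (k *: x + y); rewrite !linearP.
  split; first by exists 0; rewrite !linear0.
  by move=> _ [x [/inj -> <-]]; rewrite linear0.
by exists b => x; apply: hb; exists x.
Qed.
End Extension.
End Divisible.

Program Definition ratZ : submodule (zmodule rat : lmodType int) :=
  @Submodule _ (zmodule rat : lmodType int) (fun q => exists n : int, q = n%:~R :> rat) _ _.
Next Obligation. by exists 0. Qed.
Next Obligation.
move=> /= a _ _ [n ->] [m ->]; exists (a * n + m).
by rewrite intrD intrM -[a in LHS]intz scaler_int mulrzl.
Qed.

Definition QmodZ : lmodType int := quom ratZ.

Lemma QmodZ_divisible (n : nat) (d : QmodZ) : (0 < n)%N -> exists d', n%:Z *: d' = d.
Proof.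
move=> n0; have [q <-] := quop_surj d.
exists (quop ratZ ((q : rat) / n%:R : rat)); rewrite -linearZ; congr (quop _ _).
rewrite -[n%:Z]intz scaler_int /= -mulrzr -pmulrn divfK //.
by rewrite pnatr_eq0 -lt0n.
Qed.

(* Extend x |-> 1 / n, where n is the order of x, or 2 if that is infinite. *)
Lemma QmodZ_cogenerator (B : lmodType int) (x : B) : x <> 0 ->
  exists f : {linear B -> QmodZ}, f x <> 0.
Proof.
move=> x0.
pose P (n : nat) := (0 < n)%N && (n%:Z *: x == 0).
have [n n1 hn] : exists2 n : nat, (1 < n)%N & forall k : int, k *: x = 0 -> (n %| k)%Z.
  have [[n hn]|no] := pselect (exists n, P n).
    have [m] := ex_minnP (ex_intro _ n hn) => /andP[m0 /eqP hm] mmin.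
    exists m => [|k].
      by move: m m0 hm {mmin} => [|[|m]] // _; rewrite scale1r.
    have m0' : m%:Z != 0 by rewrite eqz_nat -lt0n.
    have := divz_eq k m; have := ltz_pmod k (m0 : 0 < m%:Z); have := modz_ge0 k m0'.
    case e : (k %% m)%Z => [r|] // _ rm ->.
    rewrite scalerDl -scalerA hm scaler0 add0r => hr.
    have r0 : r = 0%N.
      apply/eqP; rewrite -leqn0 leqNgt; apply/negP => r0.
      have /mmin : P r by rewrite /P r0 hr eqxx.
      by rewrite leqNgt -ltz_nat rm.
    by rewrite r0 addr0 dvdz_mull.
  exists 2%N => // k hk; have [->|k0] := eqVneq k 0; first exact: dvdz0.
  case: no; exists `|k|%N; rewrite /P absz_gt0 k0 /= abszE normrEsg -scalerA hk.
  by rewrite scaler0 eqxx.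
pose d : QmodZ := quop ratZ (n%:R^-1 : rat).
have dE (k : int) : k *: d = quop ratZ (k%:~R / n%:R : rat).
  rewrite -linearZ; congr (quop _ _).
  by rewrite -[k in LHS]intz scaler_int mulrzl.
have n0 : n%:R != 0 :> rat by rewrite pnatr_eq0 -lt0n ltnW.
have [|f hf] := @partial_hom_extend _ QmodZ_divisible B
    (fun y z => exists k : int, y = k *: x /\ z = k *: d).
  split.
    by move=> a _ _ _ _ [k [-> ->]] [l [-> ->]]; exists (a * k + l); rewrite !scalerDl !scalerA.
  split; first by exists 0; rewrite !scale0r.
  move=> _ [k [/esym/hn/dvdzP[q ->] ->]]; rewrite dE; apply/quop_eq0.
  by exists q; rewrite intrM mulfK.
exists f; rewrite (hf x d); last by exists 1; rewrite !scale1r.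
move/quop_eq0 => [k hk].
have : (k * n)%:~R == 1%:~R :> rat by rewrite intrM -hk mulVf.
rewrite eqr_int => /eqP kn.
have : (n%:Z %| 1)%Z by apply/dvdzP; exists k.
by rewrite dvdz1 /= => /eqP e; rewrite e in n1.
Qed.

(** * Coinduced modules *)

Section Coinduced.
Variables (R : pzRingType) (T : Type) (D : lmodType int).

(* The product over T of the modules Hom_Z(R, D). *)
Definition coind_car := {g : T -> R -> D | forall t r s, g t (r + s) = g t r + g t s}.

Lemma coind_ext (g h : coind_car) : (forall t r, sval g t r = sval h t r) -> g = h.
Proof.
by case: g h => [g hg] [h hh] /= e; apply: eq_exist; apply: funext => t; apply: funext.
Qed.

Program Definition coind_pres : presentation R :=
  @Presentation R coind_car eq (exist _ (fun _ _ => 0) _)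
   (fun g h => exist _ (fun t r => sval g t r + sval h t r) _)
   (fun g => exist _ (fun t r => - sval g t r) _)
   (fun a g => exist _ (fun t r => sval g t (r * a)) _)
   _ _ _ _ _ _ _ _ _ _ _ _ _ _.
Next Obligation. by move=> t r s; rewrite addr0. Qed.
Next Obligation. by move=> [g hg] [h hh] t r s /=; rewrite hg hh addrACA. Qed.
Next Obligation. by move=> [g hg] t r s /=; rewrite hg opprD. Qed.
Next Obligation. by move=> a [g hg] t r s /=; rewrite mulrDl hg. Qed.
Next Obligation. by []. Qed.
Next Obligation. by move=> x y ->. Qed.
Next Obligation. by move=> x y z ->. Qed.
Next Obligation. by move=> x x' y y' -> ->. Qed.
Next Obligation. by move=> x x' ->. Qed.
Next Obligation. by move=> a x x' ->. Qed.
Next Obligation. by move=> x y z; apply: coind_ext => t r /=; rewrite addrA. Qed.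
Next Obligation. by move=> x y; apply: coind_ext => t r /=; rewrite addrC. Qed.
Next Obligation. by move=> x; apply: coind_ext => t r /=; rewrite add0r. Qed.
Next Obligation. by move=> x; apply: coind_ext => t r /=; rewrite addNr. Qed.
Next Obligation. by move=> a b x; apply: coind_ext => t r /=; rewrite mulrA. Qed.
Next Obligation. by move=> x; apply: coind_ext => t r /=; rewrite mulr1. Qed.
Next Obligation. by move=> a x y; apply: coind_ext. Qed.
Next Obligation.
by move=> [x hx] a b; apply: coind_ext => t r /=; rewrite mulrDr hx.
Qed.

Definition coind : lmodType R := pmod coind_pres.
Definition coind_at (t : T) (r : R) (g : coind) : D := sval (prep g) t r.

Lemma coind_atD t r g h : coind_at t r (g + h) = coind_at t r g + coind_at t r h.
Proof.
rewrite /coind_at -{1}(prepK g) -{1}(prepK h) -pclsD.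
by rewrite (prep_cls (p := coind_pres)).
Qed.
Lemma coind_atZ t r a g : coind_at t r (a *: g) = coind_at t (r * a) g.
Proof.
by rewrite /coind_at -{1}(prepK g) -pclsZ (prep_cls (p := coind_pres)).
Qed.
Lemma coind_at_inj g h : (forall t r, coind_at t r g = coind_at t r h) -> g = h.
Proof.
by move=> e; rewrite -(prepK g) -(prepK h); congr pcls; apply: coind_ext.
Qed.

Lemma coind_mk (M : lmodType R) (chi : T -> {linear (zmodule M : lmodType int) -> D}) :
  exists f : {linear M -> coind}, forall x t r, coind_at t r (f x) = chi t (r *: x).
Proof.
have FD (x : M) t (r s : R) : chi t ((r + s) *: x) = chi t (r *: x) + chi t (s *: x).
  by rewrite scalerDl linearD.
pose F (x : M) : coind := pcls (p := coind_pres)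
  (exist (fun g : T -> R -> D => forall t r s, g t (r + s) = g t r + g t s)
    (fun t r => chi t (r *: x)) (FD x)).
have FE x t r : coind_at t r (F x) = chi t (r *: x).
  by rewrite /coind_at (prep_cls (p := coind_pres)).
have linF : linear F.
  move=> a x y; apply: coind_at_inj => t r.
  by rewrite coind_atD coind_atZ !FE scalerDr scalerA linearD.
by exists (mklin linF) => x t r; apply: FE.
Qed.

(** By the adjunction with restriction of scalars, a linear map into [coind] amounts to the family
    over T of its components at 1. These are additive maps into D, which extend because D is
    divisible. *)
Lemma coind_injective (A B : lmodType R) (f : {linear A -> B}) (a : {linear A -> coind}) :
  (forall (n : nat) (d : D), (0 < n)%N -> exists d', n%:Z *: d' = d) ->
  (forall x, f x = 0 -> x = 0) -> exists b : {linear B -> coind}, forall x, b (f x) = a x.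
Proof.
move=> div inj.
have lf : linear (f : (zmodule A : lmodType int) -> (zmodule B : lmodType int)).
  by apply: additive_int_linear => x y; apply: linearD.
have la t : linear ((fun x => coind_at t 1 (a x)) : (zmodule A : lmodType int) -> D).
  by apply: additive_int_linear => x y; rewrite linearD coind_atD.
have /choice[b hb] t := divisible_injective div (f := mklin lf) (mklin (la t)) inj.
have [g hg] := coind_mk b; exists g => x; apply: coind_at_inj => t r.
by rewrite hg -linearZ [LHS]hb /= linearZ coind_atZ mul1r.
Qed.
End Coinduced.

(** Indexed by all characters of M, so that these together give a single linear map from M; it is
    injective because Q/Z is a cogenerator. *)
Definition injm (R : pzRingType) (M : lmodType R) : lmodType R :=
  coind R {linear (zmodule M : lmodType int) -> QmodZ} QmodZ.

Lemma injm_injective (R : pzRingType) (M A B : lmodType R) (f : {linear A -> B})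
    (a : {linear A -> injm M}) :
  (forall x, f x = 0 -> x = 0) -> exists b : {linear B -> injm M}, forall x, b (f x) = a x.
Proof. exact: coind_injective QmodZ_divisible. Qed.

Lemma injm_embed (R : pzRingType) (M : lmodType R) :
  exists f : {linear M -> injm M}, forall x, f x = 0 -> x = 0.
Proof.
have [f hf] := @coind_mk R _ QmodZ M idfun; exists f => x fx.
apply: contrapT => /(@QmodZ_cogenerator (zmodule M : lmodType int))[chi hchi]; apply: hchi.
by rewrite -[x]scale1r -hf fx -(linear0 f) hf scaler0 linear0.
Qed.

(** * Extensions and projective resolutions *)

Lemma dchoice (I : Type) (F : I -> Type) (P : forall i, F i -> Prop) :
  (forall i, exists x, P i x) -> exists f : forall i, F i, forall i, P i (f i).
Proof.
by move=> h; exists (fun i => projT1 (cid (h i))) => i; apply: (projT2 (cid (h i))).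
Qed.

(** Stated for exact pairs instead of epimorphisms, which is the form in which maps out of a
    resolution are lifted along an exact sequence. *)
Definition projective (C : abcat) (P : C) : Prop :=
  forall A B D (f : mor A B) (g : mor B D) (h : mor P B),
    is_exact f g -> g ∘ h = zerom P D -> exists h' : mor P A, f ∘ h' = h.

Definition splits (C : abcat) (M N : C) : Prop :=
  forall B (f : mor N B) (g : mor B M), short_exact f g ->
    exists s : mor M B, g ∘ s = idm M.

Definition closed_iso (C : abcat) (X : obj_class C) : Prop :=
  forall (A B : C) (f : mor A B) (g : mor B A),
    f ∘ g = idm B -> g ∘ f = idm A -> X A -> X B.

(** The class [wedge w m] cut into short exact sequences, as induction on m requires; [wedge_resdim]
    compares the two. *)
Fixpoint resdim (C : abcat) (w : obj_class C) (m : nat) (M : C) : Prop :=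
  if m is m'.+1 then
    exists (T W : C) (f : mor T W) (g : mor W M),
      [/\ short_exact f g, w W & resdim w m' T]
  else w M.

(* The properties of an abelian category with enough projectives that the
   homological arguments below rely on; the last three replace the calculus
   of images. *)
Record abelian_axioms (C : abcat) := AbelianAxioms {
  heq_eq : forall (A B : C) (f g : mor A B), f =h g <-> f = g;
  compA : forall (A B D E : C) (h : mor D E) (g : mor B D) (f : mor A B),
    h ∘ (g ∘ f) = h ∘ g ∘ f;
  comp1m : forall (A B : C) (f : mor A B), idm B ∘ f = f;
  compm1 : forall (A B : C) (f : mor A B), f ∘ idm A = f;
  addmA : forall (A B : C) (f g h : mor A B), addm f (addm g h) = addm (addm f g) h;
  addmC : forall (A B : C) (f g : mor A B), addm f g = addm g f;
  add0m : forall (A B : C) (f : mor A B), addm (zerom A B) f = f;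
  oppm : forall A B : C, mor A B -> mor A B;
  addNm : forall (A B : C) (f : mor A B), addm (oppm f) f = zerom A B;
  compDl : forall (A B D : C) (h : mor B D) (f g : mor A B),
    h ∘ addm f g = addm (h ∘ f) (h ∘ g);
  compDr : forall (A B D : C) (f g : mor B D) (h : mor A B),
    addm f g ∘ h = addm (f ∘ h) (g ∘ h);
  comp0m : forall (A B D : C) (f : mor A B), zerom B D ∘ f = zerom A D;
  compm0 : forall (A B D : C) (f : mor B D), f ∘ zerom A B = zerom A D;
  exact0 : forall (A B D : C) (f : mor A B) (g : mor B D),
    is_exact f g -> g ∘ f = zerom A D;
  mono_eq0 : forall (A B T : C) (f : mor A B) (h : mor T A),
    is_mono f -> f ∘ h = zerom T B -> h = zerom T A;
  epi_eq0 : forall (B D T : C) (g : mor B D) (h : mor D T),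
    is_epi g -> h ∘ g = zerom B T -> h = zerom D T;
  ker_lift : forall (A B D T : C) (f : mor A B) (g : mor B D) (h : mor T B),
    is_mono f -> is_exact f g -> g ∘ h = zerom T D -> exists h', f ∘ h' = h;
  coker_desc : forall (A B D T : C) (f : mor A B) (g : mor B D) (h : mor B T),
    is_exact f g -> is_epi g -> h ∘ f = zerom A T -> exists h', h' ∘ g = h;
  kernels : forall (A B : C) (f : mor A B),
    exists (K : C) (k : mor K A), is_mono k /\ is_exact k f;
  pushouts : forall (A B D N : C) (f : mor A B) (g : mor B D) (a : mor A N),
    short_exact f g -> exists (B' : C) (f' : mor N B') (g' : mor B' D) (b : mor B B'),
      [/\ short_exact f' g', b ∘ f = f' ∘ a & g' ∘ b = g];
  biproducts : forall A B : C, exists (S : C) (i : mor A S) (p : mor S B) (r : mor S A),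
    short_exact i p /\ r ∘ i = idm A;
  enough_projectives : forall M : C, exists (N P : C) (i : mor N P) (p : mor P M),
    short_exact i p /\ projective P;
  idm_mono : forall A : C, is_mono (idm A);
  idm_epi : forall A : C, is_epi (idm A);
  exact_mono : forall (A B D E : C) (f : mor A B) (e : mor B D) (k : mor D E),
    is_mono k -> (is_exact f e <-> is_exact f (k ∘ e));
  exact_epi : forall (A B D E : C) (e : mor A B) (k : mor B D) (g : mor D E),
    is_epi e -> (is_exact k g <-> is_exact (k ∘ e) g);
  factor_epi : forall (A B D E : C) (e : mor A B) (k : mor B D) (g : mor D E),
    is_mono k -> is_exact k g -> is_exact (k ∘ e) g -> is_epi e }.

Section Homological.
Variables (C : abcat) (ax : abelian_axioms C).
Implicit Types A B D M N P T : C.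

Definition subh A B (f g : mor A B) := addm f (oppm ax g).

Lemma subh_self A B (f : mor A B) : subh f f = zerom A B.
Proof. by rewrite /subh (addmC ax) (addNm ax). Qed.
Lemma subhK A B (f g : mor A B) : addm (subh f g) g = f.
Proof. by rewrite /subh -(addmA ax) (addNm ax) (addmC ax) (add0m ax). Qed.
Lemma addm0 A B (f : mor A B) : addm f (zerom A B) = f.
Proof. by rewrite (addmC ax) (add0m ax). Qed.
Lemma addmK A B (f g h : mor A B) : addm f h = addm g h -> f = g.
Proof.
move=> e; have: addm (addm f h) (oppm ax h) = addm (addm g h) (oppm ax h) by rewrite e.
by rewrite -!(addmA ax) ![addm h _](addmC ax) (addNm ax) !addm0.
Qed.
Lemma subh_eq0 A B (f g : mor A B) : subh f g = zerom A B -> f = g.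
Proof. by move=> e; rewrite -(subhK f g) e (add0m ax). Qed.
Lemma comp_subl A B D (h : mor B D) (f g : mor A B) :
  h ∘ subh f g = subh (h ∘ f) (h ∘ g).
Proof. by apply: (@addmK _ _ _ _ (h ∘ g)); rewrite -(compDl ax) !subhK. Qed.
Lemma comp_subr A B D (f g : mor B D) (h : mor A B) :
  subh f g ∘ h = subh (f ∘ h) (g ∘ h).
Proof. by apply: (@addmK _ _ _ _ (g ∘ h)); rewrite -(compDr ax) !subhK. Qed.
Lemma subh0 A B (f : mor A B) : subh f (zerom A B) = f.
Proof. by apply: (@addmK _ _ _ _ (zerom A B)); rewrite subhK addm0. Qed.

Lemma mono_cancel A B T (f : mor A B) (h h' : mor T A) :
  is_mono f -> f ∘ h = f ∘ h' -> h = h'.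
Proof.
move=> mf e; apply: subh_eq0; apply: (mono_eq0 ax mf).
by rewrite comp_subl e subh_self.
Qed.
Lemma epi_cancel A B T (g : mor A B) (h h' : mor B T) :
  is_epi g -> h ∘ g = h' ∘ g -> h = h'.
Proof.
move=> eg e; apply: subh_eq0; apply: (epi_eq0 ax eg).
by rewrite comp_subr e subh_self.
Qed.

Lemma projective_lift P B D (g : mor B D) (h : mor P D) :
  projective P -> is_epi g -> exists h', g ∘ h' = h.
Proof. by move=> pP /pP; apply; rewrite (comp0m ax). Qed.

Lemma projective_splits P N : projective P -> splits P N.
Proof. by move=> pP B f g [_ _ eg]; apply: (projective_lift _ pP eg). Qed.

(** Push the sequence out along a; the pushout splits, and its retraction onto N restricts to the
    desired map on B. *)
Lemma splits_extend M N A B (f : mor A B) (g : mor B M) (a : mor A N) :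
  splits M N -> short_exact f g -> exists b, b ∘ f = a.
Proof.
move=> sp /(pushouts ax a)[B' [f' [g' [b [se e1 e2]]]]].
have [s hs] := sp _ _ _ se; have [mf' ef' _] := se.
have [r hr] : exists r, f' ∘ r = subh (idm B') (s ∘ g').
  apply: (ker_lift ax mf' ef').
  by rewrite comp_subl (compm1 ax) (compA ax) hs (comp1m ax) subh_self.
exists (r ∘ b); apply: (mono_cancel mf').
rewrite !(compA ax) hr comp_subr (comp1m ax) comp_subr e1.
by rewrite -!(compA ax) e1 (compA ax g') (exact0 ax ef') (comp0m ax) (compm0 ax) subh0.
Qed.

(** Pullbacks are avoided: h is lifted on a projective P covering M, and the lift is corrected by an
    extension to P of its restriction to the syzygy, which takes values in N. *)
Lemma splits_lift M N B D (f : mor N B) (g : mor B D) (h : mor M D) :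
  splits M N -> short_exact f g -> exists h', g ∘ h' = h.
Proof.
move=> sp [mf ef eg]; have [M' [P [i [p [se pP]]]]] := enough_projectives ax M.
have [mi ei ep] := se.
have [u hu] := projective_lift (h ∘ p) pP eg.
have [a ha] : exists a, f ∘ a = u ∘ i.
  by apply: (ker_lift ax mf ef); rewrite (compA ax) hu -(compA ax) (exact0 ax ei) (compm0 ax).
have [v hv] := splits_extend a sp se.
have [w hw] : exists w, w ∘ p = subh u (f ∘ v).
  by apply: (coker_desc ax ei ep); rewrite comp_subr -(compA ax) hv ha subh_self.
exists w; apply: (epi_cancel ep).
by rewrite -(compA ax) hw comp_subl hu (compA ax) (exact0 ax ef) (comp0m ax) subh0.
Qed.

(** Exactness of Hom(B, N) -> Hom(A, N) -> Ext^1(M, N) -> Ext^1(B, N), by hand. *)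
Lemma splits_of_extend M N A B (f : mor A B) (g : mor B M) :
  short_exact f g -> splits B N -> (forall a : mor A N, exists b, b ∘ f = a) ->
  splits M N.
Proof.
move=> [mf ef eg] spB ext Y j q se; have [mj ej eq] := se.
have [u hu] := splits_lift g spB se.
have [a ha] : exists a, j ∘ a = u ∘ f.
  by apply: (ker_lift ax mj ej); rewrite (compA ax) hu (exact0 ax ef).
have [v hv] := ext a.
have [s hs] : exists s, s ∘ g = subh u (j ∘ v).
  by apply: (coker_desc ax ef eg); rewrite comp_subr -(compA ax) hv ha subh_self.
exists s; apply: (epi_cancel eg).
by rewrite -(compA ax) hs comp_subl hu (compA ax) (exact0 ax ej) (comp0m ax) subh0 (comp1m ax).
Qed.

(** Exactness of Hom(M, B) -> Hom(M, D) -> Ext^1(M, N) -> Ext^1(M, B), by hand. *)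
Lemma splits_of_lift M N B D (f : mor N B) (g : mor B D) :
  short_exact f g -> splits M B -> (forall h : mor M D, exists h', g ∘ h' = h) ->
  splits M N.
Proof.
move=> [mf ef eg] spB lif Y j q se; have [mj ej eq] := se.
have [u hu] := splits_extend f spB se.
have [h hh] : exists h, h ∘ q = g ∘ u.
  by apply: (coker_desc ax ej eq); rewrite -(compA ax) hu (exact0 ax ef).
have [h' hh'] := lif h.
have [r hr] : exists r, f ∘ r = subh u (h' ∘ q).
  by apply: (ker_lift ax mf ef); rewrite comp_subl (compA ax) hh' hh subh_self.
have rj : r ∘ j = idm N.
  apply: (mono_cancel mf); rewrite (compA ax) hr comp_subr hu -(compA ax).
  by rewrite (exact0 ax ej) (compm0 ax) subh0 (compm1 ax).
have [s hs] : exists s, s ∘ q = subh (idm Y) (j ∘ r).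
  apply: (coker_desc ax ej eq).
  by rewrite comp_subr (comp1m ax) -(compA ax) rj (compm1 ax) subh_self.
exists s; apply: (epi_cancel eq).
by rewrite -(compA ax) hs comp_subl (compm1 ax) (compA ax) (exact0 ax ej) (comp0m ax) subh0 (comp1m ax).
Qed.

Lemma splits_ext_r M N' N N'' (f : mor N' N) (g : mor N N'') :
  short_exact f g -> splits M N' -> splits M N'' -> splits M N.
Proof.
move=> [mf ef eg] sp' sp''; have [A [P [i [p [se pP]]]]] := enough_projectives ax M.
apply: (splits_of_extend se (projective_splits pP)) => a.
have [v'' hv''] := splits_extend (g ∘ a) sp'' se.
have [v hv] := projective_lift v'' pP eg.
have [a' ha'] : exists a', f ∘ a' = subh a (v ∘ i).
  by apply: (ker_lift ax mf ef); rewrite comp_subl (compA ax) hv hv'' subh_self.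
have [v' hv'] := splits_extend a' sp' se.
by exists (addm (f ∘ v') v); rewrite (compDr ax) -(compA ax) hv' ha' subhK.
Qed.

(* Dimension shifting in both variables at once: morphisms A -> N'' lift to N,
   and then extend to B. *)
Lemma splits_shift M N N' N'' A B (f : mor A B) (g : mor B M) (j : mor N' N) (q : mor N N'') :
  short_exact f g -> short_exact j q ->
  splits B N'' -> splits A N' -> splits M N -> splits M N''.
Proof.
move=> se se' sp1 sp2 sp3; apply: (splits_of_extend se sp1) => a.
have [h hh] := splits_lift a sp2 se'; have [b hb] := splits_extend h sp3 se.
by exists (q ∘ b); rewrite -(compA ax) hb.
Qed.

Lemma splits_retract M N N' (f : mor N N') (g : mor N' N) :
  f ∘ g = idm N' -> splits M N -> splits M N'.
Proof.
move=> fg sp; have [A [P [i [p [se pP]]]]] := enough_projectives ax M.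
apply: (splits_of_extend se (projective_splits pP)) => a.
have [b hb] := splits_extend (g ∘ a) sp se.
by exists (f ∘ b); rewrite -(compA ax) hb (compA ax) fg (comp1m ax).
Qed.

Lemma mono_epi_iso A B (f : mor A B) :
  is_mono f -> is_epi f -> exists g, f ∘ g = idm B /\ g ∘ f = idm A.
Proof.
move=> mf ef; have [g hg] := ker_lift ax mf ef (comp0m ax _ (idm B)).
exists g; split=> //; apply: (mono_cancel mf).
by rewrite (compA ax) hg (comp1m ax) (compm1 ax).
Qed.

Lemma closed_summands_iso X : closed_summands X -> @closed_iso C X.
Proof.
move=> cl A B f g fg gf; apply: cl.
(* The complementary summand has to be a zero object; the kernel of an identity is one. *)
have [K [k [mk ek]]] := kernels ax (idm A).
have k0 : k = zerom K A by rewrite -(comp1m ax k) (exact0 ax ek).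
have K0 : idm K = zerom K K.
  by apply: (mono_eq0 ax mk); rewrite k0 (comp0m ax).
exists K, g, f, (zerom _ _), (zerom _ _); split; apply/(heq_eq ax) => //.
- by rewrite (comp0m ax) K0.
- by rewrite (compm0 ax).
- by rewrite (comp0m ax).
- by rewrite gf (comp0m ax) addm0.
Qed.

(** * Projective resolutions and Yoneda extensions *)

Record resolution := Resolution {
  syz : nat -> C;
  rob : nat -> C;
  syz_in : forall j, mor (syz j.+1) (rob j);
  syz_out : forall j, mor (rob j) (syz j);
  res_exact : forall j, short_exact (syz_in j) (syz_out j) }.

Definition tail_res r := @Resolution (fun j => syz r j.+1) (fun j => rob r j.+1)
  (fun j => syz_in r j.+1) (fun j => syz_out r j.+1) (fun j => res_exact r j.+1).

Lemma projective_resolution M :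
  exists r, syz r 0 = M /\ forall j, projective (rob r j).
Proof.
have /dchoice[S /dchoice[P /dchoice[i /dchoice[p h]]]] := enough_projectives ax.
exists (@Resolution (fun j => iter j S M) (fun j => P (iter j S M))
  (fun j => i (iter j S M)) (fun j => p (iter j S M)) (fun j => (h (iter j S M)).1)).
by split=> // j; apply: (h _).2.
Qed.

Section Splice.
Variables (M' P M : C) (i : mor M' P) (p : mor P M).
Hypothesis se : short_exact i p.

Definition splice_obj (E : nat -> C) j : C := if j is j'.+1 then E j' else P.
Definition splice_d (E : nat -> C) (d : forall j, mor (E j) (aug M' E j)) j :
    mor (splice_obj E j) (aug M (splice_obj E) j) :=
  match j with
  | 0 => p
  | 1 => i ∘ d 0%N
  | j'.+2 => d j'.+1
  end.

Lemma splice_exact n E (d : forall j, mor (E j) (aug M' E j)) :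
  exact_upto n d -> exact_upto n.+1 (splice_d d).
Proof.
move: (se) => [mi ei ep] [e0 ex]; split=> // -[|[|j]] hj /=.
- exact/(exact_epi ax _ _ e0).
- by apply/(exact_mono ax _ _ mi); apply: (ex 0%N).
- exact: (ex j.+1).
Qed.

Lemma splice_exact_in n E (d : forall j, mor (E j) (aug M' E j)) A (f : mor A (E n)) :
  is_exact f (d n) -> is_exact (f : mor A (splice_obj E n.+1)) (splice_d d n.+1).
Proof.
by move: (se) => [mi ei ep]; case: n f => [|n] f //= /(exact_mono ax _ _ mi).
Qed.

Lemma splice_mono n E (d : forall j, mor (E j) (aug M' E j)) :
  is_mono (d n) -> is_mono (splice_d d n.+1).
Proof. exact: (@splice_exact_in n E d _ (zerom _ _)). Qed.

Definition splice N n (E : extension n M' N) : extension n.+1 M N :=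
  @Extension C n.+1 M N (splice_obj (ext_obj E)) (splice_d (@ext_d _ _ _ _ E))
    (ext_in E) (splice_exact (ext_exact_upto E))
    (splice_exact_in (ext_exact_in E)) (ext_mono_in E).
End Splice.

(** The iterated connecting map from Ext^1(syz r n, N) to Ext^(n+1)(syz r 0, N). *)
Fixpoint splices N n : forall r, extension 0 (syz r n) N -> extension n (syz r 0) N :=
  match n with
  | 0 => fun r Q => Q
  | n'.+1 => fun r Q => splice (res_exact r 0) (@splices N n' (tail_res r) Q)
  end.

Definition augment r M0 (E : nat -> C) (u : mor (syz r 0) M0)
    (phi : forall j, mor (rob r j) (E j)) j : mor (syz r j) (aug M0 E j) :=
  match j with 0 => u | j'.+1 => phi j' ∘ syz_in r j' end.

Definition auglift M M0 (E E' : nat -> C) (u : mor M M0) (phi : forall j, mor (E j) (E' j)) j :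
    mor (aug M E j) (aug M0 E' j) :=
  match j with 0 => u | j'.+1 => phi j' end.

(** M0 and u are arbitrary for the sake of the induction, which drops the first term of E: the
    augmentation becomes E 0, and u becomes the restriction of phi 0 to the first syzygy. *)
Lemma splices_map N n : forall r (Q : extension 0 (syz r n) N) M0 (E : nat -> C)
    (d : forall j, mor (E j) (aug M0 E j)) (u : mor (syz r 0) M0)
    (phi : forall j, mor (rob r j) (E j)) (th : mor (ext_obj Q 0) (E n)),
  (forall j, (j < n)%N -> d j ∘ phi j = augment u phi j ∘ syz_out r j) ->
  d n ∘ th = augment u phi n ∘ ext_d Q 0 ->
  exists psi : forall j, mor (ext_obj (splices Q) j) (E j),
    (forall j, (j <= n)%N -> d j ∘ psi j = auglift u psi j ∘ ext_d (splices Q) j) /\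
    psi n ∘ ext_in (splices Q) = th ∘ ext_in Q.
Proof.
elim: n => [|n IH] r Q M0 E d u phi th hphi hth.
  exists (fun j => match j return mor (ext_obj Q j) (E j) with 0 => th | j'.+1 => zerom _ _ end); split=> //.
  by case.
pose d' j : mor (E j.+1) (aug (E 0%N) (fun j => E j.+1) j) :=
  match j with 0 => d 1%N | j'.+1 => d j'.+2 end.
have [|//|psi [h1 h2]] := IH (tail_res r) Q (E 0%N) _ d' (phi 0%N ∘ syz_in r 0) (fun j => phi j.+1) th.
- by case=> [|j] hj; apply: (hphi _.+1).
- by case: (n) Q th hth.
exists (fun j => match j return mor (ext_obj (splices (n := n.+1) (r := r) Q) j) (E j) with
  0 => phi 0%N | j'.+1 => psi j' end); split=> // -[|[|j]] hj.
- exact: (hphi 0%N).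
- by rewrite /= (compA ax); apply: (h1 0%N).
- exact: (h1 j.+1).
Qed.

Definition comparison r n M0 N (E : extension n M0 N) (u : mor (syz r 0) M0)
    (phi : forall j, mor (rob r j) (ext_obj E j)) (psi : mor (syz r n.+1) N) : Prop :=
  (forall j, (j <= n)%N -> ext_d E j ∘ phi j = augment u phi j ∘ syz_out r j) /\
  ext_in E ∘ psi = phi n ∘ syz_in r n.

Lemma augment_exact r n M0 N (E : extension n M0 N) (u : mor (syz r 0) M0)
    (phi : forall j, mor (rob r j) (ext_obj E j)) j :
  ext_d E j ∘ phi j = augment u phi j ∘ syz_out r j ->
  ext_d E j ∘ augment u phi j.+1 = zerom _ _.
Proof.
move=> h; have [_ e _] := res_exact r j.
by rewrite /= (compA ax) h -(compA ax) (exact0 ax e) (compm0 ax).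
Qed.

Lemma comparison_ex r n M0 N (E : extension n M0 N) (u : mor (syz r 0) M0) :
  (forall j, projective (rob r j)) -> exists phi psi, @comparison r n M0 N E u phi psi.
Proof.
move=> proj; have [e0 ex] := ext_exact_upto E.
pose nxt j (f : mor (rob r j) (ext_obj E j)) (g : mor (rob r j.+1) (ext_obj E j.+1)) :=
  ext_d E j.+1 ∘ g = f ∘ syz_in r j ∘ syz_out r j.+1.
(* A total choice of the next lift, zero if there is none, allows a plain recursion for phi. That
   lifts do exist up to degree n is proved afterwards. *)
have /dchoice[step hstep] :
    forall j, exists F, forall f, (exists g, @nxt j f g) -> nxt j f (F f).
  move=> j; have [F hF] : exists F : mor (rob r j) (ext_obj E j) ->
      mor (rob r j.+1) (ext_obj E j.+1), forall f, (exists g, nxt j f g) -> nxt j f (F f).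
    apply: (@dchoice _ (fun _ => mor (rob r j.+1) (ext_obj E j.+1))
       (fun f g => (exists g, nxt j f g) -> nxt j f g)) => f.
    have [[g hg]|no] := pselect (exists g, nxt j f g); first by exists g.
    by exists (zerom _ _) => /no.
  by exists F.
have [phi0 hphi0] := projective_lift (u ∘ syz_out r 0) (proj 0%N) e0.
pose phi := nat_rect (fun j => mor (rob r j) (ext_obj E j)) phi0 step.
have hphi j : (j <= n)%N -> ext_d E j ∘ phi j = augment u phi j ∘ syz_out r j.
  elim: j => [|j IH] hj //; apply: hstep.
  have := augment_exact (IH (ltnW hj)).
  move/(congr1 (fun h => h ∘ syz_out r j.+1)); rewrite /= -(compA ax) (comp0m ax).
  exact: (proj j.+1 _ _ _ _ _ _ (ex j hj)).
have [psi hpsi] := ker_lift ax (ext_mono_in E) (ext_exact_in E) (augment_exact (hphi n (leqnn n))).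
by exists phi, psi.
Qed.

(* Two comparison maps are homotopic, hence differ on the last syzygy by a map
   that extends to the projective. *)
Lemma comparison_unique r n M0 N (E : extension n M0 N) (u : mor (syz r 0) M0) phi psi phi' psi' :
  (forall j, projective (rob r j)) ->
  @comparison r n M0 N E u phi psi -> @comparison r n M0 N E u phi' psi' ->
  exists v : mor (rob r n) N, v ∘ syz_in r n = subh psi psi'.
Proof.
move=> proj [h1 h2] [h1' h2']; have [e0 ex] := ext_exact_upto E.
have key j : (j <= n)%N -> exists del : mor (rob r j) (ext_obj E j),
    ext_d E j ∘ del = zerom _ _ /\ del ∘ syz_in r j = subh (phi j) (phi' j) ∘ syz_in r j.
  elim: j => [|j IH] hj.
    by exists (subh (phi 0%N) (phi' 0%N)); rewrite comp_subl h1 // h1' // subh_self.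
  have [del [d1 d2]] := IH (ltnW hj).
  have [kap hkap] := proj j _ _ _ _ _ _ (ex j hj) d1.
  exists (subh (subh (phi j.+1) (phi' j.+1)) (kap ∘ syz_in r j ∘ syz_out r j.+1)); split.
    rewrite !comp_subl h1 // h1' //= !(compA ax) hkap d2 !comp_subr subh_self //.
  have [_ e _] := res_exact r j.+1.
  by rewrite [LHS]comp_subr -(compA ax (_ ∘ _)) (exact0 ax e) (compm0 ax) subh0.
have [del [d1 d2]] := key n (leqnn n).
have [v hv] := ker_lift ax (ext_mono_in E) (ext_exact_in E) d1.
exists v; apply: (mono_cancel (ext_mono_in E)).
by rewrite (compA ax) hv d2 comp_subr comp_subl h2 h2'.
Qed.

Lemma splices_comparison N n : forall r (Q : extension 0 (syz r n) N)
    (la : mor (rob r n) (ext_obj Q 0)) (psi : mor (syz r n.+1) N),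
  ext_d Q 0 ∘ la = syz_out r n -> ext_in Q ∘ psi = la ∘ syz_in r n ->
  exists phi, @comparison r n _ N (splices Q) (idm _) phi psi.
Proof.
elim: n => [|n IH] r Q la psi h1 h2.
  exists (fun j => match j return mor (rob r j) (ext_obj Q j) with 0 => la | j'.+1 => zerom _ _ end);
    split=> //.
  by case=> // _; rewrite (comp1m ax).
have [phi [p1 p2]] := IH (tail_res r) Q la psi h1 h2.
exists (fun j => match j return mor (rob r j) (ext_obj (splices (n := n.+1) (r := r) Q) j) with
  0 => idm _ | j'.+1 => phi j' end); split=> // -[|[|j]] hj /=.
- by rewrite (compm1 ax) (comp1m ax).
- by rewrite -(compA ax) (p1 0%N) // !(comp1m ax).
- exact: (p1 j.+1).
Qed.

(** The maps psi represent an element of the cokernel of Hom(rob r n, N) -> Hom(syz r n.+1, N). For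
    u the identity and a projective resolution this is the class of E in Ext^(n+1), which is
    asserted to be zero. *)
Definition comparison_trivial r n M0 N (E : extension n M0 N) (u : mor (syz r 0) M0) : Prop :=
  forall phi psi, @comparison r n M0 N E u phi psi ->
  exists v : mor (rob r n) N, v ∘ syz_in r n = psi.

(** A morphism of extensions carries comparison maps to comparison maps with the same psi, so both
    extensions have the same class. *)
Lemma comparison_le r n N (E E' : extension n (syz r 0) N) :
  (forall j, projective (rob r j)) -> ext_le E E' ->
  comparison_trivial E (idm _) <-> comparison_trivial E' (idm _).
Proof.
move=> proj [th [t1 t2]].
have push phi psi : comparison (E := E) (idm _) phi psi ->
    comparison (E := E') (idm _) (fun j => th j ∘ phi j) psi.
  move=> [h1 h2]; split=> [j hj|]; last first.
    by move/(heq_eq ax): t2 => <-; rewrite -!(compA ax) h2.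
  move: (t1 j hj) => /(heq_eq ax) e; rewrite (compA ax) e -(compA ax) h1 // (compA ax).
  by case: (j) => [|k] /=; rewrite ?(comp1m ax) ?(compA ax).
split=> [tr phi' psi' h'|tr phi psi /push/tr //].
have [phi [psi h]] := comparison_ex E (idm _) proj.
have [v hv] := tr _ _ h; have [v' hv'] := comparison_unique proj h' (push _ _ h).
by exists (addm v' v); rewrite (compDr ax) hv hv' subhK.
Qed.

Program Definition se_extension M N B (f : mor N B) (g : mor B M) (se : short_exact f g) :=
  @Extension C 0 M N (fun _ => B) (fun j => match j with 0 => g | j'.+1 => zerom _ _ end) f _ _ _.
Next Obligation. by move=> M N B f g [_ _ eg]; split. Qed.
Next Obligation. by move=> M N B f g []. Qed.
Next Obligation. by move=> M N B f g []. Qed.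

Lemma comparison_equiv r n N (E E' : extension n (syz r 0) N) :
  (forall j, projective (rob r j)) -> yoneda_equiv E E' ->
  comparison_trivial E (idm _) -> comparison_trivial E' (idm _).
Proof.
move=> proj h.
suff : comparison_trivial E (idm _) <-> comparison_trivial E' (idm _) by case.
by elim: h => [x y|x|x y _ ->|x y z _ -> _ ->] //; apply: comparison_le.
Qed.

(** Splice both the given sequence and a split one with the resolution. The class of the split one
    is zero, hence so is the other; then psi extends to the projective, and subtracting the
    extension lets the lift la descend to a section. *)
Lemma Ext_zero_splits r n N : (forall j, projective (rob r j)) ->
  Ext_zero n.+1 (syz r 0) N -> splits (syz r n) N.
Proof.
move=> proj ez B f g se; have [mi ei ep] := res_exact r n.
have [S [i [p [ret [se0 hret]]]]] := biproducts ax N (syz r n).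
pose Q := se_extension se; pose Q0 := se_extension se0.
have [mi0 ei0 ep0] := se0.
have [la0 hla0] := projective_lift (syz_out r n) (proj n) ep0.
have [psi0 hpsi0] : exists psi, i ∘ psi = la0 ∘ syz_in r n.
  by apply: (ker_lift ax mi0 ei0); rewrite (compA ax) hla0 (exact0 ax ei).
have [phi0 h0] := splices_comparison (Q := Q0) hla0 hpsi0.
have tr0 : comparison_trivial (splices Q0) (idm _).
  move=> phi psi h; have [v hv] := comparison_unique proj h h0.
  exists (addm v (ret ∘ la0)); rewrite (compDr ax) hv -(compA ax) -hpsi0 (compA ax) hret.
  by rewrite (comp1m ax) subhK.
have [mf ef eg] := se.
have [la hla] := projective_lift (syz_out r n) (proj n) eg.
have [psi hpsi] : exists psi, f ∘ psi = la ∘ syz_in r n.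
  by apply: (ker_lift ax mf ef); rewrite (compA ax) hla (exact0 ax ei).
have [phi h] := splices_comparison (Q := Q) hla hpsi.
have [v hv] := comparison_equiv proj (ez (splices Q0) (splices Q)) tr0 h.
have [s hs] : exists s, s ∘ syz_out r n = subh la (f ∘ v).
  by apply: (coker_desc ax ei ep); rewrite comp_subr -(compA ax) hv hpsi subh_self.
exists s; apply: (epi_cancel ep).
by rewrite -(compA ax) hs comp_subl hla (compA ax) (exact0 ax ef) (comp0m ax) subh0 (comp1m ax).
Qed.

(* Every extension receives a morphism from the one spliced out of the
   projectives and a split sequence. *)
Lemma splits_Ext_zero r n N : (forall j, projective (rob r j)) ->
  splits (syz r n) N -> Ext_zero n.+1 (syz r 0) N.
Proof.
move=> proj sp; have [mi ei ep] := res_exact r n.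
have [S [i [p [ret [se0 hret]]]]] := biproducts ax N (syz r n).
have [mi0 ei0 ep0] := se0.
pose Q0 := se_extension se0.
suff le E : ext_le (splices Q0) E.
  by move=> E E'; apply: (rst_trans _ _ _ (splices Q0));
    [apply: rst_sym|]; apply: rst_step; apply: le.
have [phi [psi [h1 h2]]] := comparison_ex E (idm _) proj.
have [v hv] := splits_extend psi sp (res_exact r n).
(* Subtracting the extension v of psi makes phi n vanish on the next syzygy; what it induces is the
   component of the morphism on the complement of N. *)
have [om hom] : exists om, om ∘ syz_out r n = subh (phi n) (ext_in E ∘ v).
  by apply: (coker_desc ax ei ep); rewrite comp_subr -(compA ax) hv h2 subh_self.
pose th : mor (ext_obj Q0 0) (ext_obj E n) := addm (ext_in E ∘ ret) (om ∘ p).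
have dom : ext_d E n ∘ om = augment (idm _) phi n.
  apply: (epi_cancel ep); rewrite -(compA ax) hom comp_subl h1 // (compA ax).
  by rewrite (exact0 ax (ext_exact_in E)) (comp0m ax) subh0.
have [|psi' [k1 k2]] := splices_map (Q := Q0) (th := th) (fun j hj => h1 j (ltnW hj)).
  rewrite /th (compDl ax) !(compA ax) (exact0 ax (ext_exact_in E)) (comp0m ax) (add0m ax).
  by rewrite dom.
exists psi'; split.
  by move=> j hj; apply/(heq_eq ax); rewrite k1 //; case: (j).
apply/(heq_eq ax); rewrite k2 /th (compDr ax) -!(compA ax) hret (exact0 ax ei0).
by rewrite (compm0 ax) addm0 (compm1 ax).
Qed.

(* Ext^i(M, N) = 0 for all i > 0, expressed through projective resolutions. *)
Definition splits_all M N : Prop := forall r, (forall j, projective (rob r j)) ->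
  syz r 0 = M -> forall n, splits (syz r n) N.

Lemma splits_all_Ext M N : (forall i, (0 < i)%N -> Ext_zero i M N) -> splits_all M N.
Proof. by move=> h r pr e n; apply: Ext_zero_splits pr _; rewrite e; apply: h. Qed.

Lemma splits_all_splits M N : splits_all M N -> splits M N.
Proof. by move=> h; have [r [e pr]] := projective_resolution M; rewrite -e; apply: (h r pr e 0%N). Qed.

Lemma splits_all_shift M N' N N'' (f : mor N' N) (g : mor N N'') : short_exact f g ->
  splits_all M N' -> splits_all M N -> splits_all M N''.
Proof.
move=> se h1 h2 r pr e n; apply: (splits_shift (res_exact r n) se).
- exact: projective_splits.
- exact: h1.
- exact: h2.
Qed.

Definition cons_resolution r P M (i : mor (syz r 0) P) (p : mor P M) (se : short_exact i p) :=
  @Resolution (fun j => if j is j'.+1 then syz r j' else M) (fun j => if j is j'.+1 then rob r j' else P)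
   (fun j => match j with 0 => i | j'.+1 => syz_in r j' end)
   (fun j => match j with 0 => p | j'.+1 => syz_out r j' end)
   (fun j => match j with 0 => se | j'.+1 => res_exact r j' end).

(** Dimension shifting from M to its syzygy A. In this form the vanishing of Ext^2 reaches the
    horseshoe argument. *)
Lemma splits_all_syz A P M N (i : mor A P) (p : mor P M) : short_exact i p -> projective P ->
  splits_all M N -> splits_all A N.
Proof.
move=> se pP h r pr e n; subst A.
by apply: (h (cons_resolution se) _ erefl n.+1) => -[|j]; [apply: pP|apply: pr].
Qed.

Lemma Ext_zero1 M N : Ext_zero 1 M N <-> splits M N.
Proof.
have [r [<- proj]] := projective_resolution M.
by split; [apply: (Ext_zero_splits (n := 0))|apply: (splits_Ext_zero (n := 0))].
Qed.

Lemma wedge_resdim w m M : closed_iso w -> wedge w m M <-> resdim w m M.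
Proof.
move=> iso; split.
  elim: m M => [|m IH] M [E [d [[e0 ex] mo hw]]] /=.
    have [g [dg gd]] := mono_epi_iso mo e0.
    by apply: (iso _ _ _ _ dg gd); apply: (hw 0%N).
  have [K [k [mk ek]]] := kernels ax (d 0%N).
  have [e he] := ker_lift ax mk ek (exact0 ax (ex 0%N isT)).
  exists K, (E 0%N), k, (d 0%N); split=> //; first exact: (hw 0%N).
  apply: IH; exists (fun j => E j.+1).
  exists (fun j => match j return mor (E j.+1) (aug K (fun j => E j.+1) j) with 0 => e | j'.+1 => d j'.+2 end); split.
  - split=> [|[|j] hj].
    + by apply: (factor_epi ax mk ek); rewrite he; apply: ex.
    + by apply/(exact_mono ax _ _ mk); rewrite he; apply: (ex 1%N).
    + exact: (ex j.+2).
  - case: (m) mo => [|j] mo; last exact: mo.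
    by apply/(exact_mono ax _ _ mk); rewrite he.
  - by move=> j hj; apply: (hw j.+1).
elim: m M => [|m IH] M.
  move=> hM; exists (fun _ => M).
  exists (fun j => match j return mor M (aug M (fun _ => M) j) with 0 => idm M | j'.+1 => zerom _ _ end); split=> //.
  - by split=> //; apply: idm_epi.
  - exact: idm_mono.
move=> [T [W [f [g [se hW /IH[E [d [ex mo hE]]]]]]]].
exists (splice_obj W E), (splice_d f g d); split.
- exact: splice_exact.
- exact: splice_mono.
- by case=> // j; apply: hE.
Qed.
End Homological.

(** * The category of modules *)

Section Mod.
Variable R : pzRingType.
Implicit Types A B D E M N T Q : lmodType R.

Lemma Mod_monoP A B (f : {linear A -> B}) :
  @is_mono (Mod R) A B f <-> forall x, f x = 0 -> x = 0.
Proof.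
split=> [h x /h[y /= <-] //|h x]; split=> [/h ->|[y /= <-]]; last exact: linear0.
by exists 0.
Qed.

Lemma Mod_epiP A B (f : {linear A -> B}) :
  @is_epi (Mod R) A B f <-> forall y, exists x, f x = y.
Proof. by split=> [h y|h y]; [apply/h|split=> // _]. Qed.

Lemma Mod_exactP A B D (f : {linear A -> B}) (g : {linear B -> D}) :
  @short_exact (Mod R) A B D f g <->
  [/\ forall x, f x = 0 -> x = 0, forall x, g (f x) = 0,
      forall y, g y = 0 -> exists x, f x = y & forall z, exists y, g y = z].
Proof.
split=> [[/Mod_monoP h1 h2 /Mod_epiP h3]|[h1 h2 h3 h4]].
  by split=> // [x|y]; [apply/h2; exists x|move/h2].
split; [exact/Mod_monoP| |exact/Mod_epiP].
by move=> y; split=> [/h3//|[x <-]].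
Qed.

Lemma inj_lin A B (f : {linear A -> B}) : (forall x, f x = 0 -> x = 0) -> injective f.
Proof.
by move=> h x y e; apply/eqP; rewrite -subr_eq0; apply/eqP/h; rewrite linearB e subrr.
Qed.

Lemma lift_lin A B D T (f : {linear A -> B}) (g : {linear B -> D}) (h : {linear T -> B}) :
  (forall x, f x = 0 -> x = 0) -> lin_exact f g -> (forall t, g (h t) = 0) ->
  exists h' : {linear T -> A}, forall t, f (h' t) = h t.
Proof.
move=> /inj_lin fi ex gh; apply: (graph_linear (G := fun t x => f x = h t)).
- by move=> t; apply/ex.
- by move=> x; rewrite linear0 -(linear0 f) => /fi.
- by move=> a t x t' x' e e'; rewrite !linearP e e'.
Qed.

Lemma desc_lin A B D T (f : {linear A -> B}) (g : {linear B -> D}) (h : {linear B -> T}) :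
  lin_exact f g -> (forall z, exists y, g y = z) -> (forall x, h (f x) = 0) ->
  exists h' : {linear D -> T}, forall y, h' (g y) = h y.
Proof.
move=> ex gs hf.
have h0 y : g y = 0 -> h y = 0 by move/ex => [x <-].
have [h' hh'] : exists h' : {linear D -> T}, forall z, exists2 y, g y = z & h y = h' z.
  apply: (graph_linear (G := fun z t => exists2 y, g y = z & h y = t)).
  - by move=> z; have [y hy] := gs z; exists (h y), y.
  - by move=> t [y /h0 ->].
  - by move=> a _ _ _ _ [y <- <-] [y' <- <-]; exists (a *: y + y'); rewrite linearP.
exists h' => y; have [y' e <-] := hh' (g y); apply/eqP; rewrite -subr_eq0 -linearB.
by apply/eqP/h0; rewrite linearB e subrr.
Qed.

Lemma prod_lin A B D (f : {linear A -> D}) (g : {linear B -> D}) :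
  exists h : {linear (A * B)%type -> D}, forall p, h p = f p.1 + g p.2.
Proof.
have l : linear (fun p : A * B => f p.1 + g p.2).
  by move=> a [x y] [x' y'] /=; rewrite !linearP scalerDr addrACA.
by exists (mklin l).
Qed.

Lemma pair_lin A B D (f : {linear D -> A}) (g : {linear D -> B}) :
  exists h : {linear D -> (A * B)%type}, forall x, h x = (f x, g x).
Proof.
have l : linear (fun x : D => (f x, g x)).
  by move=> a x y; rewrite !linearP.
by exists (mklin l).
Qed.

Program Definition push_rel A B N (f : {linear A -> B}) (a : {linear A -> N}) :
    submodule (N * B)%type :=
  @Submodule R _ (fun p => exists x, a x = p.1 /\ f x = - p.2) _ _.
Next Obligation. by move=> A B N f a; exists 0; rewrite !linear0; split; rewrite /= ?oppr0. Qed.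
Next Obligation.
move=> A B N f a c [u v] [u' v'] /= [x [e1 e2]] [x' [e1' e2']]; exists (c *: x + x').
by rewrite !linearP e1 e1' e2 e2'; split=> //=; rewrite opprD scalerN.
Qed.

(** Stated for any quotient map q with the right kernel, so that it serves for modules and, degree
    by degree, for complexes. *)
Lemma push_exact A B D N (Q : lmodType R) (f : {linear A -> B}) (g : {linear B -> D}) (a : {linear A -> N})
    (q : {linear (N * B)%type -> Q}) (g' : {linear Q -> D}) :
  (forall x, f x = 0 -> x = 0) -> lin_exact f g ->
  (forall p, q p = 0 <-> push_rel f a p) -> (forall y, exists p, q p = y) ->
  (forall p, g' (q p) = g p.2) ->
  [/\ forall n, q (n, 0) = 0 -> n = 0, forall x, q (0, f x) = q (a x, 0),
   forall n, g' (q (n, 0)) = 0 & forall y, g' y = 0 -> exists n, q (n, 0) = y].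
Proof.
move=> fi ex kq sq hg'; split.
- by move=> n /kq[x /= []] <-; rewrite oppr0 => /fi ->; rewrite linear0.
- move=> x; apply/eqP; rewrite -subr_eq0 -linearB; apply/eqP/kq; exists (- x).
  by rewrite !linearN /= sub0r subr0.
- by move=> n; rewrite hg' /= linear0.
move=> y; have [[n b] <-] := sq y; rewrite hg' /= => /ex[x hx].
exists (n + a x); apply/eqP; rewrite -subr_eq0 -linearB; apply/eqP/kq; exists x => /=.
by rewrite addrAC subrr add0r sub0r opprK.
Qed.

Lemma Mod_pushouts A B D N (f : {linear A -> B}) (g : {linear B -> D}) (a : {linear A -> N}) :
  @short_exact (Mod R) A B D f g ->
  exists (Q : lmodType R) (f' : {linear N -> Q}) (g' : {linear Q -> D}) (b : {linear B -> Q}),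
    [/\ @short_exact (Mod R) _ _ _ f' g', forall x, b (f x) = f' (a x) & forall y, g' (b y) = g y].
Proof.
move=> se; have [mf ex eg] := se; have /Mod_exactP[fi gf _ gs] := se.
pose q := quop (push_rel f a).
have [i1 hi1] := pair_lin (idfun : {linear N -> N}) (\0 : {linear N -> B}).
have [i2 hi2] := pair_lin (\0 : {linear B -> N}) (idfun : {linear B -> B}).
have [s2 hs2] := prod_lin (\0 : {linear N -> D}) g.
have [g' hg'] : exists g' : {linear quom (push_rel f a) -> D}, forall p, g' (q p) = s2 p.
  apply: (desc_lin (f := subi (push_rel f a))).
  - move=> p; split=> [/quop_eq0/subi_ex//|[z <-]]; exact/quop_eq0/subi_mem.
  - exact: quop_surj.
  - move=> z; have [x /= [_ e]] := subi_mem z; rewrite hs2 /= add0r.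
    by rewrite -[X in g X]opprK -e linearN gf oppr0.
have {}hg' p : g' (q p) = g p.2 by rewrite hg' hs2 add0r.
have [h1 h2 h3 h4] := push_exact fi ex (quop_eq0 (push_rel f a)) (quop_surj (S := _)) hg'.
exists (quom (push_rel f a)), (q \o i1), g', (q \o i2); split.
- apply/Mod_exactP; split=> /=.
  + by move=> n; rewrite hi1; apply: h1.
  + by move=> n; rewrite hi1; apply: h3.
  + by move=> y /h4[n <-]; exists n; rewrite hi1.
  + by move=> z; have [y <-] := gs z; exists (q (0, y)); rewrite hg'.
- by move=> x /=; rewrite hi1 hi2; apply: h2.
- by move=> y; rewrite [LHS]hg' hi2.
Qed.

Lemma Mod_exact_mono A B D E (f : {linear A -> B}) (e : {linear B -> D}) (k : {linear D -> E}) :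
  (forall x, k x = 0 -> x = 0) -> lin_exact f e <-> lin_exact f (k \o e).
Proof.
move=> mk; split=> ex y; split.
- by move/mk/ex.
- by move/ex => /= ->; rewrite linear0.
- by move=> h; apply/ex; rewrite /= h linear0.
- by move/ex/mk.
Qed.

Lemma Mod_exact_epi A B D E (e : {linear A -> B}) (k : {linear B -> D}) (g : {linear D -> E}) :
  (forall y, exists x, e x = y) -> lin_exact k g <-> lin_exact (k \o e) g.
Proof.
move=> se; split=> ex y; split.
- by move/ex => [x <-]; have [x' <-] := se x; exists x'.
- by move=> [x <-]; apply/ex; exists (e x).
- by move/ex => [x <-]; exists (e x).
- by move=> [x <-]; have [x' <-] := se x; apply/ex; exists x'.
Qed.

Lemma Mod_factor_epi A B D E (e : {linear A -> B}) (k : {linear B -> D}) (g : {linear D -> E}) :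
  (forall x, k x = 0 -> x = 0) -> lin_exact k g -> lin_exact (k \o e) g ->
  forall y, exists x, e x = y.
Proof.
move=> /inj_lin ki ex ex' y; have /ex'[x /ki hx] : g (k y) = 0 by apply/ex; exists y.
by exists x.
Qed.

Lemma Mod_projective_free M : projective (freem M : Mod R).
Proof.
move=> A B D f g h ex gh.
have [|h' hh'] := freem_lift (h := h) ex; last by exists h'; apply: linear_eq.
by move=> x; have := congr1 (fun u : {linear freem M -> D} => u x) gh.
Qed.

Lemma ker_ses M N (f : {linear M -> N}) :
  (forall y, exists x, f x = y) -> @short_exact (Mod R) _ _ _ (subi (kerS f)) f.
Proof.
move=> fs; apply/Mod_exactP; split=> //.
- by move=> x e; apply: subi_inj; rewrite e linear0.
- exact: subi_mem.
- by move=> y /(subi_ex (S := kerS f)).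
Qed.

Lemma Mod_axioms : abelian_axioms (Mod R).
Proof.
have ap A B (f g : {linear A -> B}) x : f = g -> f x = g x by move->.
apply: (@AbelianAxioms (Mod R) _ _ _ _ _ _ _ (fun A B f => (\- (f : {linear A -> B}) : {linear A -> B}))) => /=.
- by move=> A B f g; split=> [/linear_eq|->].
- by move=> A B D E h g f; apply: linear_eq.
- by move=> A B f; apply: linear_eq.
- by move=> A B f; apply: linear_eq.
- by move=> A B f g h; apply: linear_eq => x /=; rewrite addrA.
- by move=> A B f g; apply: linear_eq => x /=; rewrite addrC.
- by move=> A B f; apply: linear_eq => x /=; rewrite add0r.
- by move=> A B f; apply: linear_eq => x /=; rewrite addNr.
- by move=> A B D h f g; apply: linear_eq => x /=; rewrite linearD.
- by move=> A B D f g h; apply: linear_eq.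
- by move=> A B D f; apply: linear_eq.
- by move=> A B D f; apply: linear_eq => x /=; rewrite linear0.
- by move=> A B D f g ex; apply: linear_eq => x /=; apply/ex; exists x.
- move=> A B T f h /Mod_monoP mf e; apply: linear_eq => x /=.
  by apply: mf; apply: (ap _ _ _ _ x e).
- move=> B D T g h /Mod_epiP sg e; apply: linear_eq => y /=; have [x <-] := sg y.
  exact: (ap _ _ _ _ x e).
- move=> A B D T f g h /Mod_monoP mf ex e.
  have [|h' hh'] := lift_lin (h := h) mf ex; last by exists h'; apply: linear_eq.
  by move=> t; apply: (ap _ _ _ _ t e).
- move=> A B D T f g h ex /Mod_epiP sg e.
  have [|h' hh'] := desc_lin (h := h) ex sg; last by exists h'; apply: linear_eq.
  by move=> t; apply: (ap _ _ _ _ t e).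
- move=> A B f; exists (subm (kerS f)), (subi (kerS f)); split.
    by apply/Mod_monoP => x e; apply: subi_inj; rewrite e linear0.
  by move=> y; split=> [/(subi_ex (S := kerS f))//|[x <-]]; apply: (subi_mem (S := kerS f) x).
- move=> A B D N f g a /(Mod_pushouts a)[Q [f' [g' [b [h1 h2 h3]]]]].
  by exists Q, f', g', b; split=> //; apply: linear_eq.
- move=> A B; have [i hi] := pair_lin (idfun : {linear A -> A}) (\0 : {linear A -> B}).
  have [p hp] := prod_lin (\0 : {linear A -> B}) (idfun : {linear B -> B}).
  have [r hr] := prod_lin (idfun : {linear A -> A}) (\0 : {linear B -> A}).
  exists (A * B)%type, i, p, r; split; last by apply: linear_eq => x /=; rewrite hr hi /= addr0.
  apply/Mod_exactP; split.
  + by move=> x; rewrite hi => -[].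
  + by move=> x; rewrite hi hp /= addr0.
  + by move=> [x y]; rewrite hp /= add0r => ->; exists x; rewrite hi.
  + by move=> y; exists (0, y); rewrite hp /= add0r.
- move=> M; exists (subm (kerS (evid M))), (freem M), (subi _), (evid M).
  by split; [apply/ker_ses/evid_surj|apply: Mod_projective_free].
- by move=> A; apply/Mod_monoP.
- by move=> A; apply/Mod_epiP => y; exists y.
- by move=> A B D E f e k /Mod_monoP mk; apply: Mod_exact_mono.
- by move=> A B D E e k g /Mod_epiP sk; apply: Mod_exact_epi.
- move=> A B D E e k g /Mod_monoP mk ex ex'; apply/Mod_epiP.
  exact: Mod_factor_epi mk ex ex'.
Qed.
End Mod.

(** * The category of complexes *)

(** Proving a statement at k - 1 leaves degree k available above it, without a transport from k - 1
    + 1. *)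
Lemma int_shift (P : int -> Prop) : (forall k, P (k - 1)) -> forall k, P k.
Proof. by move=> h k; rewrite -(addrK 1 k); apply: h. Qed.

(* Reindexing a family along k |-> k - 1: this confines the transports along
   equalities of degrees. *)
Lemma shift_family (F : int -> Type) (s : forall k, F (k - 1)) :
  exists s' : forall k, F k, forall k, s' (k - 1) = s k.
Proof.
have e (k : int) : k + 1 - 1 = k by exact: addrK.
exists (fun k => eq_rect _ F (s (k + 1)) _ (e k)) => k.
suff: forall i (h : i = k) (h' : i - 1 = k - 1), eq_rect _ F (s i) _ h' = s k.
  by apply; exact: subrK.
by move=> i h; subst i => h'; rewrite (eq_irrelevance h' erefl).
Qed.

Lemma point_family (F : int -> Type) (z : forall k, F k) n (x : F n) :
  exists s : forall k, F k, s n = x.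
Proof.
exists (fun k => match pselect (n = k) with left e => eq_rect _ F x _ e | right _ => z k end).
by case: pselect => // e; rewrite (eq_irrelevance e erefl).
Qed.

Section Ch.
Variable R : pzRingType.
Implicit Types A B D E M N T Q : chain_complex R.

Lemma chain_eq A B (f g : chain_map A B) : (forall k x, f k x = g k x) -> f = g.
Proof.
case: f g => [f cf] [g cg] /= h.
have e : f = g by apply: functional_extensionality_dep => k; apply: linear_eq; apply: h.
by subst g; rewrite (Prop_irrelevance cf cg).
Qed.

Lemma Ch_monoP A B (f : chain_map A B) :
  @is_mono (Ch R) A B f <-> forall k x, f k x = 0 -> x = 0.
Proof.
split=> h k; first exact: (Mod_monoP (f k)).1 (h k).
exact: (Mod_monoP (f k)).2 (h k).
Qed.

Lemma Ch_epiP A B (f : chain_map A B) :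
  @is_epi (Ch R) A B f <-> forall k y, exists x, f k x = y.
Proof.
split=> h k; first exact: (Mod_epiP (f k)).1 (h k).
exact: (Mod_epiP (f k)).2 (h k).
Qed.

Lemma Ch_degreewise A B D (f : chain_map A B) (g : chain_map B D) :
  @short_exact (Ch R) A B D f g <->
  forall k, @short_exact (Mod R) (A k) (B k) (D k) (f k) (g k).
Proof.
split=> [[h1 h2 h3] k|h]; first by split; [apply: h1|apply: h2|apply: h3].
by split=> k; case: (h k).
Qed.

Lemma Ch_exactP A B D (f : chain_map A B) (g : chain_map B D) :
  @short_exact (Ch R) A B D f g <->
  [/\ forall k x, f k x = 0 -> x = 0, forall k x, g k (f k x) = 0,
      forall k y, g k y = 0 -> exists x, f k x = y & forall k z, exists y, g k y = z].
Proof.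
split=> [/Ch_degreewise h|[h1 h2 h3 h4]].
  by split=> k; have [? ? ? ?] := (Mod_exactP _ _).1 (h k).
apply/Ch_degreewise => k; apply/Mod_exactP.
by split; [apply: h1|apply: h2|apply: h3|apply: h4].
Qed.

Lemma lift_chain A B D T (f : chain_map A B) (g : chain_map B D) (h : chain_map T B) :
  (forall k x, f k x = 0 -> x = 0) -> (forall k, lin_exact (f k) (g k)) ->
  (forall k t, g k (h k t) = 0) ->
  exists h' : chain_map T A, forall k t, f k (h' k t) = h k t.
Proof.
move=> fi ex e; have /dchoice[h' hh'] k := lift_lin (h := h k) (fi k) (ex k) (e k).
have c k x : h' (k - 1) (bd T k x) = bd A k (h' k x).
  by apply: (inj_lin (fi (k - 1))); rewrite hh' !cmap_bd hh'.
by exists (ChainMap c).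
Qed.

Lemma desc_chain A B D T (f : chain_map A B) (g : chain_map B D) (h : chain_map B T) :
  (forall k, lin_exact (f k) (g k)) -> (forall k z, exists y, g k y = z) ->
  (forall k x, h k (f k x) = 0) ->
  exists h' : chain_map D T, forall k y, h' k (g k y) = h k y.
Proof.
move=> ex gs e; have /dchoice[h' hh'] k := desc_lin (h := h k) (ex k) (gs k) (e k).
have c k x : h' (k - 1) (bd D k x) = bd T k (h' k x).
  by have [y <-] := gs k x; rewrite -cmap_bd !hh' cmap_bd.
by exists (ChainMap c).
Qed.

Lemma subcomplex_ex B (S : forall k, submodule (B k)) :
  (forall k x, S k x -> S (k - 1) (bd B k x)) ->
  exists A (i : chain_map A B), (forall k x, i k x = 0 -> x = 0) /\
    forall k y, S k y <-> exists x, i k x = y.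
Proof.
move=> hS.
have imem k y : S k y <-> exists x, subi (S k) x = y.
  by split=> [/subi_ex//|[x <-]]; apply: subi_mem.
have sinj k x : subi (S k) x = 0 -> x = 0.
  by move=> e; apply: subi_inj; rewrite e linear0.
have /dchoice[d hd] k : exists d : {linear subm (S k) -> subm (S (k - 1))},
    forall x, subi _ (d x) = bd B k (subi _ x).
  have [|//|//|d hd] := @graph_linear R _ _ (fun x y => subi (S (k - 1)) y = bd B k (subi (S k) x)).
  - by move=> x; apply/imem/hS/imem; exists x.
  - by move=> y; rewrite !linear0; apply: sinj.
  - by move=> a x y x' y' e e'; rewrite !linearP e e'.
  - by exists d.
have dd k x : d (k - 1) (d k x) = 0 by apply: sinj; rewrite !hd bd_bd.
exists (Complex dd), (@ChainMap R (Complex dd) B (fun k => subi (S k)) hd).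
by split.
Qed.

Lemma quocomplex_ex B (S : forall k, submodule (B k)) :
  (forall k x, S k x -> S (k - 1) (bd B k x)) ->
  exists Q (q : chain_map B Q), (forall k y, exists x, q k x = y) /\
    forall k y, q k y = 0 <-> S k y.
Proof.
move=> hS.
have /dchoice[d hd] k : exists d : {linear quom (S k) -> quom (S (k - 1))},
    forall x, d (quop _ x) = quop _ (bd B k x).
  apply: (desc_lin (f := subi (S k)) (h := quop (S (k - 1)) \o bd B k)).
  - by move=> y; split=> [/quop_eq0/subi_ex//|[x <-]]; apply/quop_eq0/subi_mem.
  - exact: quop_surj.
  - by move=> x; apply/quop_eq0/hS/subi_mem.
have dd k x : d (k - 1) (d k x) = 0.
  by have [y <-] := quop_surj x; rewrite !hd bd_bd linear0.
have cq k x : quop (S (k - 1)) (bd B k x) = d k (quop (S k) x) by rewrite hd.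
exists (Complex dd), (@ChainMap R B (Complex dd) (fun k => quop (S k)) cq).
by split=> k y; [apply: quop_surj|apply: quop_eq0].
Qed.

Section Product.
Variables A B : chain_complex R.

Lemma prodcx_linear k : linear (fun p : A k * B k => (bd A k p.1, bd B k p.2)).
Proof. by move=> a x y /=; rewrite !linearP. Qed.
Lemma prodcx_bd_bd k (x : A k * B k) :
  mklin (@prodcx_linear (k - 1)) (mklin (@prodcx_linear k) x) = 0.
Proof. by rewrite /= !bd_bd. Qed.
Definition prodcx : chain_complex R :=
  @Complex R (fun k => (A k * B k)%type) (fun k => mklin (@prodcx_linear k)) prodcx_bd_bd.

Lemma prod_chain D (f : chain_map A D) (g : chain_map B D) :
  exists h : chain_map prodcx D, forall k p, h k p = f k p.1 + g k p.2.
Proof.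
have /dchoice[h hh] k := prod_lin (f k) (g k).
have c k (p : prodcx k) : h (k - 1) (bd prodcx k p) = bd D k (h k p).
  by rewrite !hh /= linearD !cmap_bd.
by exists (ChainMap c).
Qed.

Lemma pair_chain D (f : chain_map D A) (g : chain_map D B) :
  exists h : chain_map D prodcx, forall k x, h k x = (f k x, g k x).
Proof.
have /dchoice[h hh] k := pair_lin (f k) (g k).
have c k x : h (k - 1) (bd D k x) = bd prodcx k (h k x).
  by rewrite !hh /= !cmap_bd.
by exists (@ChainMap R D prodcx h c).
Qed.
End Product.

Lemma ker_chain A B (f : chain_map A B) :
  exists K (i : chain_map K A), (forall k x, i k x = 0 -> x = 0) /\
    forall k y, f k y = 0 <-> exists x, i k x = y.
Proof.
apply: (@subcomplex_ex A (fun k => kerS (f k))) => k x /= e.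
by rewrite cmap_bd e linear0.
Qed.

Lemma coker_chain A B (f : chain_map A B) :
  exists Q (q : chain_map B Q), (forall k y, exists x, q k x = y) /\
    forall k, lin_exact (f k) (q k).
Proof.
have [|Q [q [q1 q2]]] := @quocomplex_ex B (fun k => imS (f k)).
  by move=> k _ /= [x <-]; exists (bd A k x); rewrite cmap_bd.
by exists Q, q.
Qed.

Lemma Ch_pushouts A B D N (f : chain_map A B) (g : chain_map B D) (a : chain_map A N) :
  @short_exact (Ch R) A B D f g ->
  exists Q (f' : chain_map N Q) (g' : chain_map Q D) (b : chain_map B Q),
    [/\ @short_exact (Ch R) _ _ _ f' g', forall k x, b k (f k x) = f' k (a k x)
      & forall k y, g' k (b k y) = g k y].
Proof.
move=> se; have [mf ex eg] := se; have /Ch_exactP[fi gf _ gs] := se.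
have [|Q [q [sq kq]]] := @quocomplex_ex (prodcx N B) (fun k => push_rel (f k) (a k)).
  move=> k p /= [x [e1 e2]]; exists (bd A k x).
  by rewrite !cmap_bd e1 e2 linearN.
have [i1 hi1] := pair_chain (chain_id N) (chain_zero N B).
have [i2 hi2] := pair_chain (chain_zero B N) (chain_id B).
have [s2 hs2] := prod_chain (chain_zero N D) g.
have [K [j [ji jK]]] := ker_chain q.
have [g' hg'] : exists g' : chain_map Q D, forall k p, g' k (q k p) = s2 k p.
  apply: (desc_chain (f := j)) => // k z.
  have /kq[x /= [_ e]] : q k (j k z) = 0 by apply/jK; exists z.
  by rewrite hs2 /= add0r -[X in g k X]opprK -e linearN gf oppr0.
have {}hg' k p : g' k (q k p) = g k p.2 by rewrite hg' hs2 add0r.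
have H k := push_exact (fi k) (ex k) (kq k) (sq k) (hg' k).
exists Q, (chain_comp q i1), g', (chain_comp q i2); split.
- apply/Ch_exactP; split=> k /=; have [h1 h2 h3 h4] := H k.
  + by move=> n; rewrite hi1; apply: h1.
  + by move=> n; rewrite hi1; apply: h3.
  + by move=> y /h4[n <-]; exists n; rewrite hi1.
  + by move=> z; have [y <-] := gs k z; exists (q k (0, y)); rewrite hg'.
- by move=> k x /=; rewrite hi1 hi2; have [_ h _ _] := H k; apply: h.
- by move=> k y; rewrite [LHS]hg' hi2.
Qed.

(** * Disk complexes *)

Section Disk.
Variable F : int -> lmodType R.

(* The product of the disk complexes with value F k in the degrees k and k + 1. *)
Lemma disk_linear k : linear (fun p : F k * F (k - 1) => (p.2, 0) : F (k - 1) * F (k - 1 - 1)).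
Proof.
by move=> a x y /=; congr pair; rewrite -[RHS]/(a *: 0 + 0) scaler0 addr0.
Qed.
Lemma disk_bd_bd k (x : F k * F (k - 1)) :
  mklin (@disk_linear (k - 1)) (mklin (@disk_linear k) x) = 0.
Proof. by []. Qed.
Definition disk : chain_complex R :=
  @Complex R (fun k => (F k * F (k - 1))%type) (fun k => mklin (@disk_linear k)) disk_bd_bd.

(** The elements (0, b) generate the disks freely: as (b, 0) is the boundary of (0, b), its image is
    forced. Dually, in [disk_to], the first components determine a chain map into the disks. *)
Lemma disk_from M (psi : forall k, {linear F (k - 1) -> M k}) :
  exists h : chain_map disk M, (forall k b, h k (0, b) = psi k b) /\
    forall k b, h (k - 1) (b, 0) = bd M k (psi k b).
Proof.
have [chi hchi] := @shift_family (fun k => {linear F k -> M k}) (fun k => bd M k \o psi k).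
have /dchoice[h hh] k := prod_lin (chi k) (psi k).
have c k x : h (k - 1) (bd disk k x) = bd M k (h k x).
  rewrite !hh /= linear0 addr0 hchi linearD /=.
  suff -> : bd M k (chi k x.1) = 0 by rewrite add0r.
  move: k {x} x.1; apply: int_shift => k y.
  by rewrite hchi /= bd_bd.
exists (@ChainMap R disk M h c); split=> k b; rewrite [LHS]hh /= linear0 ?add0r ?addr0 //.
by rewrite hchi.
Qed.

Lemma disk_to M (phi : forall k, {linear M k -> F k}) :
  exists h : chain_map M disk, forall k x, h k x = (phi k x, phi (k - 1) (bd M k x)).
Proof.
have /dchoice[h hh] k := pair_lin (phi k) (phi (k - 1) \o bd M k).
have c k x : h (k - 1) (bd M k x) = bd disk k (h k x).
  by rewrite !hh /= bd_bd linear0.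
by exists (@ChainMap R M disk h c).
Qed.

Lemma disk_ext M (g h : chain_map disk M) :
  (forall k b, g k (0, b) = h k (0, b)) -> g = h.
Proof.
move=> e; apply: chain_eq.
have e' : forall k b, g k (b, 0) = h k (b, 0).
  apply: int_shift => k b.
  by rewrite [(b, 0)](_ : _ = bd disk k (0, b)) // !cmap_bd e.
move=> k [a b]; rewrite [(a, b)](_ : _ = (a, 0) + (0, b) :> F k * F (k - 1)).
  by rewrite !linearD e e'.
by congr pair; rewrite ?addr0 ?add0r.
Qed.

Lemma disk_projective : (forall k, projective (F k : Mod R)) -> projective (disk : Ch R).
Proof.
move=> pF A B D f g h ex gh.
have gh0 k x : g k (h k x) = 0.
  by have := congr1 (fun u : chain_map disk D => u k x) gh.
have [i hi] : exists i : forall k, {linear F (k - 1) -> disk k}, forall k b, i k b = (0, b).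
  have /dchoice[i hi] k := pair_lin (\0 : {linear F (k - 1) -> F k}) (idfun : {linear F (k - 1) -> F (k - 1)}).
  by exists i.
have /dchoice[psi hpsi] k : exists psi : {linear F (k - 1) -> A k}, (f k \o psi : {linear _ -> _}) = (h k \o i k).
  apply: (pF (k - 1) (A k) (B k) (D k) (f k) (g k) (h k \o i k) (ex k)).
  by apply: linear_eq => x /=; rewrite gh0.
have [h' [hh' _]] := disk_from psi.
exists h'; apply: disk_ext => k b /=.
have := congr1 (fun u : {linear F (k - 1) -> B k} => u b) (hpsi k).
by rewrite /= hi hh'.
Qed.
End Disk.

(** * Suspension of complexes *)

Section Shift.
Variable M : chain_complex R.

Lemma up_bd_bd k x : (\- bd M (k - 1 - 1)) ((\- bd M (k - 1)) x) = 0.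
Proof. by rewrite /= linearN opprK bd_bd. Qed.
(** The suspension; the sign makes the projection in [disk_embed] a chain map. *)
Definition up : chain_complex R :=
  @Complex R (fun k => M (k - 1)) (fun k => (\- bd M (k - 1) : {linear _ -> _})) up_bd_bd.

Definition castl i j (e : i = j) : {linear M i -> M j} :=
  match e in _ = j return {linear M i -> M j} with erefl => idfun end.

Lemma castl_bd i j (e : i = j) (e' : i - 1 = j - 1) x :
  castl e' (bd M i x) = bd M j (castl e x).
Proof. by move: e' x; case: j / e => e' x; rewrite (eq_irrelevance e' erefl). Qed.

Lemma castl_comp i j l (e : i = j) (e' : j = l) (e'' : i = l) x :
  castl e' (castl e x) = castl e'' x.
Proof. by move: e'; case: j / e => e'; rewrite (eq_irrelevance e' e''). Qed.

Lemma castl_bij i j (e : i = j) : bijective (castl e).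
Proof. by case: j / e; exists idfun. Qed.
End Shift.

(** Desuspension holds only up to isomorphism, as k - 1 + 1 is not convertible to k. *)
Lemma down_ex M : exists N (th : chain_map (up N) M) (th' : chain_map M (up N)),
  (forall k x, th k (th' k x) = x) /\ (forall k x, th' k (th k x) = x).
Proof.
have e (k : int) : k + 1 - 1 = k - 1 + 1 by rewrite addrK subrK.
pose d k : {linear M (k + 1) -> M (k - 1 + 1)} := (\- (castl M (e k) \o bd M (k + 1))).
have dd k x : d (k - 1) (d k x) = 0.
  rewrite /d /= !linearN /= opprK.
  have e1 : k + 1 - 1 - 1 = k - 1 + 1 - 1 by rewrite addrK subrK.
  by rewrite -(castl_bd (e k) e1) bd_bd !linear0.
pose N := @Complex R (fun k => M (k + 1)) d dd.
have e2 (k : int) : k - 1 + 1 = k by rewrite subrK.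
have c k x : castl M (e2 (k - 1)) (bd (up N) k x) = bd M k (castl M (e2 k) x).
  have e3 : k - 1 + 1 - 1 = k - 1 by rewrite subrK.
  by rewrite /= opprK -(castl_bd (e2 k) e3); apply: castl_comp.
pose th := @ChainMap R (up N) M (fun k => castl M (e2 k)) c.
have /dchoice[ti hti] k : exists ti : {linear M k -> up N k}, forall x, th k (ti x) = x /\ forall y, ti (th k y) = y.
  have [g g1 g2] := castl_bij M (e2 k).
  have lg : linear (g : M k -> up N k).
    by move=> a x y; apply: (can_inj g1); rewrite [RHS]linearP !g2.
  by exists (mklin lg) => x; split; [apply: g2|move=> y; apply: g1].
have c' k x : ti (k - 1) (bd M k x) = bd (up N) k (ti k x).
  have {1}<- := (hti k x).1.
  by rewrite -cmap_bd; have [_ ->] := hti (k - 1) 0.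
exists N, th, (ChainMap c'); split=> k x; first by have [-> _] := hti k x.
by have [_ ->] := hti k 0.
Qed.

(** Up to isomorphism, the cone of the identity of N, placed between N and its suspension. *)
Lemma disk_embed N :
  exists (i : chain_map N (disk N)) (p : chain_map (disk N) (up N)),
   [/\ @short_exact (Ch R) _ _ _ i p, forall k x, i k x = (x, bd N k x)
     & forall k x, p k x = x.2 - bd N k x.1].
Proof.
have [i hi] := @disk_to N N (fun k => idfun).
have /dchoice[p hp] k := prod_lin (\- bd N k : {linear _ -> _}) (idfun : {linear N (k - 1) -> N (k - 1)}).
have c k x : p (k - 1) (bd (disk N) k x) = bd (up N) k (p k x).
  by rewrite !hp /= addr0 linearD linearN bd_bd oppr0 add0r.
have {}hp k x : p k x = x.2 - bd N k x.1 by rewrite hp; apply: addrC.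
exists i, (@ChainMap R (disk N) (up N) p c); split=> //; apply/Ch_exactP; split=> k /=.
- by move=> x; rewrite hi => -[].
- by move=> x; rewrite hp hi /= subrr.
- move=> [a b]; rewrite hp /= => /eqP; rewrite subr_eq0 => /eqP ->.
  by exists a; rewrite hi.
- by move=> z; exists (0, z); rewrite hp /= linear0 subr0.
Qed.

(** M is a quotient of the disks on its desuspension, and replacing the modules there by free ones
    mapping onto them keeps this. *)
Lemma projective_cover_ex M : exists (F : int -> lmodType R) (p : chain_map (disk (fun k => freem (F k))) M),
  forall k y, exists x, p k x = y.
Proof.
have [N [th [th' [h1 h2]]]] := down_ex M.
have [i [q [se _ hq]]] := disk_embed N; have /Ch_exactP[_ _ _ sq] := se.
have [F hF] : exists F : chain_map (disk (fun k => freem (N k))) (disk N),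
    forall k x, F k x = (evid (N k) x.1, evid (N (k - 1)) x.2).
  have /dchoice[F hF] k : exists F : {linear disk (fun k => freem (N k)) k -> disk N k},
      forall x, F x = (evid (N k) x.1, evid (N (k - 1)) x.2).
    have l : linear (fun x : disk (fun k => freem (N k)) k =>
       (evid (N k) x.1, evid (N (k - 1)) x.2) : disk N k) by move=> a x y; rewrite !linearP.
    by exists (mklin l).
  have c k x : F (k - 1) (bd _ k x) = bd (disk N) k (F k x).
    by rewrite !hF; congr pair; apply: linear0.
  by exists (ChainMap c).
exists N, (chain_comp th (chain_comp q F)) => k y /=.
have [[a b] hab] := sq k (th' k y).
have [a' ha'] := evid_surj a; have [b' hb'] := evid_surj b.
have e : F k (a', b') = (a, b) by rewrite hF; congr pair.
by exists (a', b'); rewrite e hab h1.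
Qed.

Lemma Ch_axioms : abelian_axioms (Ch R).
Proof.
have ap A B (f g : chain_map A B) k x : f = g -> f k x = g k x by move->.
have opp_ex A B (f : chain_map A B) k x : (\- f (k - 1)) (bd A k x) = bd B k ((\- f k) x).
  by rewrite /= cmap_bd linearN.
apply: (@AbelianAxioms (Ch R) _ _ _ _ _ _ _
  (fun A B f => @ChainMap R A B (fun k => (\- f k : {linear A k -> B k})) (opp_ex A B f))) => /=.
- by move=> A B f g; split=> [/chain_eq|->].
- by move=> A B D E h g f; apply: chain_eq.
- by move=> A B f; apply: chain_eq.
- by move=> A B f; apply: chain_eq.
- by move=> A B f g h; apply: chain_eq => k x /=; rewrite addrA.
- by move=> A B f g; apply: chain_eq => k x /=; rewrite addrC.
- by move=> A B f; apply: chain_eq => k x /=; rewrite add0r.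
- by move=> A B f; apply: chain_eq => k x /=; rewrite addNr.
- by move=> A B D h f g; apply: chain_eq => k x /=; rewrite linearD.
- by move=> A B D f g h; apply: chain_eq.
- by move=> A B D f; apply: chain_eq.
- by move=> A B D f; apply: chain_eq => k x /=; rewrite linear0.
- by move=> A B D f g ex; apply: chain_eq => k x /=; apply/ex; exists x.
- move=> A B T f h /Ch_monoP mf e; apply: chain_eq => k x /=.
  by apply: mf; apply: (ap _ _ _ _ k x e).
- move=> B D T g h /Ch_epiP sg e; apply: chain_eq => k y /=; have [x <-] := sg k y.
  exact: (ap _ _ _ _ k x e).
- move=> A B D T f g h /Ch_monoP mf ex e.
  have [|h' hh'] := lift_chain (h := h) mf ex; last by exists h'; apply: chain_eq.
  by move=> k t; apply: (ap _ _ _ _ k t e).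
- move=> A B D T f g h ex /Ch_epiP sg e.
  have [|h' hh'] := desc_chain (h := h) ex sg; last by exists h'; apply: chain_eq.
  by move=> k t; apply: (ap _ _ _ _ k t e).
- move=> A B f; have [K [i [i1 i2]]] := ker_chain f.
  by exists K, i; split; first exact/Ch_monoP.
- move=> A B D N f g a /(Ch_pushouts a)[Q [f' [g' [b [h1 h2 h3]]]]].
  by exists Q, f', g', b; split=> //; apply: chain_eq.
- move=> A B; have [i hi] := pair_chain (chain_id A) (chain_zero A B).
  have [p hp] := prod_chain (chain_zero A B) (chain_id B).
  have [r hr] := prod_chain (chain_id A) (chain_zero B A).
  exists (prodcx A B), i, p, r; split; last by apply: chain_eq => k x /=; rewrite hr hi /= addr0.
  apply/Ch_exactP; split=> k.
  + by move=> x; rewrite hi => -[].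
  + by move=> x; rewrite hi hp /= addr0.
  + by move=> [x y]; rewrite hp /= add0r => ->; exists x; rewrite hi.
  + by move=> y; exists (0, y); rewrite hp /= add0r.
- move=> M; have [F [p sp]] := projective_cover_ex M.
  have [K [i [i1 i2]]] := ker_chain p.
  exists K, (disk (fun k => freem (F k))), i, p; split.
    by split; [apply/Ch_monoP| |apply/Ch_epiP].
  by apply: disk_projective => k; apply: Mod_projective_free.
- by move=> A; apply: (Ch_monoP (chain_id A)).2.
- by move=> A; apply: (Ch_epiP (chain_id A)).2 => k y; exists y.
- move=> A B D E f e k /Ch_monoP mk.
  by split=> h j; have := h j; move/(Mod_exact_mono (f j) (e j) (mk j)).
- move=> A B D E e k g /Ch_epiP sk.
  by split=> h j; have := h j; move/(Mod_exact_epi (k j) (g j) (sk j)).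
- move=> A B D E e k g /Ch_monoP mk ex ex'; apply/Ch_epiP => j.
  exact: Mod_factor_epi (mk j) (ex j) (ex' j).
Qed.
End Ch.

(** * Cycles and classes of complexes *)

Section Modules.
Variable R : pzRingType.
Implicit Types A B D E M N T Q : lmodType R.
Implicit Types X w : obj_class (Mod R).

Lemma Mod_extend M N A B (f : {linear A -> B}) (g : {linear B -> M}) (a : {linear A -> N}) :
  splits (M : Mod R) N -> @short_exact (Mod R) _ _ _ f g ->
  exists b : {linear B -> N}, forall x, b (f x) = a x.
Proof.
move=> sp se; have [b hb] := splits_extend (Mod_axioms R) (a : mor (A : Mod R) N) sp se.
by exists b => x; have := congr1 (fun u : {linear A -> N} => u x) hb.
Qed.

Lemma Mod_lift M N B D (f : {linear N -> B}) (g : {linear B -> D}) (h : {linear M -> D}) :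
  splits (M : Mod R) N -> @short_exact (Mod R) _ _ _ f g ->
  exists h' : {linear M -> B}, forall x, g (h' x) = h x.
Proof.
move=> sp se; have [b hb] := splits_lift (Mod_axioms R) (h : mor (M : Mod R) D) sp se.
by exists b => x; have := congr1 (fun u : {linear M -> D} => u x) hb.
Qed.

Lemma Mod_splits_of_extend M N A B (f : {linear A -> B}) (g : {linear B -> M}) :
  @short_exact (Mod R) _ _ _ f g -> splits (B : Mod R) N ->
  (forall a : {linear A -> N}, exists b : {linear B -> N}, forall x, b (f x) = a x) ->
  splits (M : Mod R) N.
Proof.
move=> se sp h; apply: (splits_of_extend (Mod_axioms R) se sp) => a.
by have [b hb] := h a; exists b; apply: linear_eq.
Qed.

Lemma Mod_projective_splits M N : projective (M : Mod R) -> splits (M : Mod R) N.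
Proof. exact: (projective_splits (Mod_axioms R)). Qed.

(* A map on the syzygy of M is extended first to the preimage of M', then to
   the whole free module. *)
Lemma Mod_splits_ext_l N M' M M'' (f : {linear M' -> M}) (g : {linear M -> M''}) :
  @short_exact (Mod R) _ _ _ f g -> splits (M' : Mod R) N -> splits (M'' : Mod R) N ->
  splits (M : Mod R) N.
Proof.
move=> /Mod_exactP[fi gf fg gs] sp' sp''.
have sev := ker_ses (@evid_surj R M); set K := subm _ in sev; set i := subi _ in sev.
have [ii ei ie _] := (Mod_exactP _ _).1 sev.
have spP := Mod_projective_splits (N := N) (@Mod_projective_free R M).
apply: (Mod_splits_of_extend sev spP) => a.
pose p := evid M; pose gp : {linear _ -> _} := g \o p.
pose L := subm (kerS gp); pose l := subi (kerS gp).
have lK x : gp x = 0 <-> exists y, l y = x.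
  by split=> [/(subi_ex (S := kerS gp))//|[y <-]]; apply: (subi_mem (S := kerS gp) y).
have li x : l x = 0 -> x = 0 by move=> e; apply: subi_inj; rewrite e linear0.
have sel : @short_exact (Mod R) _ _ _ l gp.
  apply: ker_ses => z; have [y <-] := gs z; have [x <-] := evid_surj y.
  by exists x.
have fex : lin_exact f g by move=> y; split=> [/fg//|[x <-]].
have [q hq] : exists q : {linear L -> M'}, forall x, f (q x) = p (l x).
  by apply: (lift_lin (h := p \o l) fi fex) => x; apply/lK; exists x.
have lex : lin_exact l gp by [].
have [j hj] : exists j : {linear K -> L}, forall x, l (j x) = i x.
  apply: (lift_lin (h := i) li lex) => x.
  by rewrite -[LHS]/(g (evid M (i x))) ei linear0.
have sej : @short_exact (Mod R) _ _ _ j q.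
  apply/Mod_exactP; split.
  - by move=> x e; apply: ii; rewrite -hj e linear0.
  - by move=> x; apply: fi; rewrite hq hj ei.
  - move=> y e; have /ie[x hx] : p (l y) = 0 by rewrite -hq e linear0.
    by exists x; apply: (inj_lin li); rewrite hj.
  - move=> z; have [x hx] := evid_surj (f z).
    have /lK[y hy] : gp x = 0 by rewrite -[LHS]/(g (p x)) hx gf.
    by exists y; apply: (inj_lin fi); rewrite hq hy.
have [b hb] := Mod_extend a sp' sej; have [c hc] := Mod_extend b sp'' sel.
by exists c => x; rewrite -hj hc hb.
Qed.

Lemma same_image_iso X A B M (f : {linear A -> M}) (g : {linear B -> M}) :
  closed_iso X -> (forall x, f x = 0 -> x = 0) -> (forall x, g x = 0 -> x = 0) ->
  (forall y, (exists x, f x = y) <-> exists x, g x = y) -> X A -> X B.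
Proof.
move=> iso fi gi im.
have lft T T' (u : {linear T -> M}) (v : {linear T' -> M}) : (forall x, u x = 0 -> x = 0) ->
    (forall y, (exists x, v x = y) -> exists x, u x = y) ->
    exists h : {linear T' -> T}, forall x, u (h x) = v x.
  move=> /[dup] ui0 /inj_lin ui vu; apply: (graph_linear (G := fun x y => u y = v x)).
  - by move=> x; apply: vu; exists x.
  - by move=> y; rewrite linear0; apply: ui0.
  - by move=> a x y x' y' e e'; rewrite !linearP e e'.
have [h hh] := lft _ _ f g fi (fun y => (im y).2).
have [h' hh'] := lft _ _ g f gi (fun y => (im y).1).
apply: (iso _ _ (h' : mor (A : Mod R) B) (h : mor (B : Mod R) A)); apply: linear_eq => x /=.
  by apply: (inj_lin gi); rewrite hh' hh.
by apply: (inj_lin fi); rewrite hh hh'.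
Qed.
End Modules.

Section Complexes.
Variable R : pzRingType.
Implicit Types A B D E M N T Q W : chain_complex R.
Implicit Types X w : obj_class (Mod R).

Definition cyc A k : lmodType R := subm (kerS (bd A k)).
Definition cyci A k : {linear cyc A k -> A k} := subi (kerS (bd A k)).

Lemma cyci0 A k x : cyci A k x = 0 -> x = 0.
Proof. by move=> e; apply: subi_inj; rewrite e linear0. Qed.
Lemma cyciP A k y : bd A k y = 0 <-> exists x, cyci A k x = y.
Proof.
by split=> [/(subi_ex (S := kerS (bd A k)))//|[x <-]]; apply: (subi_mem (S := kerS (bd A k)) x).
Qed.
Lemma bd_cyci A k x : bd A k (cyci A k x) = 0.
Proof. by apply/cyciP; exists x. Qed.

Lemma cyc_lift A k (T : lmodType R) (f : {linear T -> A k}) :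
  (forall x, bd A k (f x) = 0) ->
  exists f' : {linear T -> cyc A k}, forall x, cyci A k (f' x) = f x.
Proof. by apply: lift_lin => [x|y]; [apply: cyci0|apply: cyciP]. Qed.

Lemma cyc_map A B (f : chain_map A B) k :
  exists f' : {linear cyc A k -> cyc B k}, forall x, cyci B k (f' x) = f k (cyci A k x).
Proof.
apply: (cyc_lift (f := f k \o cyci A k)) => x /=.
by rewrite -cmap_bd bd_cyci linear0.
Qed.

Lemma acyclicP A : acyclic A <-> forall k y, bd A (k - 1) y = 0 -> exists x, bd A k x = y.
Proof.
split=> h k y; first by move/h.
by split=> [/h//|[x <-]]; apply: bd_bd.
Qed.

Lemma tildeP X A : closed_iso X -> tilde X A <-> acyclic A /\ forall k, X (cyc A k).
Proof.
move=> iso; split=> -[ac h]; split=> // k; last first.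
  exists (cyc A k), (cyci A k); split=> //; last exact: cyciP.
  by apply/Mod_monoP => x; apply: cyci0.
have [K [i [/Mod_monoP ii ei hK]]] := h k.
apply: (same_image_iso iso ii (@cyci0 A k) _ hK) => y.
by rewrite -cyciP; apply: iff_sym; apply: ei.
Qed.

Lemma cyc_ses A k : acyclic A ->
  exists p : {linear A k -> cyc A (k - 1)},
    @short_exact (Mod R) _ _ _ (cyci A k) p /\ forall x, cyci A (k - 1) (p x) = bd A k x.
Proof.
move=> /acyclicP ac; have [p hp] := cyc_lift (f := bd A k) (fun x => bd_bd x).
exists p; split=> //; apply/Mod_exactP; split.
- exact: cyci0.
- by move=> x; apply: cyci0; rewrite hp bd_cyci.
- by move=> y e; apply/cyciP; rewrite -hp e linear0.
- move=> z; have [x hx] := ac k _ (bd_cyci z).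
  by exists x; apply: (inj_lin (@cyci0 A (k - 1))); rewrite hp.
Qed.

Section ShortExact.
Variables (A B D : chain_complex R) (f : chain_map A B) (g : chain_map B D).
Hypothesis se : @short_exact (Ch R) A B D f g.

Lemma acyclic_mid : acyclic A -> acyclic D -> acyclic B.
Proof.
have [fi gf fg gs] := (Ch_exactP _ _).1 se => /acyclicP acA /acyclicP acD.
apply/acyclicP => k y dy.
have [z hz] : exists z, bd D k z = g (k - 1) y by apply: acD; rewrite -cmap_bd dy linear0.
have [x hx] := gs k z.
have [a ha] : exists a, f (k - 1) a = y - bd B k x.
  by apply: fg; rewrite linearB cmap_bd hx hz subrr.
have [a' ha'] : exists a', bd A k a' = a.
  by apply: acA; apply: fi; rewrite cmap_bd ha linearB dy bd_bd subr0.
by exists (x + f k a'); rewrite linearD -cmap_bd ha' ha subrKC.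
Qed.

Lemma acyclic_left : acyclic B -> acyclic D -> acyclic A.
Proof.
have [fi gf fg gs] := (Ch_exactP _ _).1 se => /acyclicP acB /acyclicP acD.
apply/acyclicP; apply: int_shift => k y dy.
have [x hx] : exists x, bd B (k - 1) x = f (k - 1 - 1) y.
  by apply: acB; rewrite -cmap_bd dy linear0.
have [z hz] : exists z, bd D k z = g (k - 1) x by apply: acD; rewrite -cmap_bd hx gf.
have [u hu] := gs k z.
have [a ha] : exists a, f (k - 1) a = x - bd B k u.
  by apply: fg; rewrite linearB cmap_bd hu hz subrr.
by exists a; apply: (inj_lin (fi _)); rewrite cmap_bd ha linearB bd_bd subr0.
Qed.

Lemma acyclic_right : acyclic A -> acyclic B -> acyclic D.
Proof.
have [fi gf fg gs] := (Ch_exactP _ _).1 se => /acyclicP acA /acyclicP acB.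
apply/acyclicP => k y dy; have [x hx] := gs (k - 1) y.
have [a ha] : exists a, f (k - 1 - 1) a = bd B (k - 1) x.
  by apply: fg; rewrite cmap_bd hx dy.
have [a' ha'] : exists a', bd A (k - 1) a' = a.
  by apply: acA; apply: fi; rewrite cmap_bd ha bd_bd.
have [u hu] : exists u, bd B k u = x - f (k - 1) a'.
  by apply: acB; rewrite linearB -cmap_bd ha' ha subrr.
by exists (g k u); rewrite -cmap_bd hu linearB gf subr0.
Qed.

(** Cycles are left exact. For surjectivity, the boundary of a lift of a cycle comes from a cycle of
    A, and a primitive of that corrects the lift. *)
Lemma cycles_ses k : acyclic A ->
  exists (f' : {linear cyc A k -> cyc B k}) (g' : {linear cyc B k -> cyc D k}),
    [/\ @short_exact (Mod R) _ _ _ f' g', forall x, cyci B k (f' x) = f k (cyci A k x)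
      & forall x, cyci D k (g' x) = g k (cyci B k x)].
Proof.
have [fi gf fg gs] := (Ch_exactP _ _).1 se => /acyclicP acA.
have [f' hf'] := cyc_map f k; have [g' hg'] := cyc_map g k.
exists f', g'; split=> //; apply/Mod_exactP; split.
- by move=> x e; apply: cyci0; apply: fi; rewrite -hf' e linear0.
- by move=> x; apply: cyci0; rewrite hg' hf' gf.
- move=> y e; have [x hx] : exists x, f k x = cyci B k y by apply: fg; rewrite -hg' e linear0.
  have /cyciP[x' hx'] : bd A k x = 0 by apply: fi; rewrite cmap_bd hx bd_cyci.
  by exists x'; apply: (inj_lin (@cyci0 B k)); rewrite hf' hx'.
- move=> z; have [y hy] := gs k (cyci D k z).
  have [a ha] : exists a, f (k - 1) a = bd B k y by apply: fg; rewrite cmap_bd hy bd_cyci.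
  have [a' ha'] : exists a', bd A k a' = a.
    by apply: acA; apply: fi; rewrite cmap_bd ha bd_bd.
  have /cyciP[u hu] : bd B k (y - f k a') = 0 by rewrite linearB -cmap_bd ha' ha subrr.
  exists u; apply: (inj_lin (@cyci0 D k)); rewrite hg' hu linearB gf subr0 //.
Qed.
End ShortExact.

Lemma disk_acyclic (F : int -> lmodType R) : acyclic (disk F).
Proof.
by apply/acyclicP => k [a b] /= [->]; exists (0, a).
Qed.

Lemma disk_cyc X (F : int -> lmodType R) k : closed_iso X -> X (F k) -> X (cyc (disk F) k).
Proof.
move=> iso; have [i hi] := pair_lin (idfun : {linear F k -> F k}) (\0 : {linear F k -> F (k - 1)}).
apply: (same_image_iso (f := i : {linear F k -> disk F k}) (g := cyci (disk F) k) iso).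
- by move=> x; rewrite hi => -[].
- exact: cyci0.
- move=> [a b]; rewrite -cyciP /=; split=> [[x]|[->]]; last by exists a; rewrite hi.
  by rewrite hi => -[_ <-].
Qed.

Lemma disk_tilde X (F : int -> lmodType R) : closed_iso X -> (forall k, X (F k)) -> tilde X (disk F).
Proof.
by move=> iso h; apply/(tildeP _ iso); split=> [|k]; [apply: disk_acyclic|apply: disk_cyc].
Qed.

Section Classes.
Variable X : obj_class (Mod R).
Hypothesis Xiso : closed_iso X.

Lemma dw_ext : closed_extensions X -> @closed_extensions (Ch R) (dw_tilde X).
Proof. by move=> cl A B D f g /Ch_degreewise se hA hD k; apply: cl (se k) (hA k) (hD k). Qed.

Lemma ex_ext : closed_extensions X -> @closed_extensions (Ch R) (ex_tilde X).
Proof.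
move=> cl A B D f g se [aA hA] [aD hD]; split; first exact: (acyclic_mid se).
exact: dw_ext cl _ _ _ _ _ se hA hD.
Qed.

Lemma tilde_ext : closed_extensions X -> @closed_extensions (Ch R) (tilde X).
Proof.
move=> cl A B D f g se /(tildeP _ Xiso)[aA hA] /(tildeP _ Xiso)[aD hD].
apply/(tildeP _ Xiso); split=> [|k]; first exact: (acyclic_mid se).
by have [f' [g' [se' _ _]]] := cycles_ses se k aA; apply: cl se' (hA k) (hD k).
Qed.

Lemma dw_ker : closed_kernels_epi X -> @closed_kernels_epi (Ch R) (dw_tilde X).
Proof. by move=> cl A B D f g /Ch_degreewise se hA hD k; apply: cl (se k) (hA k) (hD k). Qed.

Lemma ex_ker : closed_kernels_epi X -> @closed_kernels_epi (Ch R) (ex_tilde X).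
Proof.
move=> cl A B D f g se [aA hA] [aD hD]; split; first exact: (acyclic_left se).
exact: dw_ker cl _ _ _ _ _ se hA hD.
Qed.

Lemma tilde_ker : closed_kernels_epi X -> @closed_kernels_epi (Ch R) (tilde X).
Proof.
move=> cl A B D f g se /(tildeP _ Xiso)[aB hB] /(tildeP _ Xiso)[aD hD].
have aA := acyclic_left se aB aD.
apply/(tildeP _ Xiso); split=> // k.
by have [f' [g' [se' _ _]]] := cycles_ses se k aA; apply: cl se' (hB k) (hD k).
Qed.

Lemma dw_summand : closed_summands X -> @closed_summands (Ch R) (dw_tilde X).
Proof.
move=> cl A B [D [i1 [p1 [i2 [p2 [h1 h2 h3 h4 h5]]]]]] hA k.
apply: (cl (A k)) (hA k); exists (D k), (i1 k), (p1 k), (i2 k), (p2 k); split.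
- exact: h1.
- exact: h2.
- exact: h3.
- exact: h4.
- exact: h5.
Qed.

Lemma acyclic_summand A B : @direct_summand (Ch R) B A -> acyclic A -> acyclic B.
Proof.
move=> [D [i1 [p1 [i2 [p2 [h1 h2 h3 h4 h5]]]]]] /acyclicP aA; apply/acyclicP => k y dy.
have [x hx] : exists x, bd A k x = i1 (k - 1) y by apply: aA; rewrite -cmap_bd dy linear0.
by exists (p1 k x); rewrite -cmap_bd hx; apply: h1.
Qed.

Lemma ex_summand : closed_summands X -> @closed_summands (Ch R) (ex_tilde X).
Proof.
move=> cl A B ds [aA hA]; split; first exact: acyclic_summand ds aA.
exact: dw_summand cl _ _ ds hA.
Qed.

Lemma tilde_summand : closed_summands X -> @closed_summands (Ch R) (tilde X).
Proof.
move=> cl A B ds /(tildeP _ Xiso)[aA hA]; apply/(tildeP _ Xiso).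
split=> [|k]; first exact: acyclic_summand ds aA.
have [D [i1 [p1 [i2 [p2 [h1 h2 h3 h4 h5]]]]]] := ds.
have [i1' e1] := cyc_map i1 k; have [p1' e2] := cyc_map p1 k.
have [i2' e3] := cyc_map i2 k; have [p2' e4] := cyc_map p2 k.
have ci C := inj_lin (@cyci0 C k).
apply: (cl (cyc A k)) (hA k); exists (cyc D k), i1', p1', i2', p2'; split=> x /=; apply: ci.
- by rewrite e2 e1; apply: h1.
- by rewrite e4 e3; apply: h2.
- by rewrite e2 e3 linear0; apply: h3.
- by rewrite e4 e1 linear0; apply: h4.
- by rewrite linearD e1 e2 e3 e4; apply: h5.
Qed.

Lemma tilde_ex A : closed_extensions X -> tilde X A -> ex_tilde X A.
Proof.
move=> cl /(tildeP _ Xiso)[aA hA]; split=> // k.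
by have [p [se _]] := cyc_ses k aA; apply: cl se (hA k) (hA (k - 1)).
Qed.
End Classes.
End Complexes.

(** * Contractible complexes and Frobenius pairs *)

Section Projectives.
Variable R : pzRingType.

Lemma projective_retract (P Q : lmodType R) (s : {linear P -> Q}) (q : {linear Q -> P}) :
  (forall x, q (s x) = x) -> projective (Q : Mod R) -> projective (P : Mod R).
Proof.
move=> qs pQ A B D f g h ex gh.
have [|h' hh'] := pQ A B D f g (h \o q : {linear Q -> B}) ex.
  by apply: linear_eq => x; have := congr1 (fun u : {linear P -> D} => u (q x)) gh.
exists (h' \o s : {linear P -> A}); apply: linear_eq => x.
have := congr1 (fun u : {linear Q -> B} => u (s x)) hh'.
by rewrite /= qs.
Qed.

Lemma projective_prod (P Q : lmodType R) :
  projective (P : Mod R) -> projective (Q : Mod R) -> projective ((P * Q)%type : Mod R).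
Proof.
move=> pP pQ A B D f g h ex gh.
have [i1 hi1] := pair_lin (idfun : {linear P -> P}) (\0 : {linear P -> Q}).
have [i2 hi2] := pair_lin (\0 : {linear Q -> P}) (idfun : {linear Q -> Q}).
have gh0 z : g (h z) = 0 by have := congr1 (fun u : {linear (P * Q)%type -> D} => u z) gh.
have [|h1 hh1] := pP A B D f g (h \o i1 : {linear P -> B}) ex.
  by apply: linear_eq => x /=; apply: gh0.
have [|h2 hh2] := pQ A B D f g (h \o i2 : {linear Q -> B}) ex.
  by apply: linear_eq => x /=; apply: gh0.
have [h' hh'] := prod_lin (h1 : {linear P -> A}) (h2 : {linear Q -> A}).
exists h'; apply: linear_eq => -[x y].
have e1 := congr1 (fun u : {linear P -> B} => u x) hh1.
have e2 := congr1 (fun u : {linear Q -> B} => u y) hh2.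
rewrite /= in e1 e2; rewrite /= hh' linearD /= e1 e2 -linearD hi1 hi2; congr (h _).
by congr pair; rewrite /= ?addr0 ?add0r.
Qed.

(** P is a retract of a disk complex on free modules. Hence a projective resolution of complexes is
    one of modules in every degree. *)
Lemma Ch_projective_at (P : chain_complex R) k :
  projective (P : Ch R) -> projective (P k : Mod R).
Proof.
move=> pP; have [F [p sp]] := projective_cover_ex P.
have [s hs] := projective_lift (Ch_axioms R) (idm (P : Ch R)) pP ((Ch_epiP p).2 sp).
apply: (@projective_retract _ _ (s k) (p k)).
  by move=> x; have := congr1 (fun u : chain_map P P => u k x) hs.
by apply: projective_prod; apply: Mod_projective_free.
Qed.
End Projectives.

Section Complexes.
Variable R : pzRingType.
Implicit Types A B D E M N T Q W P : chain_complex R.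
Implicit Types X w : obj_class (Mod R).

Lemma Ch_extend M N A B (f : chain_map A B) (g : chain_map B M) (a : chain_map A N) :
  splits (M : Ch R) N -> @short_exact (Ch R) _ _ _ f g ->
  exists b : chain_map B N, forall k x, b k (f k x) = a k x.
Proof.
move=> sp se; have [b hb] := splits_extend (Ch_axioms R) (a : mor (A : Ch R) N) sp se.
by exists b => k x; have := congr1 (fun u : chain_map A N => u k x) hb.
Qed.

Lemma Ch_splits_of_extend M N A B (f : chain_map A B) (g : chain_map B M) :
  @short_exact (Ch R) _ _ _ f g -> splits (B : Ch R) N ->
  (forall a : chain_map A N, exists b : chain_map B N, forall k x, b k (f k x) = a k x) ->
  splits (M : Ch R) N.
Proof.
move=> se sp h; apply: (splits_of_extend (Ch_axioms R) se sp) => a.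
by have [b hb] := h a; exists b; apply: chain_eq.
Qed.

(** Contractibility, with conditions on the separate degrees that do not interact; the next lemma
    recovers a homotopy. *)
Definition contracting W : Prop := forall k,
  exists c : {linear W (k - 1) -> W k}, forall z, bd W (k - 1) z = 0 -> bd W k (c z) = z.

Lemma contracting_homotopy W : contracting W ->
  exists s : forall k, {linear W (k - 1) -> W k},
    forall k y, bd W k (s k y) + s (k - 1) (bd W (k - 1) y) = y.
Proof.
move=> /dchoice[c hc].
(* As y - c (d y) is always a cycle, d (s y) equals it, while s (d y) is c (d y). *)
exists (fun k => c k \o (idfun \- (c (k - 1) \o bd W (k - 1)))) => k y /=.
rewrite bd_bd linear0 subr0 hc ?subrK //.
by rewrite linearB /= hc ?subrr // bd_bd.
Qed.

(** Orthogonality of the cycles is used twice: for a section of W k -> Z_(k-1), and for extending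
    that section from Z_(k-1) to W (k - 1). *)
Lemma tilde_contracting w W : closed_iso w ->
  (forall A B : Mod R, w A -> w B -> splits A B) -> tilde w W -> contracting W.
Proof.
move=> iso sp /(tildeP _ iso)[aW hW] k.
have [p [se hp]] := cyc_ses k aW; have [p' [se' _]] := cyc_ses (k - 1) aW.
have [s hs] := Mod_lift (idfun : {linear cyc W (k - 1) -> cyc W (k - 1)})
  (sp _ _ (hW (k - 1)) (hW k)) se.
have sp' : splits (cyc W (k - 1 - 1) : Mod R) (W k).
  by apply: (splits_ext_r (Mod_axioms R) se); apply: sp.
have [c hc] := Mod_extend s sp' se'.
by exists c => _ /cyciP[z <-]; rewrite hc -hp hs.
Qed.

Lemma splits_contracting_r N W : contracting W ->
  (forall k, splits (N k : Mod R) (W k)) -> splits (N : Ch R) W.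
Proof.
move=> cW sp; have [A [P [f [g [se pP]]]]] := enough_projectives (Ch_axioms R) N.
apply: (Ch_splits_of_extend se (projective_splits (Ch_axioms R) pP)) => a.
have /dchoice[r hr] k := Mod_extend (a k) (sp k) ((Ch_degreewise f g).1 se k).
have [c hc] := dchoice cW.
have [pi hpi] : exists pi : forall k, {linear W k -> W k}, forall k y, pi k y = y - c k (bd W k y).
  by exists (fun k => idfun \- (c k \o bd W k)).
have dpi k y : bd W k (pi k y) = 0 by rewrite hpi linearB hc ?subrr ?bd_bd.
have pid k y : pi (k - 1) (bd W k y) = bd W k y by rewrite hpi bd_bd linear0 subr0.
(* W is a product of disks on its cycles, and c provides the coordinates. The degreewise extensions
   r need not form a chain map; rho is the chain map whose components in the cycles are those of
   r. *)
have [rho hrho] : exists rho : forall k, {linear P k -> W k},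
    forall k x, rho k x = pi k (r k x) + c k (pi (k - 1) (r (k - 1) (bd P k x))).
  by exists (fun k => (pi k \o r k) \+ (c k \o pi (k - 1) \o r (k - 1) \o bd P k)).
have crho k x : rho (k - 1) (bd P k x) = bd W k (rho k x).
  by rewrite !hrho linearD dpi add0r hc ?dpi // bd_bd !linear0 addr0.
by exists (ChainMap crho) => k x /=; rewrite hrho -cmap_bd !hr cmap_bd pid hpi subrK.
Qed.

Lemma splits_contracting_l V N : contracting V ->
  (forall k, splits (V k : Mod R) (N k)) -> splits (V : Ch R) N.
Proof.
move=> cV sp E f g se; have /Ch_degreewise sek := se.
have /dchoice[s hs] k := Mod_lift (idfun : {linear V k -> V k}) (sp k) (sek k).
have [c hc] := contracting_homotopy cV.
have [psi hpsi] : exists psi : forall k, {linear V (k - 1) -> E k},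
    forall k y, psi k y = s k (c k y) by exists (fun k => s k \o c k).
have [chi hchi'] := @shift_family (fun k => {linear V k -> E k}) (fun k => bd E k \o psi k).
have hchi k x : chi (k - 1) x = bd E k (psi k x) by rewrite hchi'.
have chi0 : forall k x, bd E k (chi k x) = 0.
  by apply: int_shift => k x; rewrite hchi bd_bd.
(* This is d psi + psi d, a chain map for any psi; as psi lifts the contraction c, it lifts d c + c
   d, the identity. *)
have [t ht] : exists t : forall k, {linear V k -> E k}, forall k x, t k x = chi k x + psi k (bd V k x).
  by exists (fun k => chi k \+ (psi k \o bd V k)).
have ct k x : t (k - 1) (bd V k x) = bd E k (t k x).
  by rewrite !ht bd_bd !linear0 addr0 linearD chi0 add0r hchi.
exists (ChainMap ct); apply: chain_eq; apply: int_shift => k x.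
rewrite -[LHS]/(g (k - 1) (t (k - 1) x)) ht linearD hchi cmap_bd !hpsi.
by rewrite (hs k) (hs (k - 1)) hc.
Qed.

Lemma castl_homotopy W (s : forall k, {linear W (k - 1) -> W k}) i j (e : i = j)
    (e' : i - 1 = j - 1) y :
  castl W e (s i y) = s j (castl W e' y).
Proof. by move: e'; case: j / e => e'; rewrite (eq_irrelevance e' erefl). Qed.

Lemma cast_degE A i j (e : i = j) x : @cast_deg R A i j e x = castl A e x.
Proof. by case: j / e. Qed.

Lemma contracting_Hom_acyclic A W : contracting W -> Hom_acyclic A W.
Proof.
move=> /contracting_homotopy[s hs] n f hf.
have e0 (k : int) : n - 1 + k = n + k - 1 by rewrite addrAC.
(* Here d s f = f - s d f, and the cycle condition on f cancels s d f against the other term of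
   [Hom_bd], because the signs in degrees n - 1 and n are opposite. The rest of the proof normalizes
   transports. *)
pose g k : {linear A k -> W (n + k)} := s (n + k) \o castl W (e0 k) \o f k.
exists g => k x; rewrite /Hom_bd !cast_degE /g /=.
have -> : bd W (n + k) (s (n + k) (castl W (e0 k) (f k x))) =
    castl W (e0 k) (f k x) - s (n + k - 1) (bd W (n + k - 1) (castl W (e0 k) (f k x))).
  by apply/eqP; rewrite eq_sym subr_eq (hs (n + k)).
rewrite linearB /= (castl_comp _ _ erefl) /=.
have e1 : n + k - 1 - 1 = n - 1 + k - 1 by rewrite -(e0 k).
rewrite (castl_homotopy s (deg_bd_l n k) e1) -(castl_bd (e0 k) (congr1 (fun i => i - 1) (e0 k))).
have e2 : n + (k - 1) - 1 = n - 1 + k - 1 by rewrite deg_bd_r.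
rewrite (castl_homotopy s (deg_bd_r n k) e2).
have e3 : n - 1 + k - 1 = n - 1 + k - 1 by [].
rewrite !(castl_comp _ _ e3).
have e4 : n - 1 + (k - 1) = n - 1 + k - 1 by rewrite addrA.
rewrite (castl_comp _ _ e4).
have sub2 (V : zmodType) (u y z : V) : y + z = 0 -> u - y - z = u.
  by move=> h; rewrite -addrA -opprD h subr0.
apply: sub2.
rewrite -linearZ -linearD /=.
suff -> : castl W e3 (bd W (n - 1 + k) (f k x)) +
   (-1) ^+ `|n|%N *: castl W e4 (f (k - 1) (bd A k x)) = 0 by rewrite linear0.
have := hf k x; rewrite /Hom_bd !cast_degE => /eqP; rewrite subr_eq0 => /eqP.
move/(congr1 (castl W (esym (deg_bd_l (n - 1) k)))).
rewrite linearZ /= !(castl_comp _ _ e3) (castl_comp _ _ e4) => ->.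
rewrite -scalerDl.
suff -> : (-1) ^+ `|n - 1|%N + (-1) ^+ `|n|%N = 0 :> R by rewrite scale0r.
case: n {f hf e0 g e1 e2 e3 e4} => [[|n]|n].
- by rewrite /= expr0 expr1 addNr.
- rewrite -[Posz n.+1 - 1]/(Posz n.+1 - Posz 1) subzSS subr0 /= exprS mulN1r.
  by rewrite subrr.
- have -> : Negz n - 1 = Negz n.+1 by rewrite !NegzE -opprD -[n.+2]addn1 PoszD.
  by rewrite /= [in LHS]exprS mulN1r addNr.
Qed.

(** * Frobenius pairs of complexes *)

Section Frobenius.
Variables X w : obj_class (Mod R).
Hypothesis hXw : frobenius_pair X w.

Let Xe := frob_ext hXw.
Let Xiso : closed_iso X := closed_summands_iso (Mod_axioms R) (frob_summand hXw).
Let wiso : closed_iso w := closed_summands_iso (Mod_axioms R) (frob_summand_w hXw).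

Lemma frob_splits (A B : Mod R) : X A -> w B -> splits A B.
Proof. by move=> hA hB; apply/(Ext_zero1 (Mod_axioms R)); apply: (frob_Ext hXw). Qed.

Lemma tilde_w_contracting W : tilde w W -> contracting W.
Proof.
by apply: tilde_contracting => // A B hA hB; apply: frob_splits => //; apply: (frob_sub hXw).
Qed.

Lemma dg_tildeE A : dg_tilde X w A <-> dw_tilde X A.
Proof.
split=> [[]//|hA]; split=> // W /tilde_w_contracting; exact: contracting_Hom_acyclic.
Qed.

Lemma tilde_sub W : tilde w W -> tilde X W.
Proof.
move=> /(tildeP _ wiso)[aW hW]; apply/(tildeP _ Xiso).
by split=> // k; apply: (frob_sub hXw).
Qed.

(** In degree k, a projective resolution of M resolves M k, so each syzygy of M is orthogonal to the
    terms of W degree by degree; contractibility of W makes this sufficient. *)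
Lemma dw_Ext M W : dw_tilde X M -> tilde w W -> forall i, (0 < i)%N -> @Ext_zero (Ch R) i M W.
Proof.
move=> hM hW [|n] // _; have [r [r0 pr]] := projective_resolution (Ch_axioms R) M.
move: hM; rewrite -{}r0 => hM; apply: (splits_Ext_zero (Ch_axioms R)) => //.
apply: splits_contracting_r (tilde_w_contracting hW) _ => k.
have /(tildeP _ wiso)[aW cW] := hW; have [p [se _]] := cyc_ses k aW.
pose rk := @Resolution (Mod R) (fun j => (syz r j : chain_complex R) k)
  (fun j => (rob r j : chain_complex R) k) (fun j => (syz_in r j : chain_map _ _) k)
  (fun j => (syz_out r j : chain_map _ _) k) (fun j => (Ch_degreewise _ _).1 (res_exact r j) k).
have prk j : projective (rob rk j) by apply: Ch_projective_at.
have sp l : splits (syz rk n) (cyc W l).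
  apply: (Ext_zero_splits (r := rk) (n := n) (Mod_axioms R) prk).
  exact: (frob_Ext hXw (hM k) (cW l)) (ltn0Sn n).
by apply: (splits_ext_r (Mod_axioms R) se); apply: sp.
Qed.

(* M embeds in the product of the disks on modules W_k of w containing M_k. *)
Lemma dw_cogen M : dw_tilde X M -> exists W Q (i : chain_map M W) (q : chain_map W Q),
  [/\ @short_exact (Ch R) _ _ _ i q, tilde w W, dw_tilde X Q,
      acyclic M -> acyclic Q & tilde X M -> tilde X Q].
Proof.
move=> hM; have /dchoice[F /dchoice[M' /dchoice[f /dchoice[g hfg]]]] k := frob_cogen hXw (hM k).
have se k : @short_exact (Mod R) _ _ _ (f k : {linear _ -> _}) (g k) by case: (hfg k).
have wF k : w (F k) by case: (hfg k).
have xM k : X (M' k) by case: (hfg k).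
have [i hi] := disk_to (F := F) f.
have [Q [q [sq kq]]] := coker_chain i.
have H k := (Mod_exactP (f k : {linear _ -> _}) (g k : {linear _ -> _})).1 (se k).
have fi k x : (f k : {linear _ -> _}) x = 0 -> x = 0 by have [h _ _ _] := H k; apply: h.
have ii k x : i k x = 0 -> x = 0 by rewrite hi => -[/fi].
have seq : @short_exact (Ch R) _ _ _ i q by split; [apply/Ch_monoP| |apply/Ch_epiP].
have qi k x : q k (i k x) = 0 by apply/kq; exists x.
have [fl hfl] : exists fl : forall k, {linear disk F k -> M' k},
    forall k x, fl k x = (g k : {linear _ -> _}) x.1.
  by apply: (@dchoice _ _ (fun k (fl : {linear disk F k -> M' k}) => forall x, fl x = (g k : {linear _ -> _}) x.1)) => k;
    exists (g k \o fst : {linear _ -> _}).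
have /dchoice[gq hgq] k : exists gq : {linear Q k -> M' k}, forall x, gq (q k x) = (g k : {linear _ -> _}) x.1.
  have [|gq hgq] := desc_lin (h := fl k) (kq k) (sq k).
    by move=> x; rewrite hi hfl /=; have [_ h _ _] := H k; apply: h.
  by exists gq => x; rewrite hgq hfl.
have gq_surj k z : exists a, gq k (q k (a, 0)) = z.
  by have [_ _ _ h] := H k; have [a ha] := h z; exists a; rewrite hgq.
have [j hj] : exists j : forall k, {linear F (k - 1) -> Q k}, forall k b, j k b = q k (0, b).
  apply: (@dchoice _ _ (fun k (j : {linear F (k - 1) -> Q k}) => forall b, j b = q k (0, b))) => k.
  have [u hu] := pair_lin (\0 : {linear F (k - 1) -> F k}) (idfun : {linear F (k - 1) -> F (k - 1)}).
  by exists (q k \o (u : {linear _ -> disk F k})) => b /=; rewrite hu.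
have jinj k b : j k b = 0 -> b = 0.
  by rewrite hj => /kq[x]; rewrite hi => -[/fi -> <-]; rewrite !linear0.
have qE k (a : F k) (b : F (k - 1)) x : (f k : {linear _ -> _}) x = a ->
    q k (a, b) = j k (b - (f (k - 1) : {linear _ -> _}) (bd M k x)).
  move=> e; rewrite hj; apply/eqP; rewrite -subr_eq0 -linearB; apply/eqP/kq; exists x.
  by rewrite hi e; congr pair; rewrite /= ?subr0 ?opprB ?subrKC.
have gq0 k (a : F k) b : gq k (q k (a, b)) = 0 -> exists x, (f k : {linear _ -> _}) x = a.
  by rewrite hgq; have [_ _ h _] := H k; apply: h.
have xQ k : X (Q k).
  apply: (frob_ext hXw (f := j k : mor (F (k - 1) : Mod R) (Q k)) (g := gq k : mor (Q k : Mod R) (M' k))) => //.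
    apply/Mod_exactP; split=> //.
    - exact: jinj.
    - by move=> b; rewrite hj hgq linear0.
    - move=> y; have [[a b] <-] := sq k y => /gq0[x hx].
      by rewrite (qE _ _ _ _ hx); eexists.
    - by move=> z; have [a ha] := gq_surj k z; exists (q k (a, 0)).
  exact: (frob_sub hXw).
have aQ : acyclic M -> acyclic Q by move=> aM; apply: (acyclic_right seq aM); apply: disk_acyclic.
exists (disk F), Q, i, q; split=> //; first exact: disk_tilde.
move=> /(tildeP _ Xiso)[aM cM]; apply/(tildeP _ Xiso); split=> [|k]; first exact: aQ.
have dq (a : F k) b : bd Q k (q k (a, b)) = q (k - 1) (b, 0) by rewrite -cmap_bd.
(* Q k is an extension of M' k by F (k - 1), and its cycles form an extension of M' k by Z_(k-1)(M),
   embedded through f and j. *)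
have [u hu] : exists u : {linear cyc M (k - 1) -> cyc Q k},
    forall x, cyci Q k (u x) = j k ((f (k - 1) : {linear _ -> _}) (cyci M (k - 1) x)).
  apply: (cyc_lift (f := j k \o (f (k - 1) : {linear _ -> _}) \o cyci M (k - 1))) => x /=.
  by rewrite hj dq; apply/kq; exists (cyci M (k - 1) x); rewrite hi bd_cyci linear0.
apply: (frob_ext hXw (f := u : mor (cyc M (k - 1) : Mod R) (cyc Q k))
  (g := gq k \o cyci Q k : {linear cyc Q k -> M' k})) => //.
apply/Mod_exactP; split.
- move=> x e; have : j k ((f (k - 1) : {linear _ -> _}) (cyci M (k - 1) x)) = 0 by rewrite -hu e linear0.
  by move/jinj/fi/cyci0.
- by move=> x; rewrite -[LHS]/(gq k (cyci Q k (u x))) hu hj hgq linear0.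
- move=> z; rewrite -[X in X = 0 -> _]/(gq k (cyci Q k z)).
  have [[a b] e] := sq k (cyci Q k z); rewrite -e => /gq0[x hx].
  have := bd_cyci z; rewrite -e dq => /kq[x']; rewrite hi => -[ex' dx'].
  have dx0 : bd M (k - 1) (x' - bd M k x) = 0 by rewrite linearB bd_bd subr0; apply: fi.
  have [y hy] := (cyciP _).1 dx0; exists y; apply: (inj_lin (@cyci0 R Q k)).
  by rewrite hu hy linearB ex' -(qE _ _ _ _ hx) e.
- move=> z; have [a ha] := gq_surj k z.
  have /cyciP[y hy] : bd Q k (q k (a, 0)) = 0 by rewrite dq linear0.
  by exists y; rewrite -[LHS]/(gq k (cyci Q k y)) hy.
Qed.

Lemma dw_frobenius : @frobenius_pair (Ch R) (dw_tilde X) (tilde w).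
Proof.
split.
- exact: (dw_ext (frob_ext hXw)).
- exact: (dw_ker (frob_ker hXw)).
- exact: (dw_summand (frob_summand hXw)).
- exact: (tilde_summand wiso (frob_summand_w hXw)).
- exact: dw_Ext.
- by move=> W /tilde_sub /(tilde_ex Xiso Xe)[].
- by move=> M /dw_cogen[W [Q [i [q [se hW hQ _ _]]]]]; exists W, Q, i, q.
Qed.

Lemma ex_frobenius : @frobenius_pair (Ch R) (ex_tilde X) (tilde w).
Proof.
split.
- exact: (ex_ext (frob_ext hXw)).
- exact: (ex_ker (frob_ker hXw)).
- exact: (ex_summand (frob_summand hXw)).
- exact: (tilde_summand wiso (frob_summand_w hXw)).
- by move=> M W [_ hM]; apply: dw_Ext.
- by move=> W /tilde_sub /(tilde_ex Xiso Xe).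
- move=> M [aM /dw_cogen[W [Q [i [q [se hW hQ aQ _]]]]]].
  by exists W, Q, i, q; split=> //; split=> //; apply: aQ.
Qed.

Lemma tilde_frobenius : @frobenius_pair (Ch R) (tilde X) (tilde w).
Proof.
split.
- exact: (tilde_ext Xiso (frob_ext hXw)).
- exact: (tilde_ker Xiso (frob_ker hXw)).
- exact: (tilde_summand Xiso (frob_summand hXw)).
- exact: (tilde_summand wiso (frob_summand_w hXw)).
- by move=> M W /(tilde_ex Xiso Xe)[_ hM]; apply: dw_Ext.
- exact: tilde_sub.
- move=> M hM; have [_ /dw_cogen[W [Q [i [q [se hW hQ _ tQ]]]]]] := tilde_ex Xiso Xe hM.
  by exists W, Q, i, q; split=> //; apply: tQ.
Qed.
End Frobenius.
End Complexes.

(** * Approximations of acyclic complexes *)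

Section Approximation.
Variable R : pzRingType.
Implicit Types X w : obj_class (Mod R).

(* Z - E - Z' is covered by an extension of L' by L; since the projection
   L -> Z and the map L' -> Z' are given in advance, what is required is that a
   class in Ext^1(L', Z) lifts to Ext^1(L', L). *)
Lemma horseshoe (Z E Z' K L L' : lmodType R) (z : {linear Z -> E}) (e : {linear E -> Z'})
    (kl : {linear K -> L}) (l : {linear L -> Z}) (l' : {linear L' -> Z'}) :
  @short_exact (Mod R) _ _ _ z e -> @short_exact (Mod R) _ _ _ kl l ->
  splits (subm (kerS (evid L')) : Mod R) K ->
  exists (Q : lmodType R) (i : {linear L -> Q}) (p : {linear Q -> L'}) (t : {linear Q -> E}),
    [/\ @short_exact (Mod R) _ _ _ i p, forall x, t (i x) = z (l x) & forall x, e (t x) = l' (p x)].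
Proof.
move=> se1 se2 sp; have [zi ez ze es] := (Mod_exactP _ _).1 se1.
have seF := ker_ses (@evid_surj R L').
set Om := subm _ in sp seF; set j : {linear Om -> freem L'} := subi _ in seF.
set ev := evid L' in seF; have [ji ej je evs] := (Mod_exactP _ _).1 seF.
have [u0 hu0] := projective_lift (Mod_axioms R) (l' \o ev : {linear freem L' -> Z'})
  (@Mod_projective_free R L') ((Mod_epiP e).2 es).
pose u : {linear freem L' -> E} := u0.
have hu x : e (u x) = l' (ev x).
  by have := congr1 (fun v : {linear freem L' -> Z'} => v x) hu0.
have [v0 hv0] : exists v0 : {linear Om -> Z}, forall x, z (v0 x) = u (j x).
  apply: (lift_lin (g := e) (h := u \o j) zi).
    by move=> y; split=> [/ze//|[x <-]].
  by move=> x; rewrite -[LHS]/(e (u (j x))) hu ej linear0.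
have [v hv] := Mod_lift v0 sp se2.
(* On the free presentation of L', the map v0 is the class of the pullback of E along l', and v
   lifts it to L. Pushing out along v realizes the lifted class; t is then z l on L and u on the
   free module. *)
have [Q [i [p [b [seQ bj pb]]]]] := Mod_pushouts v seF.
have [ii pi ip ps] := (Mod_exactP _ _).1 seQ.
have fun0 x a : i x + b a = 0 -> z (l x) + u a = 0.
  move=> h; have [om hom] : exists om, j om = a.
    by apply: je; rewrite -pb -[RHS](linear0 p) -h linearD pi add0r.
  have e0 : x + v om = 0 by apply: ii; rewrite linearD -bj hom.
  by rewrite -hom -hv0 -hv -!linearD e0 !linear0.
have [|||t ht] := @graph_linear R Q E (fun q y => exists x a, q = i x + b a /\ y = z (l x) + u a).
- move=> q; have [a ha] := evs (p q).
  have [x hx] : exists x, i x = q - b a by apply: ip; rewrite linearB pb ha subrr.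
  by exists (z (l x) + u a), x, a; rewrite hx subrK.
- by move=> y [x [a [h ->]]]; apply: fun0.
- move=> c _ _ _ _ [x [a [-> ->]]] [x' [a' [-> ->]]]; exists (c *: x + x'), (c *: a + a').
  by rewrite !linearP !scalerDr; split; apply: addrACA.
have tE x a : t (i x + b a) = z (l x) + u a.
  have [x' [a' [h ->]]] := ht (i x + b a); apply/eqP.
  rewrite -subr_eq0 opprD addrACA -!linearB; apply/eqP/fun0.
  by rewrite !linearB addrACA -opprD -h subrr.
exists Q, i, p, t; split=> //.
- by move=> x; rewrite -[i x]addr0 -[X in _ + X](linear0 b) tE linear0 addr0.
- move=> q; have [x [a [h ->]]] := ht q.
  by rewrite linearD ez add0r hu -pb h linearD pi add0r.
Qed.

Section Splice.
Variables (Z P : int -> lmodType R) (i : forall k, {linear Z k -> P k}).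
Variable p : forall k, {linear P k -> Z (k - 1)}.
Hypothesis se : forall k, @short_exact (Mod R) _ _ _ (i k) (p k).

Lemma splice_bd_bd k x : (i (k - 1 - 1) \o p (k - 1)) ((i (k - 1) \o p k) x) = 0.
Proof. by have [_ h _ _] := (Mod_exactP _ _).1 (se (k - 1)); rewrite /= h linear0. Qed.

Definition splice_cx : chain_complex R :=
  @Complex R P (fun k => (i (k - 1) \o p k : {linear _ -> _})) splice_bd_bd.

Lemma splice_cx_ker k y : bd splice_cx k y = 0 <-> exists x, i k x = y.
Proof.
have [_ pi ip _] := (Mod_exactP _ _).1 (se k).
have [ii _ _ _] := (Mod_exactP _ _).1 (se (k - 1)).
by split=> [/= /ii/ip//|[x <-]]; rewrite /= pi linear0.
Qed.

Lemma splice_cx_acyclic : acyclic splice_cx.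
Proof.
apply/acyclicP => k y /splice_cx_ker[x <-].
by have [_ _ _ ps] := (Mod_exactP _ _).1 (se k); have [u <-] := ps x; exists u.
Qed.

Lemma splice_cx_cyc X k : closed_iso X -> X (Z k) -> X (cyc splice_cx k).
Proof.
move=> iso; apply: (same_image_iso (f := i k : {linear _ -> splice_cx k}) (g := cyci splice_cx k) iso).
- by have [h _ _ _] := (Mod_exactP _ _).1 (se k).
- exact: cyci0.
- by move=> y; rewrite -cyciP; apply: iff_sym; apply: splice_cx_ker.
Qed.
End Splice.

(** The horseshoe extensions of L (k - 1) by L k splice to LL, and the cycles of the kernel KK are
    the K k. The classes are quantified inside the conclusion because KK and LL are placed in
    different ones, among them orthogonal classes. *)
Lemma approximation (E : chain_complex R) (K L : int -> lmodType R)
    (kl : forall k, {linear K k -> L k}) (l : forall k, {linear L k -> cyc E k}) :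
  acyclic E -> (forall k, @short_exact (Mod R) _ _ _ (kl k) (l k)) ->
  (forall k, splits (subm (kerS (evid (L (k - 1)))) : Mod R) (K k)) ->
  exists (KK LL : chain_complex R) (f : chain_map KK LL) (g : chain_map LL E),
    [/\ @short_exact (Ch R) _ _ _ f g,
      forall X, closed_iso X -> (forall k, X (L k)) -> tilde X LL
    & forall X, closed_iso X -> (forall k, X (K k)) -> tilde X KK].
Proof.
move=> aE se sp.
have /dchoice[e he] k := cyc_ses k aE.
have /dchoice[P /dchoice[i /dchoice[p /dchoice[t ht]]]] k :=
  horseshoe (l (k - 1)) (he k).1 (se k) (sp k).
have sei k : @short_exact (Mod R) _ _ _ (i k) (p k) by case: (ht k).
pose LL := splice_cx sei.
have ct k x : t (k - 1) (bd LL k x) = bd E k (t k x).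
  have [_ h1 _] := ht (k - 1); have [_ _ h2] := ht k.
  by rewrite -(he k).2 h2 -h1.
pose g := @ChainMap R LL E t ct.
have tE k y : bd LL k y = 0 -> exists2 x, i k x = y & t k y = cyci E k (l k x).
  by move=> /splice_cx_ker[x <-]; exists x => //; have [_ h1 _] := ht k; apply: h1.
have gs k y : exists x, g k x = y.
  have [_ _ ps ls'] := (Mod_exactP _ _).1 (se (k - 1)).
  have [_ _ _ qs] := (Mod_exactP _ _).1 (sei k).
  have [_ _ _ ls] := (Mod_exactP _ _).1 (se k).
  have [_ h1 h2] := ht k.
  have [x' hx'] := ls' (e k y); have [q hq] := qs x'.
  have /cyciP[c hc] : bd E k (y - t k q) = 0.
    by rewrite linearB -!(he k).2 h2 hq hx' subrr.
  have [x hx] := ls c.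
  by exists (q + i k x); rewrite linearD /= h1 hx hc subrKC.
have [KK [f [fi fex]]] := ker_chain g.
have seg : @short_exact (Ch R) _ _ _ f g by split; [apply/Ch_monoP| |apply/Ch_epiP].
have aLL : acyclic LL by apply: splice_cx_acyclic.
exists KK, LL, f, g; split=> // X iso h; apply/(tildeP _ iso); split=> //.
- by move=> k; apply: splice_cx_cyc.
- exact: acyclic_left seg aLL aE.
move=> k.
apply: (same_image_iso (f := i k \o kl k : {linear _ -> LL k}) (g := f k \o cyci KK k) iso) (h k).
- move=> x /=; have [ii _ _ _] := (Mod_exactP _ _).1 (sei k); move/ii.
  by have [ki _ _ _] := (Mod_exactP _ _).1 (se k); apply: ki.
- by move=> x /fi/cyci0.
have [_ lk kle _] := (Mod_exactP _ _).1 (se k); have [_ h1 _] := ht k.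
move=> y; split=> [[x <-]|[x <-]].
  have [x' hx'] : exists x', f k x' = i k (kl k x).
    by apply/fex; rewrite /= h1 lk linear0.
  have /cyciP[c hc] : bd KK k x' = 0.
    by apply: fi; rewrite cmap_bd hx'; apply/splice_cx_ker; exists (kl k x).
  by exists c; rewrite -[LHS]/(f k (cyci KK k c)) hc hx'.
have [|c hc] := tE k (f k (cyci KK k x)); first by rewrite -cmap_bd bd_cyci linear0.
have /fex -> : exists y, f k y = f k (cyci KK k x) by exists (cyci KK k x).
by move=> /esym/cyci0/kle[x' hx']; exists x'; rewrite /= hx'.
Qed.

(* The standard argument that maps between exact complexes with orthogonal
   cycles are null-homotopic, phrased for an extension of T by K. *)
Lemma splits_acyclic (T K : chain_complex R) : acyclic T -> acyclic K ->
  (forall i j, splits (cyc T i : Mod R) (cyc K j)) -> splits (T : Ch R) K.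
Proof.
move=> aT aK sp E f g se; have [fi gf fg gs] := (Ch_exactP _ _).1 se.
have fex k : lin_exact (f k) (g k) by case: se => _ h _; apply: h.
have /dchoice[p hp] k := cyc_ses k aT.
have /dchoice[f' /dchoice[g' hg']] k := cycles_ses se k aK.
have /dchoice[sg hsg] k : exists sg : {linear cyc T k -> cyc E k}, forall x, g' k (sg x) = x.
  by have [h _ _] := hg' k; apply: (Mod_lift idfun _ h).
have gsg k x : g k (cyci E k (sg k x)) = cyci T k x.
  by have [_ _ h] := hg' k; rewrite -h hsg.
have /dchoice[s1 hs1] k : exists s1 : {linear T k -> E k}, forall x,
    g k (s1 x) = x /\ bd E k (s1 x) = cyci E (k - 1) (sg (k - 1) (p k x)).
  (* The kernel Y of r consists of the elements whose boundary is the one that the sections sg on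
     cycles prescribe. It is an extension of T k by the cycles of K, so it splits. *)
  pose r : {linear E k -> E (k - 1)} := bd E k \- (cyci E (k - 1) \o sg (k - 1) \o p k \o g k).
  have hr x : r x = bd E k x - cyci E (k - 1) (sg (k - 1) (p k (g k x))) by [].
  move: r hr => r hr.
  pose Y := subm (kerS r); pose y : {linear Y -> E k} := subi (kerS r).
  have yP x : r x = 0 <-> exists u, y u = x.
    by split=> [/(subi_ex (S := kerS r))//|[u <-]]; apply: (subi_mem (S := kerS r) u).
  have yi u : y u = 0 -> u = 0 by move=> e; apply: subi_inj; rewrite e linear0.
  have [j hj] : exists j : {linear cyc K k -> Y}, forall x, y (j x) = f k (cyci K k x).
    apply: (lift_lin (g := r) (h := f k \o cyci K k) yi) => // x.
    change (r (f k (cyci K k x)) = 0).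
    by rewrite hr gf !linear0 addr0 -cmap_bd bd_cyci linear0.
  have seY : @short_exact (Mod R) _ _ _ j (g k \o y : {linear Y -> T k}).
    apply/Mod_exactP; split.
    - by move=> x e; apply: cyci0; apply: fi; rewrite -hj e linear0.
    - by move=> x; rewrite -[LHS]/(g k (y (j x))) hj gf.
    - move=> u; rewrite -[X in X = 0 -> _]/(g k (y u)) => e.
      have [x hx] := fg _ _ e.
      have : r (y u) = 0 by apply/yP; exists u.
      rewrite hr e !linear0 addr0 -hx -cmap_bd => /fi/cyciP[c hc].
      by exists c; apply: (inj_lin yi); rewrite hj hc hx.
    - move=> t; have [e he] := gs k t.
      have [x hx] : exists x, f (k - 1) x = bd E k e - cyci E (k - 1) (sg (k - 1) (p k t)).
        by apply: fg; rewrite linearB cmap_bd he gsg (hp k).2 subrr.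
      have [x' hx'] : exists x', bd K k x' = x.
        apply/(acyclicP K).1 => //; apply: fi.
        by rewrite cmap_bd hx linearB bd_bd bd_cyci subr0.
      have /yP[u hu] : r (e - f k x') = 0.
        have ge : g k (e - f k x') = t by rewrite linearB gf subr0.
        by rewrite hr ge linearB -cmap_bd hx' hx subKr subrr.
      by exists u; rewrite -[LHS]/(g k (y u)) hu linearB gf subr0 he.
  have spT : splits (T k : Mod R) (cyc K k) by apply: (Mod_splits_ext_l (hp k).1).
  have [s hs] := Mod_lift (idfun : {linear T k -> T k}) spT seY.
  exists (y \o s) => x; have e : g k (y (s x)) = x := hs x.
  split=> //; have : r (y (s x)) = 0 by apply/yP; exists (s x).
  by rewrite hr e => /eqP; rewrite subr_eq0 => /eqP.
(* On cycles, s1 may differ from sg, by a map into the cycles of K. Extending the difference to T k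
   and subtracting it leaves the boundaries unchanged. *)
have /dchoice[de hde] k : exists de : {linear T k -> cyc K k}, forall x,
    f k (cyci K k (de (cyci T k x))) = s1 k (cyci T k x) - cyci E k (sg k x).
  have [q hq] : exists q : {linear cyc T k -> E k}, forall x, q x = s1 k (cyci T k x) - cyci E k (sg k x).
    by exists ((s1 k \o cyci T k) \- (cyci E k \o sg k)).
  have [ka hka] : exists ka : {linear cyc T k -> K k}, forall x, f k (ka x) = q x.
    apply: (lift_lin (fi k) (fex k)) => x.
    by rewrite hq linearB (hs1 k _).1 gsg subrr.
  have [d0 hd0] : exists d0 : {linear cyc T k -> cyc K k}, forall x, cyci K k (d0 x) = ka x.
    apply: cyc_lift => x; apply: fi; rewrite cmap_bd hka hq linearB (hs1 k _).2 bd_cyci.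
    have [_ h _ _] := (Mod_exactP _ _).1 (hp k).1.
    by rewrite h !linear0 addr0.
  have [d hd] := Mod_extend d0 (sp (k - 1) k) (hp k).1.
  by exists d => x; rewrite hd hd0 hka hq.
have [s hs] : exists s : forall k, {linear T k -> E k}, forall k x, s k x = s1 k x - f k (cyci K k (de k x)).
  by exists (fun k => s1 k \- (f k \o cyci K k \o de k)).
have sc k x : s k (cyci T k x) = cyci E k (sg k x).
  by rewrite hs hde opprB subrKC.
have cs k x : s (k - 1) (bd T k x) = bd E k (s k x).
  by rewrite -(hp k).2 sc hs linearB -cmap_bd bd_cyci linear0 subr0 (hs1 k x).2.
by exists (ChainMap cs); apply: chain_eq => k x /=; rewrite hs linearB gf subr0 (hs1 k x).1.
Qed.
End Approximation.

(** * Completeness *)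

Section Shifts.
Variable R : pzRingType.
Implicit Types A B D E M N T Q W P : chain_complex R.
Implicit Types X w : obj_class (Mod R).

Lemma up_acyclic T : acyclic T -> acyclic (up T).
Proof.
move=> /acyclicP aT; apply/acyclicP => k y /= /eqP; rewrite oppr_eq0 => /eqP /aT[x hx].
by exists (- x); rewrite linearN opprK.
Qed.

Lemma up_tilde X T : closed_iso X -> tilde X T -> tilde X (up T).
Proof.
move=> iso /(tildeP _ iso)[aT cT]; apply/(tildeP _ iso); split=> [|k]; first exact: up_acyclic.
apply: (same_image_iso (f := cyci T (k - 1)) (g := cyci (up T) k : {linear _ -> T (k - 1)}) iso) (cT (k - 1)).
- exact: cyci0.
- exact: (@cyci0 R (up T) k).
- move=> y; rewrite -cyciP -(cyciP (A := up T)) /=.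
  by split=> [->|/eqP]; [rewrite oppr0|rewrite oppr_eq0 => /eqP].
Qed.

Lemma splits_up T N : splits (up T : Ch R) (up N) -> splits (T : Ch R) N.
Proof.
move=> sp E f g se; have /Ch_degreewise sek := se.
have up_map A B (h : chain_map A B) : exists h' : chain_map (up A) (up B), forall k x, h' k x = h (k - 1) x.
  have c k (x : up A k) : h (k - 1 - 1) (bd (up A) k x) = bd (up B) k (h (k - 1) x).
    by rewrite /= linearN cmap_bd.
  by exists (@ChainMap R (up A) (up B) (fun k => h (k - 1)) c).
have [f' hf'] := up_map _ _ f; have [g' hg'] := up_map _ _ g.
have se' : @short_exact (Ch R) _ _ _ f' g'.
  have [h1 h2 h3 h4] := (Ch_exactP _ _).1 se.
  apply/Ch_exactP; split=> k.
  - by move=> x; rewrite hf' => /h1.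
  - by move=> x; rewrite hf' hg' h2.
  - by move=> y; rewrite hg' => /h3[x hx]; exists x; rewrite hf'.
  - by move=> z; have [y hy] := h4 (k - 1) z; exists y; rewrite hg'.
have [t ht] := sp _ _ _ se'.
have {}ht k (x : T (k - 1)) : g (k - 1) ((t : chain_map (up T) (up E)) k x) = x.
  by rewrite -hg'; have := congr1 (fun u : chain_map (up T) (up T) => u k x) ht.
have [s hs] := @shift_family (fun k => {linear T k -> E k}) (fun k => (t : chain_map (up T) (up E)) k).
have cs : forall k x, s (k - 1) (bd T k x) = bd E k (s k x).
  apply: int_shift => k x; rewrite !hs.
  have := cmap_bd (t : chain_map (up T) (up E)) (x : up T k).
  by rewrite /= linearN => /oppr_inj.
exists (ChainMap cs); apply: chain_eq; apply: int_shift => k x /=.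
by rewrite hs ht.
Qed.

(* f extends to the contractible complex disk T, where (0, x) is a primitive of
   (x, d x). *)
Lemma null_on_cycles T M (f : chain_map T M) : splits (up T : Ch R) M ->
  forall k, exists al : {linear T (k - 1) -> M k}, forall x, bd T (k - 1) x = 0 ->
    bd M k (al x) = f (k - 1) x.
Proof.
move=> sp k; have [i [p [se hi hp]]] := disk_embed T.
have [F hF] := Ch_extend f sp se.
have [j hj] := pair_lin (\0 : {linear T (k - 1) -> T k}) (idfun : {linear T (k - 1) -> T (k - 1)}).
exists (F k \o (j : {linear _ -> disk T k})) => x dx.
by rewrite -[LHS]/(bd M k (F k (j x))) -cmap_bd hj -hF hi dx.
Qed.

Lemma disk_map (F G : int -> lmodType R) (phi : forall k, {linear F k -> G k}) :
  exists h : chain_map (disk F) (disk G), forall k x, h k x = (phi k x.1, phi (k - 1) x.2).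
Proof.
have /dchoice[h hh] k : exists h : {linear disk F k -> disk G k},
    forall x, h x = (phi k x.1, phi (k - 1) x.2).
  have l : linear (fun x : disk F k => (phi k x.1, phi (k - 1) x.2) : disk G k).
    by move=> a x y; rewrite !linearP.
  by exists (mklin l).
have c k x : h (k - 1) (bd (disk F) k x) = bd (disk G) k (h k x).
  by rewrite !hh; congr pair; apply: linear0.
by exists (ChainMap c).
Qed.

(** Since maps from disks are arbitrary families, a map on the syzygy of A into M n, put in one
    degree and completed by zero, becomes a chain map, and its extension is read off in that
    degree. *)
Lemma splits_of_disk (A : lmodType R) M : splits (disk (fun _ => A) : Ch R) M ->
  forall n, splits (A : Mod R) (M n).
Proof.
move=> sp n; have se := ker_ses (@evid_surj R A).
set Om := subm _ in se; set j : {linear Om -> freem A} := subi _ in se.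
have [ji ej je es] := (Mod_exactP _ _).1 se.
apply: (Mod_splits_of_extend se).
  by apply: Mod_projective_splits; apply: Mod_projective_free.
have [J hJ] := disk_map (F := fun _ => Om) (G := fun _ => freem A) (fun k => j).
have [V hV] := disk_map (F := fun _ => freem A) (G := fun _ => A) (fun k => evid A).
have seJ : @short_exact (Ch R) _ _ _ J V.
  apply/Ch_exactP; split=> k.
  - by move=> [x y]; rewrite hJ => -[/ji -> /ji ->].
  - by move=> [x y]; rewrite hV hJ; congr pair; apply: ej.
  - move=> [x y]; rewrite hV => -[/je[x' hx'] /je[y' hy']].
    by exists (x', y'); rewrite hJ; congr pair.
  - move=> [x y]; have [x' hx'] := es x; have [y' hy'] := es y.
    by exists (x', y'); rewrite hV; congr pair.
move=> a.
have [psi hpsi] := @point_family (fun k => {linear Om -> M k}) (fun k => \0 : {linear _ -> _}) n a.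
have [h [hh _]] := disk_from (F := fun _ => Om) psi.
have [b hb] := Ch_extend h sp seJ.
have [q hq] := pair_lin (\0 : {linear freem A -> freem A}) (idfun : {linear freem A -> freem A}).
exists (b n \o (q : {linear _ -> disk (fun _ => freem A) n})) => x.
rewrite -[LHS]/(b n (q (j x))) hq -hpsi -hh -hb hJ; congr (b n _).
by congr pair; rewrite linear0.
Qed.

(** Once Ext^1(A, M k) = 0, the group Ext^1(A, Z_k) is the cokernel of Hom(A, M k) -> Hom(A,
    Z_(k-1)). *)
Lemma splits_cycles (A : lmodType R) M : acyclic M -> (forall k, splits (A : Mod R) (M k)) ->
  (forall k (h : {linear A -> cyc M (k - 1)}), exists h' : {linear A -> M k},
     forall x, bd M k (h' x) = cyci M (k - 1) (h x)) ->
  forall k, splits (A : Mod R) (cyc M k).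
Proof.
move=> aM sp lif k; have [p [se hp]] := cyc_ses k aM.
apply: (splits_of_lift (Mod_axioms R) se (sp k)) => h.
have [h' hh'] := lif k h; exists h'; apply: linear_eq => x.
by apply: (inj_lin (@cyci0 R M (k - 1))); rewrite -hh' -hp.
Qed.

Definition zero_complex_of (A : lmodType R) : chain_complex R :=
  @Complex R (fun _ => A) (fun k => (\0 : {linear A -> A})) (fun k x => erefl).

(** With zero differential, any family of maps from A to the cycles of M is a chain map, and all of
    A consists of cycles, so [null_on_cycles] applies to h placed in degree k - 1. *)
Lemma boundaries_of_dw (A : lmodType R) M : splits (up (zero_complex_of A) : Ch R) M ->
  forall k (h : {linear A -> cyc M (k - 1)}), exists h' : {linear A -> M k},
    forall x, bd M k (h' x) = cyci M (k - 1) (h x).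
Proof.
move=> sp k h.
have [f hf] := @point_family (fun k => {linear A -> cyc M k}) (fun k => \0 : {linear _ -> _}) (k - 1) h.
have c j (x : A) : (cyci M (j - 1) \o f (j - 1)) ((\0 : {linear A -> A}) x) = bd M j ((cyci M j \o f j) x).
  by rewrite [LHS]linear0 -[RHS]/(bd M j (cyci M j (f j x))) bd_cyci.
pose F := @ChainMap R (zero_complex_of A) M (fun j => cyci M j \o f j : {linear _ -> _}) c.
have [al hal] := null_on_cycles F sp k.
by exists al => x; rewrite hal // -[LHS]/(cyci M (k - 1) (f (k - 1) x)) hf.
Qed.
Lemma graph_chain A B (G : forall k, A k -> B k -> Prop) :
  (forall k x, exists y, G k x y) -> (forall k y, G k 0 y -> y = 0) ->
  (forall k a x y x' y', G k x y -> G k x' y' -> G k (a *: x + x') (a *: y + y')) ->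
  (forall k x y, G k x y -> G (k - 1) (bd A k x) (bd B k y)) ->
  exists f : chain_map A B, forall k x, G k x (f k x).
Proof.
move=> tot fun0 clos comp; have /dchoice[f hf] k := graph_linear (tot k) (fun0 k) (clos k).
have c k x : f (k - 1) (bd A k x) = bd B k (f k x).
  have := clos _ (-1) _ _ _ _ (hf (k - 1) (bd A k x)) (comp _ _ _ (hf k x)).
  by rewrite !scaleN1r addNr => /fun0 /eqP; rewrite addr_eq0 eqr_opp => /eqP.
by exists (ChainMap c).
Qed.
End Shifts.

(** * Approximations in [Ch R], and acyclic precovers *)

Section Completeness.
Variables (R : pzRingType) (m : nat) (X w : obj_class (Mod R)).
Hypothesis hXw : frobenius_pair X w.
Implicit Types M E T K : chain_complex R.

Let Xe := frob_ext hXw.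
Let Xiso : closed_iso X := closed_summands_iso (Mod_axioms R) (frob_summand hXw).
Let wiso : closed_iso w := closed_summands_iso (Mod_axioms R) (frob_summand_w hXw).

Lemma resdim_iso n : closed_iso (resdim w n).
Proof.
case: n => [|n] //= A B f g fg gf [T [W [i [p [se hW hT]]]]].
have [h1 h2 h3 h4] := (Mod_exactP _ _).1 se.
have fgx x : (f : {linear _ -> _}) ((g : {linear _ -> _}) x) = x.
  by have := congr1 (fun u : {linear B -> B} => u x) fg.
have gfx x : (g : {linear _ -> _}) ((f : {linear _ -> _}) x) = x.
  by have := congr1 (fun u : {linear A -> A} => u x) gf.
exists T, W, i, ((f : {linear _ -> _}) \o (p : {linear _ -> _}) : {linear _ -> _}).
split=> //; apply/Mod_exactP; split=> //.
- by move=> x /=; rewrite h2 linear0.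
- by move=> y /= e; apply: h3; rewrite -[LHS]gfx e linear0.
- by move=> z; have [y hy] := h4 ((g : {linear _ -> _}) z); exists y; rewrite /= hy fgx.
Qed.

Lemma splits_all_resdim n (A L : Mod R) : X A -> resdim w n L -> splits_all A L.
Proof.
move=> hA; elim: n L => [|n IH] L /=.
  by move=> hL; apply: (splits_all_Ext (Mod_axioms R)); apply: (frob_Ext hXw).
move=> [T [W [i [p [se hW hT]]]]]; apply: (splits_all_shift (Mod_axioms R) se); first exact: IH.
by apply: (splits_all_Ext (Mod_axioms R)); apply: (frob_Ext hXw).
Qed.

Lemma resdim_tilde n T : @resdim (Ch R) (tilde w) n T -> tilde (resdim w n) T.
Proof.
elim: n T => [|n IH] T //= [T' [W [i [p [se /(tildeP _ wiso)[aW cW] /IH]]]]].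
move=> /(tildeP _ (@resdim_iso n))[aT' cT'].
apply/(tildeP _ (@resdim_iso n.+1)); split=> [|k]; first exact: acyclic_right se aT' aW.
have [f' [g' [se' _ _]]] := cycles_ses se k aT'.
by exists (cyc T' k), (cyc W k), f', g'.
Qed.

(** The obstruction to gluing resolutions of the cycles lies in Ext^2(L, K) with L in w, hence in X,
    and K of w-dimension at most n; it vanishes by dimension shifting. *)
Lemma tilde_step n T : tilde (resdim w n.+1) T -> exists T' W (f : chain_map T' W) (g : chain_map W T),
  [/\ @short_exact (Ch R) _ _ _ f g, tilde w W & tilde (resdim w n) T'].
Proof.
move=> /(tildeP _ (@resdim_iso n.+1))[aT cT].
have /dchoice[K /dchoice[L /dchoice[i /dchoice[p h]]]] k : exists (K L : Mod R)
    (f : mor K L) (g : mor L (cyc T k)), [/\ short_exact f g, w L & resdim w n K] := cT k.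
have [|T' [W [f [g [se hW hT']]]]] :=
  @approximation R T K L i p aT (fun k => (let: And3 h _ _ := h k in h)).
  move=> k; have [_ hL _] := h (k - 1); have [_ _ hK] := h k.
  apply: (splits_all_splits (Mod_axioms R)).
  apply: (splits_all_syz (ker_ses (@evid_surj R (L (k - 1))))).
    exact: Mod_projective_free.
  exact: splits_all_resdim (frob_sub hXw hL) hK.
exists T', W, f, g; split=> //.
  by apply: hW => // k; case: (h k).
by apply: hT' => [|k]; [apply: resdim_iso|case: (h k)].
Qed.

Lemma tilde_resdim n T : tilde (resdim w n) T -> @resdim (Ch R) (tilde w) n T.
Proof.
elim: n T => [|n IH] T // /tilde_step[T' [W [f [g [se hW /IH hT']]]]].
by exists T', W, f, g.
Qed.

Hypothesis hcomplete : totally_left_complete m X w.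
Hypothesis hR : X (R^o : lmodType R).

Lemma acyclic_approximation E : acyclic E ->
  (forall A : Mod R, X A -> forall k, splits A (cyc E k)) ->
  exists K L (f : chain_map K L) (g : chain_map L E),
    [/\ @short_exact (Ch R) _ _ _ f g, @resdim (Ch R) (tilde w) m L
      & forall T, tilde (resdim w m) T -> splits (T : Ch R) K].
Proof.
move=> aE sp; have [_ cpl] := hcomplete.
have /dchoice[K /dchoice[L /dchoice[i /dchoice[p h]]]] k : exists (K L : Mod R)
    (f : mor K L) (g : mor L (cyc E k)),
    [/\ short_exact f g, wedge w m L & perp (wedge w m) K].
  by apply: cpl => A hA; apply/(Ext_zero1 (Mod_axioms R)); apply: sp.
have sall (A : Mod R) k : resdim w m A -> splits_all A (K k).
  move=> /(wedge_resdim (Mod_axioms R) _ _ wiso) hA; apply: (splits_all_Ext (Mod_axioms R)) => n hn.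
  by have [_ _ hK] := h k; apply: hK.
have hL k : resdim w m (L k).
  by have [_ hL _] := h k; apply/(wedge_resdim (Mod_axioms R) _ _ wiso).
have [|KK [LL [f [g [se tL tK]]]]] :=
  @approximation R E K L i p aE (fun k => (let: And3 h _ _ := h k in h)).
  move=> k; apply: (splits_all_splits (Mod_axioms R)).
  apply: (splits_all_syz (ker_ses (@evid_surj R (L (k - 1))))); first exact: Mod_projective_free.
  exact: sall.
exists KK, LL, f, g; split=> //.
  by apply: tilde_resdim; apply: tL => //; apply: resdim_iso.
move=> T /(tildeP _ (@resdim_iso m))[aT cT].
(* The cycles of KK lie in every class, closed under isomorphism, that contains all K k; this one
   makes [splits_acyclic] applicable. *)
pose B (N : Mod R) := forall A : Mod R, resdim w m A -> splits A N.
have Biso : closed_iso B.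
  by move=> N N' u v uv vu hN A hA; apply: (splits_retract (Mod_axioms R) uv); apply: hN.
have [|aK cK] := (tildeP KK Biso).1 (tK B Biso _).
  by move=> k A hA; apply: (splits_all_splits (Mod_axioms R)); apply: sall.
by apply: splits_acyclic => // a b; apply: cK.
Qed.

Lemma left_complete_of (Y : obj_class (Ch R)) : @frobenius_pair (Ch R) Y (tilde w) ->
  (forall M, (forall T, Y T -> splits (T : Ch R) M) ->
    exists K L (f : chain_map K L) (g : chain_map L M),
    [/\ @short_exact (Ch R) _ _ _ f g, @resdim (Ch R) (tilde w) m L
      & forall T, tilde (resdim w m) T -> splits (T : Ch R) K]) ->
  @left_complete (Ch R) m Y (tilde w).
Proof.
move=> fp h; split=> // M hM.
have tiso : @closed_iso (Ch R) (tilde w) :=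
  closed_summands_iso (Ch_axioms R) (frob_summand_w fp).
have [|K [L [f [g [se hL hK]]]]] := h M.
  by move=> T hT; apply/(Ext_zero1 (Ch_axioms R)); apply: hM.
exists K, L, f, g; split=> //; first exact/(wedge_resdim (Ch_axioms R) _ _ tiso).
move=> T /(wedge_resdim (Ch_axioms R) _ _ tiso) hT.
by apply/(Ext_zero1 (Ch_axioms R))/hK/resdim_tilde.
Qed.

Lemma dw_left_complete : @left_complete (Ch R) m (dw_tilde X) (tilde w).
Proof.
apply: left_complete_of; first exact: dw_frobenius.
move=> M hM; have aM : acyclic M.
  apply/acyclicP => k y /cyciP[z hz].
  have lz : linear (fun r : R^o => (r : R) *: z).
    by move=> a r s; rewrite scalerDl scalerA.
  (* A cycle is a map from R, so R in X yields acyclicity. *)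
  have [|h' hh'] := boundaries_of_dw (A := R^o) (M := M) _ (mklin lz).
    by apply: hM => j; apply: hR.
  by exists (h' 1); rewrite hh' -hz /= scale1r.
apply: acyclic_approximation => // A hA; apply: splits_cycles => //.
  by apply: splits_of_disk; apply: hM; apply: (tilde_ex Xiso Xe _).2; apply: disk_tilde.
by apply: boundaries_of_dw; apply: hM => j; apply: hA.
Qed.
Hypothesis hcop : closed_coproducts X.

Lemma X_free (M : lmodType R) : X (freem M).
Proof. by apply: (hcop (@freem_coproduct R M)) => x; apply: hR. Qed.

Lemma X_syzygy (A : lmodType R) : X A -> X (subm (kerS (evid A))).
Proof. by move=> hA; apply: (frob_ker hXw (ker_ses (@evid_surj R A))) hA; apply: X_free. Qed.

Definition orthogonal_to (Y : obj_class (Ch R)) M : Prop := forall T, Y T -> splits (T : Ch R) M.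

Lemma orthogonal_at M : orthogonal_to (tilde X) M ->
  forall A : Mod R, X A -> forall k, splits A (M k).
Proof. by move=> hM A hA k; apply: splits_of_disk; apply: hM; apply: disk_tilde. Qed.

Lemma orthogonal_ext (Y : obj_class (Ch R)) A B D (f : chain_map A B) (g : chain_map B D) :
  @short_exact (Ch R) _ _ _ f g ->
  orthogonal_to Y A -> orthogonal_to Y D -> orthogonal_to Y B.
Proof.
by move=> se hA hD T hT; apply: (splits_ext_r (Ch_axioms R) se); [apply: hA|apply: hD].
Qed.

Lemma injective_embedding M : exists I C (i : chain_map M I) (q : chain_map I C),
  @short_exact (Ch R) _ _ _ i q /\ forall T, splits (T : Ch R) I.
Proof.
have /dchoice[j hj] k := injm_embed (M k).
have [i hi] := disk_to (F := fun k => injm (M k)) j.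
have [C [q [sq kq]]] := coker_chain i.
exists (disk (fun k => injm (M k))), C, i, q; split.
  split; [apply/Ch_monoP|exact: kq|exact/Ch_epiP].
  by move=> k x; rewrite hi => -[/hj].
move=> T; have [A [P [f [g [se pP]]]]] := enough_projectives (Ch_axioms R) T.
apply: (Ch_splits_of_extend se (projective_splits (Ch_axioms R) pP)) => a.
have [fi _ _ _] := (Ch_exactP f g).1 se.
(* Only the first components of a have to be extended, as they determine a chain map into the
   disks. *)
have /dchoice[b hb] k := injm_injective (f := (f : chain_map _ _) k)
  (fst \o (a : chain_map _ _) k : {linear _ -> injm (M k)}) (fi k).
have [B hB] := disk_to (F := fun k => injm (M k)) b.
exists B => k x; rewrite hB -cmap_bd !hb /= cmap_bd.
by case: (a k x).
Qed.

(** Ext^1(T, C) = Ext^2(T, M) = Ext^1(K, M), where the syzygy K of T for a cover by disks on free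
    modules is again in [tilde X]. *)
Lemma cosyzygy_tilde M I C (i : chain_map M I) (q : chain_map I C) :
  @short_exact (Ch R) _ _ _ i q -> (forall T, splits (T : Ch R) I) ->
  orthogonal_to (tilde X) M -> orthogonal_to (tilde X) C.
Proof.
move=> se hI hM T hT; have [F [p sp]] := projective_cover_ex T.
have [K [f [fi fex]]] := ker_chain p.
have sef : @short_exact (Ch R) _ _ _ f p by split; [apply/Ch_monoP| |apply/Ch_epiP].
have pP : projective (disk (fun k => freem (F k)) : Ch R).
  by apply: disk_projective => k; apply: Mod_projective_free.
apply: (splits_shift (Ch_axioms R) sef se _ _ (hI T)); first exact: (projective_splits (Ch_axioms R)).
apply: hM; apply: (tilde_ker Xiso (frob_ker hXw) sef) hT.
by apply: disk_tilde => // k; apply: X_free.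
Qed.

(** Ext^1(T, C) = Ext^2(T, M) lies between Ext^1(T', M) and Ext^2(V, M) = Ext^1(V, C). The last
    group vanishes because V is contractible and its terms are orthogonal to those of C. *)
Lemma cosyzygy_resdim n M I C (i : chain_map M I) (q : chain_map I C) :
  @short_exact (Ch R) _ _ _ i q -> (forall T, splits (T : Ch R) I) ->
  orthogonal_to (tilde X) M -> orthogonal_to (tilde (resdim w n)) M ->
  orthogonal_to (tilde (resdim w n.+1)) C.
Proof.
move=> se hI hM hMn T /tilde_step[T' [V [f [g [sef hV hT']]]]].
apply: (splits_shift (Ch_axioms R) sef se _ (hMn _ hT') (hI T)).
apply: splits_contracting_l => [|k]; first exact: (tilde_w_contracting hXw).
apply: (orthogonal_at (cosyzygy_tilde se hI hM)).
by apply: (tilde_ex Xiso Xe _).2; apply: (tilde_sub hXw).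
Qed.

(** The kernel is the desuspension of M, and [tilde Y] is stable under suspension. *)
Lemma disk_cover M : exists N D (f : chain_map N D) (g : chain_map D M),
  [/\ @short_exact (Ch R) _ _ _ f g, acyclic D
    & forall Y, closed_iso Y -> orthogonal_to (tilde Y) M -> orthogonal_to (tilde Y) N].
Proof.
have [N [th [th' [h1 h2]]]] := down_ex M; have [i [p [se hi hp]]] := disk_embed N.
have [ii pi ip ps] := (Ch_exactP _ _).1 se.
exists N, (disk N), i, (chain_comp th p); split; last 1 first.
- move=> Y iso hM T hT; apply: splits_up.
  apply: (splits_retract (Ch_axioms R) (f := th') (g := th) _ (hM _ (up_tilde iso hT))).
  by apply: chain_eq => k x; apply: h2.
- apply/Ch_exactP; split=> k.
  + exact: ii.
  + by move=> x; rewrite /= pi linear0.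
  + by move=> y /= e; apply: ip; rewrite -[LHS]h2 e linear0.
  + by move=> z; have [y hy] := ps k (th' k z); exists y; rewrite /= hy h1.
- exact: disk_acyclic.
Qed.

(* After m cosyzygies M becomes orthogonal to tilde (resdim w m); descending
   again, the kernel is corrected by a pullback and a disk cover. *)
Lemma acyclic_precover b n M : (n + b = m)%N ->
  orthogonal_to (tilde X) M -> orthogonal_to (tilde (resdim w n)) M ->
  exists N E (f : chain_map N E) (g : chain_map E M),
    [/\ @short_exact (Ch R) _ _ _ f g, acyclic E, orthogonal_to (tilde X) N
      & orthogonal_to (tilde (resdim w m)) N].
Proof.
elim: b n M => [|b IH] n M.
  rewrite addn0 => -> hM hMm; have [N [D [f [g [se aD hN]]]]] := disk_cover M.
  exists N, D, f, g; split=> //; first exact: hN.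
  by apply: hN => //; apply: resdim_iso.
move=> nb hM hMn; have [I [C [i [q [se hI]]]]] := injective_embedding M.
have [|||N1 [E1 [f1 [g1 [se1 aE1 hN1 hN1m]]]]] := IH n.+1 C.
- by rewrite addSnnS.
- exact: cosyzygy_tilde se hI hM.
- exact: cosyzygy_resdim se hI hM hMn.
have [ii qi iq qs] := (Ch_exactP _ _).1 se.
have [fi gf fg gs] := (Ch_exactP _ _).1 se1.
(* Y is the pullback of I and E1 over C. It is an extension of E1 by M, through u, and of I by N1,
   through v; the second shows that Y inherits the orthogonality of N1. *)
have [Y [y [yi yex]]] : exists Y (y : chain_map Y (prodcx I E1)),
    (forall k x, y k x = 0 -> x = 0) /\
    forall k p, q k p.1 = g1 k p.2 <-> exists x, y k x = p.
  have [d hd] : exists d : forall k, {linear prodcx I E1 k -> C k},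
      forall k p, d k p = q k p.1 - g1 k p.2.
    have /dchoice[d hd] k := prod_lin (q k) (\- g1 k : {linear _ -> _}).
    by exists d => k p; rewrite hd.
  have [|Y [y [yi yex]]] := @subcomplex_ex R (prodcx I E1) (fun k => kerS (d k)).
    by move=> k p /=; rewrite !hd /= !cmap_bd -linearB => ->; rewrite linear0.
  exists Y, y; split=> // k p; rewrite -yex /= hd; split=> [->|/eqP]; first exact: subrr.
  by rewrite subr_eq0 => /eqP.
have [y1 hy1] : exists y1 : chain_map Y I, forall k x, y1 k x = (y k x).1.
  have c k x : (fst \o y (k - 1)) (bd Y k x) = bd I k ((fst \o y k) x) by rewrite /= cmap_bd.
  by exists (@ChainMap R Y I (fun k => fst \o y k : {linear _ -> I k}) c).
have [y2 hy2] : exists y2 : chain_map Y E1, forall k x, y2 k x = (y k x).2.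
  have c k x : (snd \o y (k - 1)) (bd Y k x) = bd E1 k ((snd \o y k) x) by rewrite /= cmap_bd.
  by exists (@ChainMap R Y E1 (fun k => snd \o y k : {linear _ -> E1 k}) c).
have yeq k x : q k (y1 k x) = g1 k (y2 k x) by rewrite hy1 hy2; apply/yex; exists x.
have ymk k a e : q k a = g1 k e -> exists2 x, y1 k x = a & y2 k x = e.
  by move=> h; have [x hx] := (yex k (a, e)).1 h; exists x; rewrite ?hy1 ?hy2 hx.
have y0 k x : y1 k x = 0 -> y2 k x = 0 -> x = 0.
  rewrite hy1 hy2; case: (y k x) (yi k x) => [a e] h /= ha he; apply: h.
  by rewrite ha he.
have [u hu] : exists u : chain_map M Y, forall k x, y1 k (u k x) = i k x /\ y2 k (u k x) = 0.
  have [||||u hu] := @graph_chain R M Y (fun k x z => y1 k z = i k x /\ y2 k z = 0).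
  - move=> k x; have [|z h1 h2] := ymk k (i k x) 0; first by rewrite qi linear0.
    by exists z.
  - by move=> k z [h1 h2]; apply: y0 => //; rewrite h1 linear0.
  - by move=> k a x z x' z' [h1 h2] [h1' h2']; rewrite !linearP h1 h1' h2 h2' scaler0 addr0.
  - by move=> k x z [h1 h2]; rewrite !cmap_bd h1 h2 linear0.
  - by exists u.
have [v hv] : exists v : chain_map N1 Y, forall k x, y1 k (v k x) = 0 /\ y2 k (v k x) = f1 k x.
  have [||||v hv] := @graph_chain R N1 Y (fun k x z => y1 k z = 0 /\ y2 k z = f1 k x).
  - move=> k x; have [|z h1 h2] := ymk k 0 (f1 k x); first by rewrite gf linear0.
    by exists z.
  - by move=> k z [h1 h2]; apply: y0 => //; rewrite h2 linear0.
  - by move=> k a x z x' z' [h1 h2] [h1' h2']; rewrite !linearP h1 h1' h2 h2' scaler0 addr0.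
  - by move=> k x z [h1 h2]; rewrite !cmap_bd h1 h2 linear0.
  - by exists v.
have seY : @short_exact (Ch R) _ _ _ v y1.
  apply/Ch_exactP; split=> k.
  - by move=> x e; apply: (fi k); rewrite -(hv k x).2 e linear0.
  - by move=> x; apply: (hv k x).1.
  - move=> z hz; have [x hx] : exists x, f1 k x = y2 k z.
      by apply: fg; rewrite -yeq hz linear0.
    exists x; apply/eqP; rewrite -subr_eq0; apply/eqP/y0.
      by rewrite linearB (hv k x).1 hz subrr.
    by rewrite linearB (hv k x).2 hx subrr.
  - by move=> a; have [e he] := gs k (q k a); have [z hz _] := ymk k a e (esym he); exists z.
have hIo Z : orthogonal_to Z I by move=> T _; apply: hI.
have hY := orthogonal_ext seY hN1 (hIo _); have hYm := orthogonal_ext seY hN1m (hIo _).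
(* The kernel E of D -> Y -> E1 is acyclic, since D and E1 are. It maps onto M = ker (Y -> E1) with
   kernel N, which is a desuspension of Y. *)
have [N [D [f [g [seD aD hN]]]]] := disk_cover Y.
have [fi' gf' fg' gs'] := (Ch_exactP _ _).1 seD.
have [E [j [ji jex]]] := ker_chain (chain_comp y2 g).
have y2s k e : exists z, y2 k z = e.
  by have [a ha] := qs k (g1 k e); have [z _ hz] := ymk k a e ha; exists z.
have seE : @short_exact (Ch R) _ _ _ j (chain_comp y2 g).
  split; [exact/Ch_monoP|exact: jex|apply/Ch_epiP => k e].
  by have [z <-] := y2s k e; have [d <-] := gs' k z; exists d.
have uim k z : y2 k z = 0 -> exists x, u k x = z.
  move=> hz; have [x hx] : exists x, i k x = y1 k z by apply: iq; rewrite yeq hz linear0.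
  exists x; apply/eqP; rewrite -subr_eq0; apply/eqP/y0.
    by rewrite linearB (hu k x).1 hx subrr.
  by rewrite linearB (hu k x).2 hz subrr.
have ui k x : u k x = 0 -> x = 0.
  by move=> e; apply: (ii k); rewrite -(hu k x).1 e linear0.
have jE k x : y2 k (g k (j k x)) = 0 by apply/(jex k); exists x.
have [p hp] : exists p : chain_map E M, forall k x, u k (p k x) = g k (j k x).
  apply: (lift_chain (g := y2) (h := chain_comp g j)) => // k z.
  by split=> [/uim//|[x <-]]; apply: (hu k x).2.
have [r hr] : exists r : chain_map N E, forall k x, j k (r k x) = f k x.
  apply: (lift_chain (g := chain_comp y2 g) (h := f)) => // k x.
  by rewrite /= gf' linear0.
exists N, E, r, p; split.
- apply/Ch_exactP; split=> k.
  + by move=> x e; apply: (fi' k); rewrite -hr e linear0.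
  + by move=> x; apply: ui; rewrite hp hr gf'.
  + move=> x e; have [z hz] : exists z, f k z = j k x by apply: fg'; rewrite -hp e linear0.
    by exists z; apply: (inj_lin (ji k)); rewrite hr.
  + move=> x; have [d hd] := gs' k (u k x).
    have [z hz] : exists z, j k z = d by apply/(jex k); rewrite /= hd (hu k x).2.
    by exists z; apply: (inj_lin (ui k)); rewrite hp hz.
- exact: acyclic_left seE aD aE1.
- exact: hN.
- by apply: hN => //; apply: resdim_iso.
Qed.
End Completeness.

(* The choices are made upwards from n0; below n0 the family is z. *)
Lemma int_choice (St : int -> Type) (Rel : forall k, St (k - 1) -> St k -> Prop)
    (z : forall k, St k) (n0 : int) (s0 : St n0) :
  (forall k s, exists s', Rel k s s') -> (forall k, Rel k (z (k - 1)) (z k)) ->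
  Rel n0 (z (n0 - 1)) s0 ->
  exists st : forall k, St k, st n0 = s0 /\ forall k, Rel k (st (k - 1)) (st k).
Proof.
move=> tot zz z0.
have [F hF] : exists F : forall k, St (k - 1) -> St k, forall k s, Rel k s (F k s).
  by exists (fun k => projT1 (choice (tot k))) => k; apply: (projT2 (choice (tot k))).
have pr (j : nat) (k : int) : n0 + j.+1 = k -> n0 + j = k - 1 by lia.
(* The degree k is kept apart from n0 + j and tied to it by an equation, so that F applies without
   transports; the only one occurs at j = 0. *)
pose fix up_st (j : nat) : forall k, n0 + j = k -> St k :=
  match j return forall k, n0 + j = k -> St k with
  | 0 => fun k e => eq_rect n0 St s0 k (etrans (esym (addr0 n0)) e)
  | j'.+1 => fun k e => F k (up_st j' (k - 1) (pr j' k e))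
  end.
pose st (k : int) := match pselect (exists j : nat, n0 + j = k) with
  | left e => up_st (projT1 (cid e)) k (projT2 (cid e)) | right _ => z k end.
have stE (j : nat) (k : int) (e : n0 + j = k) : st k = up_st j k e.
  rewrite /st; case: pselect => [e'|]; last by case; exists j.
  case: (cid e') => j' /= e2; have ej : j' = j by lia.
  by subst j'; congr (up_st _ _ _); apply: Prop_irrelevance.
have stz (k : int) : k < n0 -> st k = z k.
  by move=> h; rewrite /st; case: pselect => // e; exfalso; case: e => j e; lia.
have st0 : st n0 = s0.
  by rewrite (stE 0%N n0 (addr0 n0)) /= (eq_irrelevance (etrans _ _) erefl).
exists st; split=> // k.
have [h|[h|h]] : k < n0 \/ (k = n0 \/ n0 < k) by lia.
- by rewrite !stz //; lia.
- by subst k; rewrite st0 stz //; lia.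
have [j hj] : exists j : nat, n0 + j.+1 = k :> int by exists `|(k - n0 - 1)%R|%N; lia.
by rewrite (stE j.+1 k hj) (stE j (k - 1) (pr j k hj)) /=; apply: hF.
Qed.

(** * Cycles of acyclic complexes orthogonal to [tilde X] *)

Section Cycles.
Variables (R : pzRingType) (m : nat) (X w : obj_class (Mod R)).
Hypothesis hXw : frobenius_pair X w.
Hypothesis hR : X (R^o : lmodType R).
Hypothesis hcop : closed_coproducts X.
Implicit Types M E T K : chain_complex R.

Let Xiso : closed_iso X := closed_summands_iso (Mod_axioms R) (frob_summand hXw).

(* T is a free resolution of A, augmented by A itself in degree n; the map f is
   built by lifting along the exactness of E. *)
Lemma augmented_resolution E n (A : lmodType R) (h : {linear A -> cyc E n}) :
  acyclic E -> X A ->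
  exists T (f : chain_map T E) (i : {linear A -> T n}),
    [/\ tilde X T, forall x, bd T n (i x) = 0 & forall x, f n (i x) = cyci E n (h x)].
Proof.
move=> aE hA.
pose St k := {Z : {Z : lmodType R | X Z} & {linear sval Z -> cyc E k}}.
(* A state in degree k is the module of cycles of T in that degree together with its map to the
   cycles of E; [Rel] supplies the term of T joining two successive states. *)
pose mk k (Z : lmodType R) (hZ : X Z) (g : {linear Z -> cyc E k}) : St k := existT _ (exist _ Z hZ) g.
pose Rel k (s : St (k - 1)) (s' : St k) :=
  exists (P : lmodType R) (i : {linear sval (tag s') -> P}) (p : {linear P -> sval (tag s)})
    (t : {linear P -> E k}),
  [/\ @short_exact (Mod R) _ _ _ i p, forall x, t (i x) = cyci E k (tagged s' x)
    & forall x, bd E k (t x) = cyci E (k - 1) (tagged s (p x))].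
(* The complex T is zero below degree n, so X must contain a zero module: the kernel of the identity
   of R. *)
have seO : @short_exact (Mod R) _ _ _ (subi (kerS (idfun : {linear R^o -> R^o}))) (idfun : {linear R^o -> R^o}).
  by apply: ker_ses => y; exists y.
set O := subm _ in seO.
have hO : X O by apply: (frob_ker hXw seO).
have O0 (x : O) : x = 0.
  by apply: subi_inj; rewrite linear0; apply: (subi_mem (S := kerS (idfun : {linear R^o -> R^o})) x).
pose z k : St k := mk k O hO (\0 : {linear O -> cyc E k}).
have totR k (s : St (k - 1)) : exists s', Rel k s s'.
  case: s => -[Z hZ] g; have seZ := ker_ses (@evid_surj R Z).
  have [e [see he]] := cyc_ses k aE; have [_ _ es] := see.
  have [t0 ht0] := projective_lift (Mod_axioms R) (g \o evid Z : {linear freem Z -> cyc E (k - 1)})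
    (@Mod_projective_free R Z) es.
  pose t : {linear freem Z -> E k} := t0.
  have ht x : bd E k (t x) = cyci E (k - 1) (g (evid Z x)).
    rewrite -he; congr (cyci E (k - 1) _).
    by have := congr1 (fun v : {linear freem Z -> cyc E (k - 1)} => v x) ht0.
  have [_ ej _ _] := (Mod_exactP _ _).1 seZ.
  have [g' hg'] : exists g' : {linear subm (kerS (evid Z)) -> cyc E k},
      forall x, cyci E k (g' x) = t (subi (kerS (evid Z)) x).
    apply: (cyc_lift (f := t \o subi (kerS (evid Z)))) => x.
    by rewrite -[LHS]/(bd E k (t (subi (kerS (evid Z)) x))) ht ej !linear0.
  exists (mk k _ (X_syzygy hXw hR hcop hZ) g').
  by exists (freem Z), (subi _), (evid Z), t; split.
have zR k : Rel k (z (k - 1)) (z k).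
  exists O, idfun, \0, \0; split=> [|x|x]; rewrite ?linear0 //.
  by apply/Mod_exactP; split=> // [y _|y]; [exists y|exists 0; rewrite [RHS]O0].
have z0 : Rel n (z (n - 1)) (mk n A hA h).
  exists A, idfun, \0, (cyci E n \o h); split=> [|x|x] //.
    by apply/Mod_exactP; split=> // [y _|y]; [exists y|exists 0; rewrite [RHS]O0].
  by rewrite -[LHS]/(bd E n (cyci E n (h x))) bd_cyci linear0.
have [st [stn /dchoice[P /dchoice[i /dchoice[p /dchoice[t hst]]]]]] := int_choice totR zR z0.
have se k : @short_exact (Mod R) _ _ _ (i k) (p k) by case: (hst k).
have ct k x : t (k - 1) (bd (splice_cx se) k x) = bd E k (t k x).
  by have [_ _ ->] := hst k; have [_ h1 _] := hst (k - 1); apply: h1.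
(* The state is generalized because the types of the chosen maps depend on it, which rules out
   rewriting with stn directly. *)
have key (s : St n) : s = mk n A hA h ->
    (exists j : {linear sval (tag s) -> P n}, forall x,
      bd (splice_cx se) n (j x) = 0 /\ t n (j x) = cyci E n (tagged s x)) ->
    exists j : {linear A -> P n}, forall x,
      bd (splice_cx se) n (j x) = 0 /\ t n (j x) = cyci E n (h x).
  by move=> ->.
have [|j hj] := key (st n) stn.
  exists (i n) => x; split; first by apply/splice_cx_ker; exists x.
  by have [_ -> _] := hst n.
exists (splice_cx se), (@ChainMap R (splice_cx se) E t ct), j; split=> [|x|x].
- apply/(tildeP _ Xiso); split=> [|k]; first exact: splice_cx_acyclic.
  by apply: splice_cx_cyc => //; apply: (svalP (tag (st k))).
- exact: (hj x).1.
- exact: (hj x).2.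
Qed.

(** A map from A to the cycles extends to a chain map from an augmented resolution in which A
    consists of cycles; orthogonality makes that chain map a boundary on cycles, which lifts the
    given map. *)
Lemma splits_cycles_of_orthogonal E : acyclic E -> orthogonal_to (tilde X) E ->
  forall A : Mod R, X A -> forall k, splits A (cyc E k).
Proof.
move=> aE hE A hA; apply: splits_cycles => //; first exact: (orthogonal_at hXw hE hA).
move=> k h; have [T [f [i [hT di fi]]]] := augmented_resolution h aE hA.
have [al hal] := null_on_cycles f (hE _ (up_tilde Xiso hT)) k.
by exists (al \o i) => x; rewrite -[LHS]/(bd E k (al (i x))) hal ?fi ?di.
Qed.

Hypothesis hcomplete : totally_left_complete m X w.

Lemma tilde_precover M : orthogonal_to (tilde X) M ->
  exists K L (f : chain_map K L) (g : chain_map L M),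
    [/\ @short_exact (Ch R) _ _ _ f g, @resdim (Ch R) (tilde w) m L
      & forall T, tilde (resdim w m) T -> splits (T : Ch R) K].
Proof.
move=> hM; have hM0 : orthogonal_to (tilde (resdim w 0)) M.
  by move=> T hT; apply: hM; apply: (tilde_sub hXw).
have [N [E [f [g [se aE hN hNm]]]]] :=
  acyclic_precover hXw hR hcop (add0n m) hM hM0.
have hE := orthogonal_ext se hN hM.
have [K [L [f1 [g1 [se1 hL hK]]]]] :=
  acyclic_approximation hXw hcomplete aE (splits_cycles_of_orthogonal aE hE).
have [fi gf fg gs] := (Ch_exactP _ _).1 se; have [fi1 gf1 fg1 gs1] := (Ch_exactP _ _).1 se1.
(* The kernel of L -> E -> M is an extension of N by K, both of which are orthogonal to
   [tilde (resdim w m)]. *)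
have [K' [j [ji jex]]] := ker_chain (chain_comp g g1).
have jE k x : g k (g1 k (j k x)) = 0 by apply/(jex k); exists x.
have sej : @short_exact (Ch R) _ _ _ j (chain_comp g g1).
  split; [exact/Ch_monoP|exact: jex|apply/Ch_epiP => k e].
  by have [x <-] := gs k e; have [y <-] := gs1 k x; exists y.
exists K', L, j, (chain_comp g g1); split=> //.
have fex k : lin_exact (f k) (g k) by case: se => _ h _; apply: h.
have [p hp] : exists p : chain_map K' N, forall k x, f k (p k x) = g1 k (j k x).
  by apply: (lift_chain (g := g) (h := chain_comp g1 j)).
have [r hr] : exists r : chain_map K K', forall k x, j k (r k x) = f1 k x.
  apply: (lift_chain (g := chain_comp g g1) (h := f1)) => // k x.
  by rewrite /= gf1 linear0.
have serp : @short_exact (Ch R) _ _ _ r p.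
  apply/Ch_exactP; split=> k.
  - by move=> x e; apply: (fi1 k); rewrite -hr e linear0.
  - by move=> x; apply: (fi k); rewrite hp hr gf1.
  - move=> x e; have [y hy] : exists y, f1 k y = j k x by apply: fg1; rewrite -hp e linear0.
    by exists y; apply: (inj_lin (ji k)); rewrite hr.
  - move=> y; have [x hx] := gs1 k (f k y).
    have [u hu] : exists u, j k u = x by apply/(jex k); rewrite /= hx gf.
    by exists u; apply: (inj_lin (fi k)); rewrite hp hu.
by move=> T hT; apply: (splits_ext_r (Ch_axioms R) serp); [apply: hK|apply: hNm].
Qed.
End Cycles.

Theorem proposition5p5 (R : pzRingType) (m : nat) (X w : obj_class (Mod R))
    (hXw : frobenius_pair X w)
    (hcomplete : totally_left_complete m X w)
    (hR : X (R^o : lmodType R)) :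
  [/\ left_complete m (dw_tilde X) (tilde w),
      left_complete m (dg_tilde X w) (tilde w)
    & closed_coproducts X ->
      left_complete m (tilde X) (tilde w) /\
      left_complete m (ex_tilde X) (tilde w)].
Proof.
have dw := dw_left_complete hXw hcomplete hR.
split=> [//||hcop].
  suff -> : @dg_tilde R X w = @dw_tilde R X by [].
  by apply: funext => A; apply: propext; apply: dg_tildeE.
split.
  apply: (left_complete_of hXw (tilde_frobenius hXw)).
  exact: (tilde_precover hXw hR hcop hcomplete).
apply: (left_complete_of hXw (ex_frobenius hXw)) => M hM.
(* As [tilde X] is contained in [ex_tilde X], orthogonality to the latter implies what the
   construction for [tilde X] asks of M. *)
apply: (tilde_precover hXw hR hcop hcomplete) => T hT; apply: hM.
have Xiso : closed_iso X := closed_summands_iso (Mod_axioms R) (frob_summand hXw).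
by apply: (tilde_ex Xiso (frob_ext hXw)).
Qed.
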